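(* Let $n,k\ge1$ be integers, $\mathbb{X}=\{x_1,\dots,x_n\}$ a finite alphabet, $\mathbb{Y}$ another alphabet, and $\lambda$ a partition. Then $$\int_{\mathbb{Y}}Q_\lambda^{(1/k)}(\mathbb{X}^\vee)\,\Delta(\mathbb{X})^{2k}=(-1)^{\frac{kn(n-1)}{2}}\binom{nk}{k,\dots,k}\left(b^{(k)}_{n^{k(n-1)}}\right)^{-1}Q^{(k)}_{n^{k(n-1)}/\lambda'}(\mathbb{Y}),$$ where $$b^{(k)}_{n^{k(n-1)}}=\frac{(2(n-1))!\,(nk)!\,((n-1)k)!}{k\,n!\,(n-1)!\,((2n-1)k-1)!}.$$
   Context: $\binom{nk}{k,\dots,k}=\frac{(nk)!}{(k!)^n}$; $n^{k(n-1)}$ is the partition with $k(n-1)$ parts equal to $n$ (empty if $n=1$); $\lambda'$ is the conjugate partition of $\lambda$; $\mathbb{X}^\vee=\{x_1^{-1},\dots,x_n^{-1}\}$; $\Delta(\mathbb{X})=\prod_{i<j}(x_i-x_j)$. $\int_{\mathbb{Y}}$ is the substitution $x^p\mapsto\Lambda^p(\mathbb{Y})$ for each $x\in\mathbb{X}$, $p\in\mathbb{Z}$, i.e. the linear map on Laurent polynomials with $\int_{\mathbb{Y}}x_1^{p_1}\cdots x_n^{p_n}=\Lambda^{p_1}(\mathbb{Y})\cdots\Lambda^{p_n}(\mathbb{Y})$, where $\Lambda^m$ is the $m$-th elementary symmetric function ($\Lambda^0=1$, $\Lambda^m=0$ for $m<0$). Jack polynomials: let $\Psi_\lambda$ be the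 products of power sums and $\langle\Psi_\lambda,\Psi_\mu\rangle_\alpha=\delta_{\lambda\mu}z_\lambda\alpha^{\ell(\lambda)}$, where $z_\lambda=\prod_i i^{m_i(\lambda)}m_i(\lambda)!$, $m_i(\lambda)$ is the multiplicity of $i$ in $\lambda$ and $\ell(\lambda)$ the length of $\lambda$. The Jack polynomials $P_\lambda^{(\alpha)}$ are the unique symmetric functions orthogonal for $\langle\,,\rangle_\alpha$ with $P_\lambda^{(\alpha)}=m_\lambda+\sum_{\mu<\lambda}u^{(\alpha)}_{\lambda\mu}m_\mu$ ($m_\mu$ the monomial functions, $<$ the dominance order). $(Q_\lambda^{(\alpha)})$ is the basis dual to $(P_\lambda^{(\alpha)})$ for $\langle\,,\rangle_\alpha$, and $$b_\lambda^{(\alpha)}=\langle P_\lambda^{(\alpha)},P_\lambda^{(\alpha)}\rangle_\alpha^{-1}=Q_\lambda^{(\alpha)}/P_\lambda^{(\alpha)}=\prod_{(i,j)\in\lambda}\frac{\alpha(\lambda_i-j)+\lambda'_j-i+1}{\alpha(\lambda_i-j+1)+\lambda'_j-i}.$$ Skew functions: $Q^{(\alpha)}_{\lambda/\mu}$ is defined by $\langle Q^{(\alpha)}_{\lambda/\mu},P^{(\alpha)}_\nu\rangle_\alpha=\langle Q^{(\alpha)}_\lambda,P^{(\alpha)}_\mu P^{(\alpha)}_\nu\rangle_\alpha$ for all partitions $\nu$. *)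

(* Defs.v *)
Set Warnings "-notation-overridden,-notation-incompatible-prefix".
From HB Require Import structures.
From mathcomp Require Import all_boot all_order all_algebra finmap.
From mathcomp Require Export monalg.

Set Implicit Arguments.
Unset Strict Implicit.
Unset Printing Implicit Defensive.

Import GRing.Theory.
Local Open Scope ring_scope.

(** * Integer partitions *)

Definition is_part (s : seq nat) := sorted geq s && (0%N \notin s).

Record intpart : predArgType :=
  IntPart { parts :> seq nat; _ : is_part parts }.

HB.instance Definition _ := [isSub for parts].
HB.instance Definition _ := [Choice of intpart by <:].

Lemma mkpart_subproof (s : seq nat) :
  is_part (sort geq [seq i <- s | (0 < i)%N]).
Proof.
rewrite /is_part sort_sorted /=; last by move=> a b; apply: leq_total.
by rewrite mem_sort mem_filter.
Qed.

(* The partition whose parts are the nonzero entries of s. *)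
Definition mkpart (s : seq nat) : intpart := IntPart (mkpart_subproof s).

Lemma mkpart_perm (s t : seq nat) :
  perm_eq s t -> mkpart s = mkpart t.
Proof.
move=> st; apply/val_inj/perm_sortP => /=.
- by move=> a b; apply: leq_total.
- by move=> b a c /= ba cb; apply: leq_trans cb ba.
- by move=> a b /=; rewrite andbC; apply: anti_leq.
- exact: perm_filter.
Qed.

Lemma filter_parts (la : intpart) : [seq i <- parts la | (0 < i)%N] = la.
Proof.
apply/all_filterP/allP => -[|//] la0.
by case: la la0 => s /= /andP[_ /negP].
Qed.

Lemma mkpartK (la : intpart) : mkpart la = la.
Proof.
apply: val_inj; rewrite /= filter_parts; case: la => s /= /andP[s_sorted _].
by apply: sorted_sort => // b a c /= ba cb; apply: leq_trans cb ba.
Qed.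

Lemma perm_mkpart (s : seq nat) :
  perm_eq (mkpart s) [seq i <- s | (0 < i)%N].
Proof. by rewrite /= perm_sort. Qed.

(* la'_j = #{i | la_i >= j}; mkpart drops the j beyond the first part. *)
Definition conj_part (la : intpart) : intpart :=
  mkpart [seq count (leq j) la | j <- iota 1 (sumn la)].

(* The partition n^m, that is, m parts equal to n. *)
Definition rect_part (n m : nat) : intpart := mkpart (nseq m n).

Definition dominated (mu la : intpart) : Prop :=
  sumn mu = sumn la /\
  forall i : nat, (sumn (take i mu) <= sumn (take i la))%N.

Definition strictly_dominated (mu la : intpart) : Prop :=
  dominated mu la /\ mu <> la.

Definition zee (la : intpart) : nat :=
  (\prod_(i <- undup la) (i ^ count_mem i la * (count_mem i la)`!))%N.

(** * The ring of symmetric functions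
    Over the rationals it is the polynomial algebra on the power sums, so the
    products of power sums Psi_la form a linear basis indexed by partitions,
    on which multiplication is the union of partitions.  It is therefore the
    algebra of the commutative monoid of partitions under union. *)

Definition union_part (la mu : intpart) : intpart :=
  mkpart (parts la ++ parts mu).

Lemma union_partA : associative union_part.
Proof.
move=> la mu nu; apply: mkpart_perm.
rewrite (perm_trans (y := la ++ mu ++ nu)) //.
  rewrite perm_cat2l; apply: perm_trans (perm_mkpart _) _.
  by rewrite filter_cat !filter_parts.
rewrite perm_sym catA perm_cat2r; apply: perm_trans (perm_mkpart _) _.
by rewrite filter_cat !filter_parts.
Qed.

Lemma union_partC : commutative union_part.
Proof. by move=> la mu; apply: mkpart_perm; rewrite perm_catC. Qed.

Lemma union0part : left_id (mkpart [::]) union_part.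
Proof. by move=> la; rewrite /union_part /= mkpartK. Qed.

Lemma unionpart0 : right_id (mkpart [::]) union_part.
Proof. by move=> la; rewrite union_partC union0part. Qed.

Lemma union_part_unit (la mu : intpart) :
  union_part la mu = mkpart [::] -> la = mkpart [::] /\ mu = mkpart [::].
Proof.
move=> /(congr1 (size \o parts)) /=.
rewrite !size_sort /= filter_cat size_cat !filter_parts => /eqP.
by rewrite addn_eq0 !size_eq0 => /andP[/eqP la0 /eqP mu0];
  split; apply: val_inj.
Qed.

HB.instance Definition _ := Choice_isMonomialDef.Build intpart
  union_partA union0part unionpart0 union_part_unit.
HB.instance Definition _ := MonomialDef_isConomialDef.Build intpart union_partC.

Notation symfun := {malg rat[intpart]}.

Definition psi (la : intpart) : symfun := << la >>.
Definition powersum (i : nat) : symfun := psi (mkpart [:: i]).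

(* esyms m = [:: e_0; e_1; ...; e_m] by Newton's identities
   m e_m = \sum_(1 <= i <= m) (-1)^(i-1) p_i e_(m-i); see [sfeval_esym]. *)
Fixpoint esyms (m : nat) : seq symfun :=
  if m is m'.+1 then
    let s := esyms m' in
    rcons s (m%:R^-1 *:
      \sum_(i < m) (-1) ^+ i * powersum i.+1 * nth 0 s (m' - i))
  else [:: 1].

Definition esym (m : nat) : symfun := nth 0 (esyms m) m.

(** * Alphabets and evaluation
    An alphabet with values in A is a specialization of symmetric functions,
    given by the values X i of its power sums for i >= 1 (X 0 is not used). *)

Definition alphabet (A : comAlgType rat) := nat -> A.

Definition finite_alphabet (A : comAlgType rat) (N : nat) (x : 'I_N -> A) :
  alphabet A := fun i => \sum_(j < N) x j ^+ i.

Section Evaluation.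
Variables (A : comAlgType rat) (X : alphabet A).

Definition psi_eval (la : intpart) : A := \prod_(i <- la) X i.

Lemma psi_eval_mmorphism : mmorphism psi_eval.
Proof.
split=> [la mu|]; last by rewrite /psi_eval big_nil.
rewrite /psi_eval (perm_big _ (perm_mkpart _)) filter_cat !filter_parts.
by rewrite big_cat.
Qed.

HB.instance Definition _ :=
  isMultiplicative.Build intpart A psi_eval psi_eval_mmorphism.

Definition sfeval : symfun -> A := mmap (in_alg A) psi_eval.

HB.instance Definition _ := GRing.RMorphism.on sfeval.

Lemma sfeval_scalable : scalable sfeval.
Proof.
by move=> c f; rewrite /sfeval mmapZ ?mulr_algl //= => *; apply: mulrC.
Qed.

HB.instance Definition _ :=
  GRing.isScalable.Build rat symfun A *:%R sfeval sfeval_scalable.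
End Evaluation.

Lemma sfeval_powersum (A : comAlgType rat) (X : alphabet A) (i : nat) :
  (0 < i)%N -> sfeval X (powersum i) = X i.
Proof.
case: i => // i _; rewrite /sfeval /powersum /psi mmapU /= /psi_eval /=.
by rewrite scale1r mul1r big_seq1.
Qed.

Lemma size_esyms m : size (esyms m) = m.+1.
Proof. by elim: m => //= m IH; rewrite size_rcons IH. Qed.

Lemma nth_esyms m i : (i <= m)%N -> nth 0 (esyms m) i = esym i.
Proof.
elim: m => [|m IH]; first by rewrite leqn0 => /eqP->.
rewrite leq_eqVlt => /predU1P[->//|]; rewrite ltnS => le_im /=.
by rewrite nth_rcons size_esyms ltnS le_im IH.
Qed.

Lemma esym0 : esym 0 = 1. Proof. by []. Qed.

Lemma esymS m :
  m.+1%:R *: esym m.+1 = \sum_(i < m.+1) (-1) ^+ i * powersum i.+1 * esym (m - i).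
Proof.
rewrite {1}/esym /= nth_rcons size_esyms ltnn eqxx scalerA mulfV ?scale1r.
  by apply: eq_bigr => i _; rewrite nth_esyms // leq_subr.
by rewrite Num.Theory.pnatr_eq0.
Qed.

(* The values of e_m on a finite alphabet are the coefficients of
   \prod_i (1 + x_i t). *)
Lemma sfeval_esym (A : comAlgType rat) (N : nat) (x : 'I_N -> A) (m : nat) :
  sfeval (finite_alphabet x) (esym m) = (\prod_(i < N) (1 + (x i)%:P * 'X))`_m.
Proof.
pose E N (x : 'I_N -> A) k := (\prod_(i < N) (1 + (x i)%:P * 'X))`_k.
rewrite -/(E N x m).
have E0 N' (y : 'I_N' -> A) : E N' y 0 = 1.
  rewrite /E -horner_coef0 horner_prod big1 // => i _.
  by rewrite !hornerE.
have ES N' (y : 'I_N'.+1 -> A) k : E _ y k.+1 =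
    E _ (y \o widen_ord (leqnSn _)) k.+1
    + y ord_max * E _ (y \o widen_ord (leqnSn _)) k.
  rewrite /E big_ord_recr /= mulrDr mulr1 coefD; congr (_ + _).
  by rewrite mulrA coefMX /= mulrC coefCM.
have newton N' (y : 'I_N' -> A) k :
  E _ y k.+1 *+ k.+1 =
    \sum_(i < k.+1) (-1) ^+ i * finite_alphabet y i.+1 * E _ y (k - i)%N.
  elim: N' y k => [|N' IH] y k.
    rewrite [E _ y k.+1]/E big_ord0 coef1 mul0rn big1 // => i _.
    by rewrite /finite_alphabet big_ord0 mulr0 mul0r.
  pose y' := y \o widen_ord (leqnSn N'); pose z := y ord_max.
  have {}ES j : E _ y j.+1 = E _ y' j.+1 + z * E _ y' j by apply: ES.
  have zE j : \sum_(i < j.+1) (-1) ^+ i * z ^+ i.+1 * E _ y (j - i)%N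
      = z * E _ y' j.
    elim: j => [|j IHj]; first by rewrite big_ord1 !E0 expr0 expr1 mul1r.
    rewrite big_ord_recl /= expr0 expr1 mul1r ES mulrDr -[RHS]addr0 -addrA.
    congr (_ + _); rewrite -IHj mulr_sumr -big_split big1 // => i _ /=.
    by rewrite subSS [(-1) ^+ _.+1]exprS [z ^+ i.+2]exprS !mulNr mul1r !mulrA
      [z * _]mulrC addrN.
  have fa j : finite_alphabet y j = finite_alphabet y' j + z ^+ j.
    by rewrite /finite_alphabet big_ord_recr.
  under eq_bigr do [rewrite fa; rewrite mulrDr mulrDl].
  rewrite big_split /= zE ES mulrnDl -mulrnAr [E _ y' k *+ _]mulrS.
  suff -> : \sum_(i < k.+1) (-1) ^+ i * finite_alphabet y' i.+1 * E _ y (k - i)%N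
      = E _ y' k.+1 *+ k.+1 + z * (E _ y' k *+ k).
    by rewrite -addrA mulrDr [z * _ + z * _]addrC.
  case: k => [|k]; first by rewrite IH !big_ord1 !E0 mulr0n mulr0 addr0.
  rewrite !IH [LHS]big_ord_recr [in RHS]big_ord_recr /= subnn !E0 addrAC.
  congr (_ + _); rewrite mulr_sumr -big_split; apply: eq_bigr => i _ /=.
  have ik : (i <= k)%N by rewrite -ltnS.
  by rewrite subSn // ES mulrDr [z * (_ * _)]mulrCA.
elim/ltn_ind: m => -[|m] IH; first by rewrite esym0 rmorph1 E0.
have m0 : m.+1%:R != 0 :> rat by rewrite Num.Theory.pnatr_eq0.
apply: (scalerI m0); rewrite -linearZ /= esymS scaler_nat newton rmorph_sum /=.
apply: eq_bigr => i _; rewrite !rmorphM rmorphXn rmorphN1 /=.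
by rewrite sfeval_powersum // IH // ltnS leq_subr.
Qed.

(** * Group algebras and Laurent polynomials
    monalg only puts a product on {malg R[K]} for monoids K without nontrivial
    units, hence this product on the group algebra of an abelian group G. *)

Section GroupAlgebra.
Variable G : zmodType.

Implicit Types f g h : {malg rat[G]}.

Definition galg_one : {malg rat[G]} := << 0 >>.

Definition galg_mul f g : {malg rat[G]} :=
  \sum_(a <- msupp f) \sum_(b <- msupp g) << f@_a * g@_b *g (a + b)%R >>.

Let mulw (d1 d2 : {fset G}) f g :
  (msupp f `<=` d1)%fset -> (msupp g `<=` d2)%fset ->
  galg_mul f g =
    \sum_(a <- d1) \sum_(b <- d2) << f@_a * g@_b *g (a + b)%R >>.
Proof.
move=> le1 le2; rewrite /galg_mul (big_fset_incl _ le1) /=.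
  apply: eq_bigr => a _; apply: big_fset_incl => // b _ /mcoeff_outdom ->.
  by rewrite mulr0 monalgU0.
move=> a _ /mcoeff_outdom fa; rewrite big1 // => b _.
by rewrite fa mul0r monalgU0.
Qed.

Lemma galg_mulC : commutative galg_mul.
Proof.
move=> f g; rewrite /galg_mul exchange_big /=.
apply: eq_bigr => b _; apply: eq_bigr => a _.
by rewrite addrC; congr << _ *g _ >>; apply: mulrC.
Qed.

Lemma galg_mulDl : left_distributive galg_mul +%R.
Proof.
move=> f g h; pose d := (msupp f `|` msupp g)%fset.
rewrite !(@mulw d (msupp h)) ?fsubsetUl ?fsubsetUr ?msuppD_le //.
rewrite -big_split; apply: eq_bigr => a _; rewrite -big_split.
by apply: eq_bigr => b _; rewrite mcoeffD mulrDl monalgUD.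
Qed.

Let mulDr f g h : galg_mul f (g + h) = galg_mul f g + galg_mul f h.
Proof. by rewrite galg_mulC galg_mulDl !(galg_mulC _ f). Qed.

Let mul0g f : galg_mul 0 f = 0.
Proof. by rewrite /galg_mul msupp0 big_seq_fset0. Qed.

Let mulg0 f : galg_mul f 0 = 0.
Proof. by rewrite galg_mulC mul0g. Qed.

Lemma galg_mulUU c d a b :
  galg_mul << c *g a >> << d *g b >> = << c * d *g (a + b)%R >>.
Proof. by rewrite (mulw msuppU_le msuppU_le) !big_seq_fset1 !mcoeffUU. Qed.

Let mul_suml I (r : seq I) (F : I -> {malg rat[G]}) g :
  galg_mul (\sum_(i <- r) F i) g = \sum_(i <- r) galg_mul (F i) g.
Proof. exact: (big_morph (galg_mul^~ g) (fun _ _ => galg_mulDl _ _ _)). Qed.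

Let mul_sumr I (r : seq I) (F : I -> {malg rat[G]}) g :
  galg_mul g (\sum_(i <- r) F i) = \sum_(i <- r) galg_mul g (F i).
Proof. exact: (big_morph (galg_mul g) (fun _ _ => mulDr _ _ _)). Qed.

Lemma galg_mulA : associative galg_mul.
Proof.
move=> f g h; rewrite [f]monalgE [g]monalgE [h]monalgE.
rewrite !mul_suml; apply: eq_bigr => a _.
rewrite mul_sumr [galg_mul _ (\sum_(_ <- msupp g) _)]mul_sumr mul_suml.
apply: eq_bigr => b _; rewrite !mul_sumr; apply: eq_bigr => c _.
by rewrite !galg_mulUU mulrA addrA.
Qed.

Lemma galg_mul1 : left_id galg_one galg_mul.
Proof.
move=> f; rewrite {1}[f]monalgE mul_sumr [RHS]monalgE.
by apply: eq_bigr => a _; rewrite galg_mulUU mul1r add0r.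
Qed.

Lemma galg_one_neq0 : galg_one != 0.
Proof. by rewrite monalgU_eq0 oner_eq0. Qed.

Lemma galg_scaleAl (c : rat) f g : c *: galg_mul f g = galg_mul (c *: f) g.
Proof.
rewrite (@mulw (msupp f) (msupp g)) //.
rewrite [RHS](@mulw (msupp f) (msupp g)) ?msuppZ_le // scaler_sumr.
apply: eq_bigr => a _; rewrite scaler_sumr; apply: eq_bigr => b _.
by apply/malgP => k; rewrite mcoeffZ !mcoeffU mcoeffZ mulrnAr mulrA.
Qed.

Definition galg : Type := {malg rat[G]}.

HB.instance Definition _ := GRing.Lmodule.on galg.
HB.instance Definition _ := GRing.Zmodule_isComNzRing.Build galg
  galg_mulA galg_mulC galg_mul1 galg_mulDl galg_one_neq0.
HB.instance Definition _ := GRing.Lmodule_isLalgebra.Build rat galg galg_scaleAl.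
HB.instance Definition _ := GRing.Lalgebra_isComAlgebra.Build rat galg.

End GroupAlgebra.

Section Laurent.
Variable n : nat.

Definition laurent := galg {ffun 'I_n -> int}.

HB.instance Definition _ := GRing.ComAlgebra.on laurent.

Definition lmono (p : {ffun 'I_n -> int}) : laurent := << p >>.

Definition lvar (i : 'I_n) : laurent := lmono [ffun j => (i == j)%:Z].
Definition lvarV (i : 'I_n) : laurent := lmono [ffun j => - (i == j)%:Z].

Lemma lvarK i : lvar i * lvarV i = 1.
Proof.
rewrite [LHS]galg_mulUU mulr1; congr << _ >>.
by apply/ffunP => j; rewrite !ffunE addrN.
Qed.

Definition vandermonde : laurent :=
  \prod_(i < n) \prod_(j < n | (i < j)%N) (lvar i - lvar j).

Variables (A : comAlgType rat) (Y : alphabet A).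

(* Lambda^p(Y) for an integer p, zero for p < 0. *)
Definition esym_val (p : int) : A :=
  if p is Posz m then sfeval Y (esym m) else 0.

(* The substitution x_i^p |-> Lambda^p(Y), see [integral_lmono]. *)
Definition integral (f : laurent) : A :=
  \sum_(p <- msupp f) f@_p *: \prod_(i < n) esym_val (p i).

Lemma integral_lmono p : integral (lmono p) = \prod_(i < n) esym_val (p i).
Proof. by rewrite /integral msuppU oner_eq0 big_seq_fset1 mcoeffUU scale1r. Qed.

Lemma integral_linear : linear integral.
Proof.
have intw (d : {fset {ffun 'I_n -> int}}) f : (msupp f `<=` d)%fset ->
    integral f = \sum_(p <- d) f@_p *: \prod_(i < n) esym_val (p i).
  by move=> le; apply: big_fset_incl => // p _ /mcoeff_outdom ->; rewrite scale0r.
move=> c f g; pose d := (msupp f `|` msupp g)%fset.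
rewrite !(intw d) ?fsubsetUl ?fsubsetUr //; last first.
  by apply: fsubset_trans (msuppD_le _ _) _; apply: fsetSU; apply: msuppZ_le.
rewrite scaler_sumr -big_split; apply: eq_bigr => p _ /=.
by rewrite mcoeffD mcoeffZ scalerDl scalerA.
Qed.

HB.instance Definition _ :=
  GRing.isLinear.Build rat laurent A *:%R integral integral_linear.

End Laurent.

(** * Jack symmetric functions *)

(* The bilinear form <Psi_la, Psi_mu> = delta z_la alpha^l(la). *)
Definition jdot (alpha : rat) (f g : symfun) : rat :=
  \sum_(la <- msupp f) f@_la * g@_la * (zee la)%:R * alpha ^+ size la.

Lemma jdot_psi alpha la mu :
  jdot alpha (psi la) (psi mu) =
    (la == mu)%:R * (zee la)%:R * alpha ^+ size la.
Proof.
by rewrite /jdot msuppU1 big_seq_fset1 mcoeffUU mul1r mcoeffU1 eq_sym.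
Qed.

(* m_mu(x_1, ..., x_N): the sum of the x^a over the exponent vectors a that
   rearrange to mu. *)
Definition monomial_eval (A : comAlgType rat) (N : nat) (x : 'I_N -> A)
    (mu : intpart) : A :=
  \sum_(a : {ffun 'I_N -> 'I_(sumn mu).+1}
         | mkpart [seq nat_of_ord (a i) | i <- enum 'I_N] == mu)
    \prod_(i < N) x i ^+ a i.

(* f = m_la + \sum_(mu < la) u_mu m_mu; a symmetric function is determined by
   its values on finite alphabets. *)
Definition unitriangular (la : intpart) (f : symfun) : Prop :=
  exists (s : seq intpart) (u : intpart -> rat),
    (forall mu, mu \in s -> strictly_dominated mu la) /\
    (forall (A : comAlgType rat) (N : nat) (x : 'I_N -> A),
       sfeval (finite_alphabet x) f =
         monomial_eval x la + \sum_(mu <- s) u mu *: monomial_eval x mu).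

(* For alpha > 0 these two conditions are satisfied by exactly one family P. *)
Definition is_jackP (alpha : rat) (P : intpart -> symfun) : Prop :=
  (forall la mu, la <> mu -> jdot alpha (P la) (P mu) = 0) /\
  (forall la, unitriangular la (P la)).

Definition is_jackQ (alpha : rat) (P Q : intpart -> symfun) : Prop :=
  forall la mu, jdot alpha (Q la) (P mu) = (la == mu)%:R.

Definition is_skew_jackQ (alpha : rat) (P Q : intpart -> symfun)
    (Qskew : intpart -> intpart -> symfun) : Prop :=
  forall la mu nu,
    jdot alpha (Qskew la mu) (P nu) = jdot alpha (Q la) (P mu * P nu).

Definition jack_b (alpha : rat) (P : intpart -> symfun) (la : intpart) : rat :=
  (jdot alpha (P la) (P la))^-1.

(* Main.v *)
Require Import Defs.
From HB Require Import structures.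
From mathcomp Require Import all_boot all_order all_algebra.
From mathcomp Require Import perm finmap.
From mathcomp Require Import zify ring lra.

(** Let z_i = x_i^(-1), m = k (n - 1) and W = \prod_(i != j) (1 - z_j x_i)^k.  Up to
    a sign, Delta(X)^(2k) is (x_1 ... x_n)^m W [vandermonde_dyson], and an integral
    over Y is the value at Y of the integral over the generic alphabet
    [integral_powersum], so the theorem is about symmetric functions obtained by
    integrating against x^m W.

    The substitution x^p |-> e_p is tied to the scalar products through the twist
    omega_b : p_r |-> (-1)^(r-1) b p_r.  For b = 1/alpha it sends e_p to a function
    g_p, the g_la are dual to the monomial functions, and therefore
      <f, omega_(1/alpha) (\int F)>_alpha = constant term of f(X^v) F
    [jdot_integral].  For alpha = 1/k the twist omega_k is an isometry from <,>_k to
    <,>_(1/k) and sends P^(k)_(la') to Q^(1/k)_la [jack_duality].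

    The main point is that, for the parameter 1/k, the constant term of
    P_nu(X^v) x^m W vanishes unless nu = m^n [coef0_jackP].  When nu_1 <= m this
    follows from triangularity and degrees, and the case nu = m^n is Dyson's
    constant term (nk)! / k!^n of W [dyson_constant_term].  When nu_1 > m, P_nu is a
    combination of the g_ka with ka_1 > m, and each monomial of g_p(X^v) W has an
    exponent at most -p [supported_dyson_product_esym].  Both facts come from
    Good's interpolation proof of Dyson's theorem, run with g_p(X^v) inserted
    [dyson_recursion].  Consequently omega_k (\int x^m W) is (nk)! / k!^n times
    Q^(1/k)_(m^n), so \int x^m W is the same multiple of P^(k)_(n^m); inserting
    Q_la(X^v) and testing against the P^(k)_nu then produces the skew function
    [integral_jackQ_dyson].

    For the value of b, evaluate \int x^m W at the alphabet of power sums
    (-1)^(r-1) n k, which amounts to applying omega_k and then setting n variables to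
    1.  As P^(1/k)_(m^n) takes the value 1 there, the result is (nk)! / k!^n divided
    by b [sfeval_binomial_rect]; it is also a Selberg type integral, computed by
    Aomoto's recursion on the integrals of x^j z_1 ... z_r W [stair_step]. *)

Set Implicit Arguments.
Unset Strict Implicit.
Unset Printing Implicit Defensive.

Import GRing.Theory.
Local Open Scope ring_scope.
Local Notation esym := Defs.esym.

(** * Linear maps on spaces with a basis *)

Section LinearExtension.
Variables (K : choiceType) (V : lmodType rat).
Implicit Types (f g : {malg rat[K]}) (h : K -> V).

Definition lext h f : V := \sum_(k <- msupp f) f@_k *: h k.

Lemma lextEw h (d : {fset K}) f :
  (msupp f `<=` d)%fset -> lext h f = \sum_(k <- d) f@_k *: h k.
Proof.
by move=> le; apply: big_fset_incl => // k _ /mcoeff_outdom ->; rewrite scale0r.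
Qed.

Lemma lext_is_linear h : linear (lext h).
Proof.
move=> c f g; pose d := (msupp f `|` msupp g)%fset.
rewrite !(@lextEw h d) ?fsubsetUl ?fsubsetUr //; last first.
  by apply: fsubset_trans (msuppD_le _ _) _; apply: fsetSU; apply: msuppZ_le.
rewrite scaler_sumr -big_split; apply: eq_bigr => p _ /=.
by rewrite mcoeffD mcoeffZ scalerDl scalerA.
Qed.

HB.instance Definition _ h :=
  GRing.isLinear.Build rat {malg rat[K]} V *:%R (lext h) (lext_is_linear h).

Lemma lextU h k : lext h << k >> = h k.
Proof. by rewrite /lext msuppU oner_eq0 big_seq_fset1 mcoeffUU scale1r. Qed.

Lemma malg_ind (P : {malg rat[K]} -> Prop) :
  P 0 -> (forall c k f, P f -> P (c *: << k >> + f)) -> forall f, P f.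
Proof.
move=> P0 PD f; rewrite [f]monalgE; elim: (enum_fset (msupp f)) => [|k s IH].
  by rewrite big_nil.
rewrite big_cons; have -> : << f@_k *g k >> = f@_k *: << k >> :> {malg rat[K]}.
  by apply/malgP=> k'; rewrite mcoeffZ !mcoeffU mulr_natr.
exact: PD.
Qed.

(** Linearity is a hypothesis here, so that the lemma applies to composite maps
    such as F |-> f (F * H) that carry no bundled linear structure. *)
Lemma linear_basis_eq (u v : {malg rat[K]} -> V) : linear u -> linear v ->
  (forall k, u << k >> = v << k >>) -> forall f, u f = v f.
Proof.
have lin0 (w : {malg rat[K]} -> V) : linear w -> w 0 = 0.
  move=> wP; have := wP 1 0 0; rewrite !scale1r addr0 => /eqP.
  by rewrite -subr_eq0 opprD addrA subrr sub0r oppr_eq0 => /eqP.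
move=> uP vP uv; apply: malg_ind => [|c k f IH]; first by rewrite !lin0.
by rewrite uP vP uv IH.
Qed.

Lemma lext_unique (u v : {linear {malg rat[K]} -> V}) :
  (forall k, u << k >> = v << k >>) -> u =1 v.
Proof.
move=> uv; apply: malg_ind => [|c k f IH]; first by rewrite !linear0.
by rewrite !linearP uv IH.
Qed.
End LinearExtension.

(** * Supports in group algebras *)

Section Support.
Variable G : zmodType.
Implicit Types (F H : galg G) (P Q R : G -> Prop).

Lemma galg_coefM F H q :
  (F * H)@_q = \sum_(a <- msupp F) F@_a * H@_(q - a).
Proof.
rewrite [F * H]/(galg_mul F H) /galg_mul raddf_sum; apply: eq_bigr => a _ /=.
rewrite raddf_sum /= (eq_bigr (fun b => (F@_a * H@_b) *+ (b == q - a))).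
  2: by move=> b _; rewrite mcoeffU [a + b]addrC eq_sym -subr_eq eq_sym.
have [Hq|Hq] := boolP (q - a \in msupp H).
  rewrite (big_rem _ Hq) /= eqxx big_seq big1 ?addr0 // => b.
  by rewrite mem_rem_uniq ?fset_uniq // inE => /andP[/negPf->].
rewrite (mcoeff_outdom Hq) mulr0 big_seq big1 // => b.
by case: eqP => [->|//]; rewrite (negPf Hq).
Qed.

(** Constant terms are shown to vanish by carrying a property of exponents
    through sums and products. *)
Definition supported P F := forall q, F@_q != 0 -> P q.

Lemma supportedS P Q F :
  supported P F -> (forall q, P q -> Q q) -> supported Q F.
Proof. by move=> FP PQ q /FP/PQ. Qed.

Lemma supported0 P : supported P 0.
Proof. by move=> q; rewrite mcoeff0 eqxx. Qed.

Lemma supportedU P c g : P g -> supported P << c *g g >>.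
Proof. by move=> Pg q; rewrite mcoeffU; case: (g =P q) => [<- //|]; rewrite eqxx. Qed.

Lemma supported1 P : P 0 -> supported P 1.
Proof. exact: supportedU. Qed.

Lemma supportedD P F H : supported P F -> supported P H -> supported P (F + H).
Proof.
move=> FP HP q; rewrite [(F + H)@_q]mcoeffD => nz; have [F0|/FP//] := eqVneq F@_q 0.
by apply: HP; move: nz; rewrite F0 add0r.
Qed.

Lemma supportedZ P c F : supported P F -> supported P (c *: F).
Proof.
move=> FP q; rewrite [(c *: F)@_q]mcoeffZ mulf_eq0 => /norP[_]; exact: FP.
Qed.

Lemma supportedN P F : supported P F -> supported P (- F).
Proof. by rewrite -scaleN1r; apply: supportedZ. Qed.

Lemma supportedB P F H : supported P F -> supported P H -> supported P (F - H).
Proof. by move=> FP HP; apply: supportedD => //; apply: supportedN. Qed.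

Lemma supported_sum P I (r : seq I) (C : pred I) (E : I -> galg G) :
  (forall i, C i -> supported P (E i)) -> supported P (\sum_(i <- r | C i) E i).
Proof.
by move=> EP; elim/big_rec: _ => [|i F /EP]; [apply: supported0 | apply: supportedD].
Qed.

Lemma supportedM P Q R F H :
  (forall a b, P a -> Q b -> R (a + b)) ->
  supported P F -> supported Q H -> supported R (F * H).
Proof.
move=> PQR FP HQ q; rewrite galg_coefM => nz0.
suff [a Pa Qa] : exists2 a, P a & Q (q - a) by rewrite -(subrK a q) addrC; apply: PQR.
have [/hasP[a _]|/hasPn none] :=
    boolP (has (fun a => F@_a * H@_(q - a) != 0) (msupp F)).
  by rewrite mulf_eq0 => /norP[/FP Pa /HQ Qb]; exists a.
by case/eqP: nz0; rewrite big_seq big1 // => a /none; rewrite negbK => /eqP.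
Qed.

Lemma supported_prod P I (r : seq I) (C : pred I) (E : I -> galg G) :
  P 0 -> (forall a b, P a -> P b -> P (a + b)) ->
  (forall i, C i -> supported P (E i)) -> supported P (\prod_(i <- r | C i) E i).
Proof.
move=> P0 PD EP; elim/big_rec: _ => [|i F /EP]; first exact: supported1.
exact: supportedM.
Qed.

Lemma supportedX P n F :
  P 0 -> (forall a b, P a -> P b -> P (a + b)) ->
  supported P F -> supported P (F ^+ n).
Proof.
elim: n => [|n IH] P0 PD FP; first exact: supported1.
by rewrite exprS; apply: (supportedM PD FP); apply: IH.
Qed.

Lemma supported_coef0 P F q : supported P F -> ~ P q -> F@_q = 0.
Proof. by move=> FP nP; apply/eqP; apply/negP => /negP/FP. Qed.

Lemma coef_lmonoM F g q : (F * (<< g >> : galg G))@_q = F@_(q - g).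
Proof.
rewrite mulrC galg_coefM msuppU oner_eq0 big_seq_fset1 mcoeffUU mul1r //.
Qed.
End Support.

(** * The scalar product *)

Section ScalarProduct.
Variable alpha : rat.
Implicit Types f g h : symfun.

Lemma jdotE f g (d : {fset intpart}) : (msupp f `<=` d)%fset ->
  jdot alpha f g = \sum_(la <- d) f@_la * g@_la * (zee la)%:R * alpha ^+ size la.
Proof.
move=> le; apply: big_fset_incl => // la _ /mcoeff_outdom ->.
by rewrite !mul0r.
Qed.

Lemma jdotC f g : jdot alpha f g = jdot alpha g f.
Proof.
rewrite (@jdotE f g (msupp f `|` msupp g)%fset) ?fsubsetUl //.
rewrite (@jdotE g f (msupp f `|` msupp g)%fset) ?fsubsetUr //.
by apply: eq_bigr => la _; rewrite [f@_la * _]mulrC.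
Qed.

Lemma jdot_is_linear g : linear (fun f => jdot alpha f g : rat^o).
Proof.
move=> c f h; pose d := (msupp f `|` msupp h)%fset.
rewrite !(@jdotE _ g d) ?fsubsetUl ?fsubsetUr //; last first.
  by apply: fsubset_trans (msuppD_le _ _) _; apply: fsetSU; apply: msuppZ_le.
rewrite scaler_sumr -big_split; apply: eq_bigr => p _ /=.
by rewrite mcoeffD mcoeffZ /GRing.scale /= !mulrDl !mulrA.
Qed.

Definition jdotl g f : rat^o := jdot alpha f g.

HB.instance Definition _ g :=
  GRing.isLinear.Build rat symfun rat^o *:%R (jdotl g) (jdot_is_linear g).

Lemma jdot0l g : jdot alpha 0 g = 0.
Proof. exact: (linear0 (jdotl g)). Qed.
Lemma jdot0r f : jdot alpha f 0 = 0.
Proof. by rewrite jdotC jdot0l. Qed.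
Lemma jdotDl f h g : jdot alpha (f + h) g = jdot alpha f g + jdot alpha h g.
Proof. exact: (linearD (jdotl g)). Qed.
Lemma jdotZl c f g : jdot alpha (c *: f) g = c * jdot alpha f g.
Proof. exact: (linearZ_LR (jdotl g)). Qed.
Lemma jdotPl c f h g :
  jdot alpha (c *: f + h) g = c * jdot alpha f g + jdot alpha h g.
Proof. by rewrite jdotDl jdotZl. Qed.
Lemma jdotBl f h g : jdot alpha (f - h) g = jdot alpha f g - jdot alpha h g.
Proof. exact: (linearB (jdotl g)). Qed.
Lemma jdotDr f h g : jdot alpha g (f + h) = jdot alpha g f + jdot alpha g h.
Proof. by rewrite jdotC jdotDl !(jdotC _ g). Qed.
Lemma jdotZr c f g : jdot alpha g (c *: f) = c * jdot alpha g f.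
Proof. by rewrite jdotC jdotZl (jdotC _ g). Qed.
Lemma jdotPr c f h g :
  jdot alpha g (c *: f + h) = c * jdot alpha g f + jdot alpha g h.
Proof. by rewrite jdotDr jdotZr. Qed.

Lemma jdot1 f : jdot alpha 1 f = f@_(mone : intpart).
Proof.
rewrite /jdot -[1]/(psi (mkpart [::])) msuppU1 big_seq_fset1 mcoeffU1 eqxx.
by rewrite /zee big_nil !mulr1 mul1r.
Qed.
End ScalarProduct.

Lemma jdot_eqr alpha f g : alpha != 0 ->
  (forall h, jdot alpha h f = jdot alpha h g) -> f = g.
Proof.
move=> al0 fg; apply/malgP=> la; have := fg (psi la).
rewrite /jdot /psi msuppU oner_eq0 !big_seq_fset1 !mcoeffUU !mul1r.
move/(mulIf (expf_neq0 _ al0))/mulIf; apply.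
rewrite Num.Theory.pnatr_eq0 -lt0n /zee.
rewrite big_seq prodn_cond_gt0 // => i; rewrite mem_undup => i_la.
rewrite muln_gt0 fact_gt0 expn_gt0 andbT.
case: la i_la {fg} => s /= /andP[_ s0] i_s.
by case: i i_s => // i_s; rewrite i_s in s0.
Qed.

(** * Multiplication of power sums *)

Lemma psiM la mu : psi la * psi mu = psi (union_part la mu).
Proof. by rewrite malgM_def /psi fgmulUU mulr1. Qed.

Lemma mkpart_cat s t : mkpart (s ++ t) = union_part (mkpart s) (mkpart t).
Proof.
apply/val_inj/perm_sortP => /=.
- by move=> a b; apply: leq_total.
- by move=> b a c /= ba cb; apply: leq_trans cb ba.
- by move=> a b /=; rewrite andbC; apply: anti_leq.
rewrite !filter_cat; apply: perm_cat.
  by rewrite perm_sym; have := filter_parts (mkpart s) => /= ->; rewrite perm_sort.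
by rewrite perm_sym; have := filter_parts (mkpart t) => /= ->; rewrite perm_sort.
Qed.

Lemma psi_mkpart s : psi (mkpart s) = \prod_(i <- s) powersum i.
Proof.
elim: s => [|i s IH]; first by rewrite big_nil.
by rewrite big_cons -IH /powersum psiM -mkpart_cat.
Qed.

Lemma psiE (la : intpart) : psi la = \prod_(i <- la) powersum i.
Proof. by rewrite -psi_mkpart mkpartK. Qed.

Lemma intpart_gt0 (la : intpart) i : i \in parts la -> (0 < i)%N.
Proof. by case: la i => s /= /andP[_ s0] [|//] i_s; rewrite i_s in s0. Qed.

Lemma sfeval_psi (A : comAlgType rat) (X : alphabet A) (la : intpart) :
  sfeval X (psi la) = \prod_(i <- parts la) X i.
Proof. by rewrite /sfeval /psi mmapU /= scale1r mul1r. Qed.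

Section Evaluation.
Variables (A : comAlgType rat) (X : alphabet A).

Lemma sfeval_eq (Z : alphabet A) f :
  (forall i, (0 < i)%N -> X i = Z i) -> sfeval X f = sfeval Z f.
Proof.
move=> XZ; apply: (lext_unique (u := sfeval X) (v := sfeval Z)) => la.
rewrite [LHS]sfeval_psi [RHS]sfeval_psi big_seq [RHS]big_seq.
by apply: eq_bigr => i /intpart_gt0/XZ.
Qed.

Lemma sfeval_comp (Z : alphabet symfun) f :
  sfeval X (sfeval Z f) = sfeval (fun i => sfeval X (Z i)) f.
Proof.
apply: (lext_unique (u := sfeval X \o sfeval Z)
                    (v := sfeval (fun i => sfeval X (Z i)))) => la /=.
by rewrite !(sfeval_psi, rmorph_prod).
Qed.

Lemma sfeval_newton m :
  m.+1%:R *: sfeval X (esym m.+1) =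
    \sum_(i < m.+1) (-1) ^+ i * X i.+1 * sfeval X (esym (m - i)).
Proof.
rewrite -linearZ /= esymS rmorph_sum; apply: eq_bigr => i _ /=.
by rewrite !rmorphM rmorphXn rmorphN1 /= sfeval_powersum.
Qed.

(** Newton's identities determine the elementary functions one after the other,
    since the scalars are rational. *)
Lemma newton_unique (s : nat -> A) :
  s 0 = 1 ->
  (forall m, m.+1%:R *: s m.+1 = \sum_(i < m.+1) (-1) ^+ i * X i.+1 * s (m - i)%N) ->
  forall m, s m = sfeval X (esym m).
Proof.
move=> s0 sS; elim/ltn_ind=> -[|m] IH; first by rewrite s0 esym0 rmorph1.
have m0 : m.+1%:R != 0 :> rat by rewrite Num.Theory.pnatr_eq0.
apply: (scalerI m0).
rewrite sS sfeval_newton; apply: eq_bigr => i _.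
by rewrite IH // ltnS leq_subr.
Qed.
End Evaluation.

(** * The adjoint of multiplication by a power sum *)

Lemma zee_ord N (la : intpart) : (forall i, i \in parts la -> (i < N)%N) ->
  zee la = (\prod_(i < N) (i ^ count_mem (i : nat) la * (count_mem (i : nat) la)`!))%N.
Proof.
move=> laN; rewrite /zee -(big_mkord predT (fun i => i ^ count_mem i la * (count_mem i la)`!))%N.
rewrite [RHS](bigID (fun i => i \in parts la)) /= [X in (_ * X)%N]big1 ?muln1; last first.
  by move=> i /count_memPn ->.
rewrite -[RHS]big_filter; apply: perm_big; apply: uniq_perm.
- exact: undup_uniq.
- by rewrite filter_uniq // iota_uniq.
move=> i; rewrite mem_undup mem_filter mem_index_iota /=.
by case: (boolP (i \in _)) => // /laN ->.
Qed.

Definition part_cons r (la : intpart) := union_part (mkpart [:: r]) la.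

Lemma perm_part_cons r la : (0 < r)%N -> perm_eq (part_cons r la) (r :: la).
Proof.
move=> r0; apply: perm_trans (perm_mkpart _) _.
by rewrite filter_cat !filter_parts /= r0.
Qed.

Lemma intpart_eq (la mu : intpart) : perm_eq la mu -> la = mu.
Proof. by move=> /mkpart_perm; rewrite !mkpartK. Qed.

Lemma zee_cons r la : (0 < r)%N ->
  zee (part_cons r la) = (r * (count_mem r la).+1 * zee la)%N.
Proof.
move=> r0; have pe := perm_part_cons la r0.
pose N := (r + \max_(i <- parts la) i).+1.
have laN i : i \in parts la -> (i < N)%N.
  by move=> i_la; rewrite ltnS (leq_trans _ (leq_addl _ _)) //; apply: leq_bigmax_seq.
have rN : (r < N)%N by rewrite ltnS leq_addr.
rewrite (zee_ord laN) (@zee_ord N); last first.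
  by move=> i; rewrite (perm_mem pe) inE => /predU1P[->|/laN].
rewrite (bigD1 (Ordinal rN)) //= [in RHS](bigD1 (Ordinal rN)) //= (seq.permP pe) /= eqxx add1n.
rewrite factS expnS; set p1 := (\prod_(i < N | _) _)%N.
set p2 := (\prod_(i < N | _) _)%N; have -> : p1 = p2.
  apply: eq_bigr => i ir; rewrite (seq.permP pe) /=.
  by have /negPf -> : r != i :> nat by rewrite eq_sym; apply: contra ir => /eqP ir; apply/eqP/val_inj.
by nia.
Qed.

Definition part_rem r (la : intpart) := mkpart (rem r la).

Lemma part_consK r : (0 < r)%N -> cancel (part_cons r) (part_rem r).
Proof.
move=> r0 la; rewrite /part_rem -[RHS]mkpartK; apply: mkpart_perm.
have pe := perm_part_cons la r0.
by rewrite -(perm_cons r) (perm_trans _ pe) // perm_sym perm_to_rem // (perm_mem pe) mem_head.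
Qed.

Lemma part_remK r (la : intpart) : r \in parts la -> part_cons r (part_rem r la) = la.
Proof.
move=> r_la; have r0 := intpart_gt0 r_la; apply: intpart_eq.
apply: perm_trans (perm_part_cons _ r0) _.
rewrite perm_sym (perm_trans (perm_to_rem r_la)) // perm_cons perm_sym.
apply: perm_trans (perm_mkpart _) _; rewrite (_ : [seq _ <- _ | _] = rem r la) //.
by apply/all_filterP/allP => i /mem_rem/intpart_gt0.
Qed.

Section AdjointDerivation.
Variables (alpha : rat) (r : nat).
Hypothesis r_gt0 : (0 < r)%N.

(** This is the derivation alpha r d/dp_r, written on products of power sums. *)
Definition psi_skew (la : intpart) : symfun :=
  (alpha * r%:R * (count_mem r la)%:R) *: psi (part_rem r la).

Definition pskew : symfun -> symfun := lext psi_skew.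

HB.instance Definition _ := GRing.Linear.on pskew.

Lemma pskewP c f g : pskew (c *: f + g) = c *: pskew f + pskew g.
Proof. exact: linearP. Qed.

Lemma pskewZ c f : pskew (c *: f) = c *: pskew f.
Proof. exact: linearZ_LR. Qed.

Lemma pskew_sum I (s : seq I) (E : I -> symfun) :
  pskew (\sum_(i <- s) E i) = \sum_(i <- s) pskew (E i).
Proof. exact: linear_sum. Qed.

Lemma pskew_psi la : pskew (psi la) = psi_skew la.
Proof. exact: lextU. Qed.

(** Adding a part r to la multiplies z_la by r times the new multiplicity of r,
    which is what alpha r d/dp_r produces. *)
Lemma jdot_pskew f g :
  jdot alpha (powersum r * f) g = jdot alpha f (pskew g).
Proof.
elim/malg_ind: f => [|c la f IH]; first by rewrite mulr0 !jdot0l.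
rewrite mulrDr -scalerAr !jdotDl !jdotZl {}IH; congr (_ * _ + _).
elim/malg_ind: g => [|d mu g IH]; first by rewrite linear0 !jdot0r.
rewrite linearP !jdotDr /= !jdotZr {}IH; congr (_ * _ + _).
rewrite pskew_psi /psi_skew jdotZr -!/(psi _) psiM !jdot_psi -/(part_cons r la).
have [mu_r|mu_r] := boolP (r \in parts mu); last first.
  rewrite (count_memPn mu_r) mulr0 mul0r; case: eqP => [E|]; last by rewrite !mul0r.
  by case/negP: mu_r; rewrite -E (perm_mem (perm_part_cons _ r_gt0)) mem_head.
rewrite -(part_remK mu_r); move: (part_rem r mu) => nu.
rewrite part_consK // (can_eq (part_consK r_gt0)).
case: eqP => [->|]; last by rewrite !mul0r mulr0.
rewrite zee_cons // (seq.permP (perm_part_cons _ r_gt0)) (perm_size (perm_part_cons _ r_gt0)) /=.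
by rewrite eqxx add1n exprS !natrM; ring.
Qed.

Lemma pskewM f g : pskew (f * g) = pskew f * g + f * pskew g.
Proof.
elim/malg_ind: f => [|c la f IH]; first by rewrite linear0 !mul0r linear0 addr0.
rewrite mulrDl linearD /= {}IH linearP /= -scalerAl linearZ /= !mulrDl -!scalerAl.
rewrite addrACA; congr (_ + _); rewrite -scalerDr; congr (_ *: _).
elim/malg_ind: g => [|d mu g IH]; first by rewrite linear0 !mulr0 linear0 addr0.
rewrite mulrDr linearD /= {}IH linearP /= -scalerAr linearZ /= !mulrDr -!scalerAr.
rewrite addrACA; congr (_ + _); rewrite -scalerDr; congr (_ *: _).
rewrite -!/(psi _) psiM !pskew_psi /psi_skew -scalerAl -scalerAr !psiM.
have uE : perm_eq (union_part la mu) (parts la ++ parts mu).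
  by apply: perm_trans (perm_mkpart _) _; rewrite filter_cat !filter_parts.
have -> : alpha * r%:R * (count_mem r (union_part la mu))%:R =
    alpha * r%:R * (count_mem r la)%:R + alpha * r%:R * (count_mem r mu)%:R.
  by rewrite (seq.permP uE) count_cat natrD mulrDr.
have E1 : (alpha * r%:R * (count_mem r la)%:R) *: psi (part_rem r (union_part la mu)) =
    (alpha * r%:R * (count_mem r la)%:R) *: psi (union_part (part_rem r la) mu).
  have [la_r|la_r] := boolP (r \in parts la); last first.
    by rewrite (count_memPn la_r) mulr0 !scale0r.
  congr (_ *: psi _); rewrite -{1}(part_remK la_r) /part_cons -union_partA.
  by rewrite [LHS]part_consK.
have E2 : (alpha * r%:R * (count_mem r mu)%:R) *: psi (part_rem r (union_part la mu)) =
    (alpha * r%:R * (count_mem r mu)%:R) *: psi (union_part la (part_rem r mu)).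
  have [mu_r|mu_r] := boolP (r \in parts mu); last first.
    by rewrite (count_memPn mu_r) mulr0 !scale0r.
  congr (_ *: psi _); rewrite -{1}(part_remK mu_r) /part_cons.
  rewrite [union_part la (union_part _ _)]union_partC -union_partA.
  by rewrite [LHS]part_consK // union_partC.
by move: E1 E2 => <- <-; exact: scalerDl.
Qed.

Lemma pskew1 : pskew 1 = 0.
Proof.
have := pskewM 1 1; rewrite !mulr1 mul1r => /eqP.
by rewrite -subr_eq0 opprD addrA subrr sub0r oppr_eq0 => /eqP.
Qed.

Lemma pskew_powersum i : (0 < i)%N ->
  pskew (powersum i) = (alpha * r%:R * (i == r)%:R) *: 1.
Proof.
move=> i0; rewrite pskew_psi /psi_skew /= i0 /= addn0; case: eqP => [->|]; last first.
  by rewrite !mulr0 !scale0r.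
congr (_ *: _); rewrite -[1]/(psi (mkpart [::])) -(part_consK r_gt0 (mkpart [::])).
by rewrite /part_cons unionpart0.
Qed.

Lemma pskew_prod n (E : 'I_n -> symfun) :
  pskew (\prod_(i < n) E i) = \sum_(i < n) pskew (E i) * \prod_(j < n | j != i) E j.
Proof.
elim: n E => [|n IH] E; first by rewrite !big_ord0 pskew1.
rewrite !big_ord_recl pskewM IH mulr_sumr.
have lift0 : \prod_(j < n.+1 | j != ord0) E j = \prod_(j < n) E (lift ord0 j).
  by rewrite big_mkcond big_ord_recl /= mul1r; apply: eq_bigr.
rewrite lift0; congr (_ + _); apply: eq_bigr => i _.
rewrite mulrCA; congr (_ * _); rewrite [RHS]big_mkcond big_ord_recl /=; congr (_ * _).
by rewrite [LHS]big_mkcond; apply: eq_bigr => j _; rewrite (inj_eq lift_inj).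
Qed.
End AdjointDerivation.

(** * Substitution integrals as constant term functionals *)

Lemma sfeval_integral (A : comAlgType rat) (X : alphabet A) (Z : alphabet symfun)
    n (F : laurent n) :
  sfeval X (integral Z F) = integral (fun i => sfeval X (Z i)) F.
Proof.
apply: (lext_unique (u := sfeval X \o integral Z)
                    (v := integral (fun i => sfeval X (Z i)))) => p /=.
rewrite [integral Z _]integral_lmono [RHS]integral_lmono rmorph_prod.
apply: eq_bigr => i _; case: (p i) => m /=; last by rewrite rmorph0.
by rewrite sfeval_comp.
Qed.

Section Integral.
Variables (A : comAlgType rat) (Y : alphabet A) (n : nat).
Implicit Types F G : laurent n.

Lemma integralP c F G : integral Y (c *: F + G) = c *: integral Y F + integral Y G.
Proof. exact: linearP. Qed.
Lemma integralD F G : integral Y (F + G) = integral Y F + integral Y G.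
Proof. exact: linearD. Qed.
Lemma integralB F G : integral Y (F - G) = integral Y F - integral Y G.
Proof. exact: linearB. Qed.
Lemma integralZ c F : integral Y (c *: F) = c *: integral Y F.
Proof. exact: linearZ_LR. Qed.
Lemma integral_sum I (r : seq I) (P : pred I) (E : I -> laurent n) :
  integral Y (\sum_(i <- r | P i) E i) = \sum_(i <- r | P i) integral Y (E i).
Proof. exact: linear_sum. Qed.
End Integral.

Lemma laurent_linear_eq n (V : lmodType rat) (u v : laurent n -> V) :
  linear u -> linear v -> (forall p, u (lmono p) = v (lmono p)) -> forall F, u F = v F.
Proof. exact: linear_basis_eq. Qed.

Lemma coef_lmono n (p q : {ffun 'I_n -> int}) : (lmono p)@_q = (p == q)%:R.
Proof. by rewrite /lmono mcoeffU. Qed.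

Lemma lmonoM n (p q : {ffun 'I_n -> int}) : lmono p * lmono q = lmono (p + q).
Proof. by rewrite [LHS]galg_mulUU mulr1. Qed.

Lemma lmono_exp n (p : {ffun 'I_n -> int}) m : lmono p ^+ m = lmono (p *+ m).
Proof.
by elim: m => [|m IH]; rewrite ?expr0 ?mulr0n // exprS IH lmonoM -mulrS.
Qed.

Lemma lvarVX n (i : 'I_n) r : lvarV i ^+ r = lmono [ffun j => - (r%:Z * (i == j)%:Z)].
Proof.
rewrite lmono_exp; congr lmono; apply/ffunP => j; rewrite ffunMnE !ffunE.
by rewrite mulNrn -mulr_natr mulrC natz.
Qed.

(** For b = 1/alpha the substitution of this alphabet turns the elementary
    functions into the functions g_p with generating series
    exp (\sum_r p_r t^r / (alpha r)), whose products g_la are dual to the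
    monomial functions for the scalar product of parameter alpha. *)
Definition signed_powersum (b : rat) : alphabet symfun :=
  fun i => ((-1) ^+ i.-1 * b) *: powersum i.

Definition omega (b : rat) : symfun -> symfun := sfeval (signed_powersum b).

HB.instance Definition _ b := GRing.RMorphism.on (omega b).
HB.instance Definition _ b := GRing.Linear.on (omega b).

Lemma omegaE b f : omega b f = sfeval (signed_powersum b) f.
Proof. by []. Qed.
Lemma omegaZ b c f : omega b (c *: f) = c *: omega b f.
Proof. exact: linearZ_LR. Qed.
Lemma omegaM b f g : omega b (f * g) = omega b f * omega b g.
Proof. exact: rmorphM. Qed.
Lemma omegaP b c f g : omega b (c *: f + g) = c *: omega b f + omega b g.
Proof. exact: linearP. Qed.
Lemma omega0 b : omega b 0 = 0.
Proof. exact: linear0. Qed.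

Lemma omega_psi b (la : intpart) :
  omega b (psi la) = (\prod_(i <- parts la) ((-1) ^+ i.-1 * b)) *: psi la.
Proof. by rewrite /omega sfeval_psi psiE -scaler_prod. Qed.

Opaque omega sfeval integral jdot.

(** The signs square to 1, which leaves a factor b^2 for each part. *)
Lemma jdot_omega alpha b f g :
  jdot alpha (omega b f) (omega b g) = jdot (b ^+ 2 * alpha) f g.
Proof.
elim/malg_ind: f => [|c la f IH]; first by rewrite omega0 !jdot0l.
rewrite omegaP [LHS]jdotPl [RHS]jdotPl; congr (_ * _ + _); last exact: IH.
elim/malg_ind: g {IH} => [|d mu g IH]; first by rewrite omega0 !jdot0r.
rewrite omegaP [LHS]jdotPr [RHS]jdotPr ; congr (_ * _ + _); last exact: IH.
rewrite -!/(psi _) !omega_psi [LHS]jdotZl jdotZr !jdot_psi.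
case: (eqVneq la mu) => [<-|_]; last by rewrite !mul0r !mulr0.
rewrite exprMn mulrA -expr2 -prodrXl.
under eq_bigr => i _ do rewrite exprMn sqrr_sign mul1r.
rewrite big_const_seq count_predT iter_mulr_1 !mulrA !mul1r.
by rewrite mulr1 [_ * (zee la)%:R]mulrC.
Qed.

Section Reproducing.
Variable alpha : rat.
Hypothesis alpha_neq0 : alpha != 0.

Notation h := (signed_powersum alpha^-1).

Lemma signed_newton m :
  m.+1%:R *: sfeval h (esym m.+1) =
    alpha^-1 *: \sum_(i < m.+1) powersum i.+1 * sfeval h (esym (m - i)).
Proof.
rewrite sfeval_newton scaler_sumr; apply: eq_bigr => i _.
rewrite /signed_powersum /= -(signr_odd rat) -(signr_odd symfun).
by case: (odd i); rewrite ?expr1 ?expr0 ?mulN1r ?mul1r ?scaleNr ?opprK scalerAl.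
Qed.

Lemma esym_val_neg (A : comAlgType rat) (Y : alphabet A) p :
  (p < 0)%R -> esym_val Y p = 0.
Proof. by case: p. Qed.

(** The derivation alpha r d/dp_r multiplies the generating series
    exp (\sum_r p_r t^r / (alpha r)) of the g_p by t^r; the induction is Newton's
    recursion for the coefficients of that series. *)
Lemma pskew_hsym r p : (0 < r)%N ->
  pskew alpha r (esym_val h p) = esym_val h (p - r%:Z).
Proof.
move=> r_gt0; case: p => [m|m]; last first.
  rewrite [LHS]linear0 esym_val_neg //; lia.
elim/ltn_ind: m => -[|m] IH.
  by rewrite /= esym0 rmorph1 pskew1 // sub0r esym_val_neg //; lia.
have m0 : m.+1%:R != 0 :> rat by rewrite Num.Theory.pnatr_eq0.
apply: (scalerI m0); rewrite -pskewZ [esym_val h _]/= signed_newton pskewZ pskew_sum.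
rewrite (eq_bigr (fun i : 'I_m.+1 =>
   (alpha * r%:R * (i.+1 == r)%:R) *: sfeval h (esym (m - i)) +
   powersum i.+1 * esym_val h ((m - i)%N%:Z - r%:Z))); last first.
  move=> i _.
  have Ei : pskew alpha r (sfeval h (esym (m - i))) = esym_val h ((m - i)%N%:Z - r%:Z).
    by apply: IH; rewrite ltnS leq_subr.
  rewrite [LHS](pskewM alpha r_gt0) Ei (pskew_powersum alpha r_gt0) //.
  by rewrite -scalerAl mul1r.
rewrite big_split /= scalerDr.
have [rm|rm] := ltnP m.+1 r.
  rewrite big1 => [|i _]; last first.
    have -> : (i.+1 == r) = false by have := ltn_ord i; lia.
    by rewrite mulr0 scale0r.
  rewrite big1 => [|i _]; last by rewrite esym_val_neg ?mulr0 //; lia.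
  by rewrite esym_val_neg ?scaler0 ?addr0 //; lia.
have [j jE] : exists j, m.+1 = (r + j)%N by exists (m.+1 - r)%N; rewrite subnKC.
have -> : m.+1%:Z - r%:Z = j%:Z by lia.
rewrite [esym_val h j%:Z]/= jE natrD scalerDl; congr (_ + _).
  have rm' : (r.-1 < r + j)%N by lia.
  rewrite (bigD1 (Ordinal rm')) //= prednK // eqxx mulr1 big1 ?addr0 => [|i ir].
    have -> : (m - r.-1)%N = j by lia.
    by rewrite [LHS]scalerA mulKf.
  have -> : (i.+1 == r) = false.
    by apply: contraNF ir => /eqP ir; apply/eqP/val_inj => /=; lia.
  by rewrite mulr0 scale0r.
case: j jE => [|j] jE.
  rewrite scale0r big1 ?scaler0 // => i _; rewrite esym_val_neg ?mulr0 //; lia.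
rewrite signed_newton; congr (_ *: _).
rewrite (big_ord_widen (r + j.+1) (fun i => powersum i.+1 * sfeval h (esym (j - i)))); last by lia.
rewrite [RHS]big_mkcond; apply: eq_bigr => i _.
case: ifP => ij; last by rewrite esym_val_neg ?mulr0 //; lia.
by have -> : (m - i)%N%:Z - r%:Z = (j - i)%N%:Z by lia.
Qed.

Lemma mcoeff1_hsym p : (esym_val h p)@_(mone : intpart) = (p == 0)%:R.
Proof.
case: p => [[|m]|m] /=; [by rewrite esym0 rmorph1 mcoeff1 eqxx | | by rewrite mcoeff0].
have m0 : m.+1%:R != 0 :> rat by rewrite Num.Theory.pnatr_eq0.
apply: (mulfI m0); rewrite mulr0 -mcoeffZ signed_newton mcoeffZ raddf_sum big1 ?mulr0 //.
move=> i _ /=; rewrite [LHS](rmorphM (@mcoeff intpart rat mone)) /= mcoeffU1.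
case: eqP => [/(congr1 (size \o parts))//|_].
by rewrite mul0r.
Qed.

(** Lowering one factor g_(p_i) to g_(p_i - r) amounts to multiplying the
    integrand by x_i^(-r), and a derivation does this for each i in turn. *)
Lemma pskew_integral n r (F : laurent n) : (0 < r)%N ->
  pskew alpha r (integral h F) = integral h (finite_alphabet (@lvarV n) r * F).
Proof.
move=> r0; apply: (laurent_linear_eq
  (u := fun F => pskew alpha r (integral h F))
  (v := fun F => integral h (finite_alphabet (@lvarV n) r * F))) => [c G H|c G H|p].
- by rewrite integralP pskewP.
- by rewrite mulrDr -scalerAr integralP.
rewrite integral_lmono pskew_prod // mulr_suml.
rewrite [RHS]integral_sum; apply: eq_bigr => i _.
have -> : lvarV i ^+ r * lmono p = lmono ([ffun j => - (r%:Z * (i == j)%:Z)] + p).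
  by rewrite lvarVX; exact: lmonoM.
rewrite integral_lmono.
rewrite [RHS](bigD1 i isT).
apply: (congr2 *%R).
  rewrite pskew_hsym //.
  by congr (esym_val h _); rewrite !ffunE eqxx mulr1 addrC.
apply: eq_bigr => j ji; congr (esym_val h _); rewrite !ffunE eq_sym (negPf ji).
by rewrite mulr0 oppr0 add0r.
Qed.

Lemma jdot1_integral n (F : laurent n) : jdot alpha 1 (integral h F) = F@_0.
Proof.
apply: (laurent_linear_eq (V := rat^o)
  (u := fun F => jdot alpha 1 (integral h F)) (v := fun F => F@_0)) => [c G H|c G H|p].
- by rewrite integralP jdotPr.
- by rewrite mcoeffD mcoeffZ.
rewrite integral_lmono coef_lmono.
rewrite jdot1 (rmorph_prod (@mcoeff intpart rat mone)).
rewrite (eq_bigr _ (fun i _ => mcoeff1_hsym (p i))).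
case: eqP => [->|p0]; first by rewrite big1 // => i _; rewrite ffunE eqxx.
case: (pickP (fun i => p i != 0)) => [i /negPf pi0|p_eq0].
  by rewrite (bigD1 i) //= pi0 mul0r.
by case: p0; apply/ffunP => i; rewrite ffunE; have /eqP := p_eq0 i.
Qed.

(** After the twist by 1/alpha, the integral of F represents the linear form
    sending f to the constant term of f(X^v) F.  Moving the power sums of f to the
    other side of the scalar product as derivations reduces this to f = 1. *)
Lemma jdot_integral n f (F : laurent n) :
  jdot alpha f (integral h F) = (sfeval (finite_alphabet (@lvarV n)) f * F)@_0.
Proof.
apply: (linear_basis_eq (V := rat^o) (u := fun f => jdot alpha f (integral h F))
  (v := fun f => (sfeval (finite_alphabet (@lvarV n)) f * F)@_0)) => [c f1 f2|c f1 f2|la].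
- by rewrite jdotPl.
- by rewrite [sfeval _ _]linearP mulrDl -scalerAl mcoeffD mcoeffZ.
rewrite -/(psi la) psiE.
have: all (leq 1) (parts la) by apply/allP => i /intpart_gt0.
elim: (parts la) F => [|r s IH] F.
  by rewrite big_nil jdot1_integral rmorph1 mul1r.
move=> /andP[r0 s0]; rewrite big_cons (jdot_pskew alpha r0) (pskew_integral _ r0) (IH _ s0).
by rewrite rmorphM /= (sfeval_powersum _ r0) mulrCA mulrA.
Qed.
End Reproducing.

(** * Dominance and triangularity *)
Opaque pskew lext psi mkmalgU.

Lemma sumn_takeS (s : seq nat) i : sumn (take i.+1 s) = (sumn (take i s) + nth 0%N s i)%N.
Proof.
elim: s i => [|x s IH] [|i] //=; first by rewrite take0 /= addn0.
by rewrite IH addnA.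
Qed.

Lemma sumn_take_le (s : seq nat) i : (sumn (take i s) <= sumn s)%N.
Proof. by rewrite -{2}(cat_take_drop i s) sumn_cat leq_addr. Qed.

Lemma size_le_sumn (la : intpart) : (size la <= sumn la)%N.
Proof.
have: all (leq 1) (parts la) by apply/allP => i /intpart_gt0.
elim: (parts la) => //= i s IH /andP[i0 /IH]; lia.
Qed.

Lemma intpart_nth_eq (la mu : intpart) :
  (forall i, nth 0%N la i = nth 0%N mu i) -> la = mu.
Proof.
move=> E; apply: val_inj => /=.
have lt (ka nu : intpart) : (forall i, nth 0%N ka i = nth 0%N nu i) -> (size ka <= size nu)%N.
  move=> {}E; rewrite leqNgt; apply/negP => lt.
  by have := intpart_gt0 (mem_nth 0%N lt); rewrite E nth_default.
have sE : size la = size mu by apply/eqP; rewrite eqn_leq !lt.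
by apply: (eq_from_nth (x0 := 0%N)).
Qed.

Lemma dominated_refl la : dominated la la.
Proof. by []. Qed.

Lemma dominated_trans mu la nu : dominated la mu -> dominated mu nu -> dominated la nu.
Proof.
by move=> [lm lmi] [mn mni]; split=> [|i]; rewrite ?lm //; apply: leq_trans (lmi i) (mni i).
Qed.

Lemma dominated_anti la mu : dominated la mu -> dominated mu la -> la = mu.
Proof.
move=> [_ lm] [_ ml]; apply: intpart_nth_eq => i.
have E j : sumn (take j la) = sumn (take j mu) by apply/eqP; rewrite eqn_leq lm ml.
by have := E i.+1; rewrite !sumn_takeS E => /addnI.
Qed.

Definition dominatedb (mu la : intpart) : bool :=
  ((sumn mu == sumn la) &&
   [forall i : 'I_(sumn la).+1, sumn (take i mu) <= sumn (take i la)])%N.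

Lemma dominatedP mu la : reflect (dominated mu la) (dominatedb mu la).
Proof.
apply: (iffP andP) => [[/eqP E /forallP le]|[E le]]; last first.
  by split; [apply/eqP | apply/forallP => i].
split=> // i; have [lt|ge] := ltnP i (sumn la).+1; first exact: (le (Ordinal lt)).
rewrite !take_oversize ?E //; apply: leq_trans (size_le_sumn _) _; lia.
Qed.

(** A rank that increases strictly along the dominance order, for the
    inductions on that order. *)
Definition dom_rank (la : intpart) := (\sum_(i < (sumn la).+1) sumn (take i la))%N.

Lemma dom_rank_lt mu la : strictly_dominated mu la -> (dom_rank mu < dom_rank la)%N.
Proof.
move=> [[E le] ne]; rewrite ltn_neqAle; apply/andP; split; last first.
  by rewrite /dom_rank E; apply: leq_sum => i _.
apply/negP => /eqP eqr; apply: ne.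
have {}eqr (i : 'I_(sumn la).+1) : sumn (take i mu) = sumn (take i la).
  have [_] := leqif_sum (P := predT) (fun (j : 'I_(sumn la).+1) _ => leqif_eq (le j)).
  by move: eqr; rewrite /dom_rank E => -> /[!eqxx] /eqP; rewrite eq_sym eqb_id => /forallP/(_ i)/eqP.
apply: dominated_anti; split=> // i; have [lt|ge] := ltnP i (sumn la).+1.
  by rewrite (eqr (Ordinal lt)).
rewrite !take_oversize ?E //; apply: leq_trans (size_le_sumn _) _; lia.
Qed.

(** The negated exponents are those of the monomials in the inverse variables. *)
Definition nexp n (b : 'I_n -> nat) : {ffun 'I_n -> int} := [ffun i => - (b i)%:Z].

Definition part_of n (b : 'I_n -> nat) : intpart := mkpart [seq b i | i <- enum 'I_n].

Lemma prod_lvarV n (b : 'I_n -> nat) : \prod_(i < n) lvarV i ^+ b i = lmono (nexp b).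
Proof.
pose e i := [ffun j => - ((b i)%:Z * (i == j)%:Z)] : {ffun 'I_n -> int}.
rewrite (eq_bigr (fun i => lmono (e i))) => [|i _]; last exact: lvarVX.
have -> : nexp b = \sum_(i < n) e i.
  apply/ffunP => j; rewrite sum_ffunE !ffunE (bigD1 j) //= ffunE eqxx mulr1.
  rewrite big1 ?addr0 // => i /negPf ij; by rewrite ffunE ij mulr0 oppr0.
by elim/big_rec2: _ => // i x y _ ->; rewrite lmonoM.
Qed.

Lemma monomial_eval_lvarV n mu :
  monomial_eval (@lvarV n) mu =
  \sum_(a : {ffun 'I_n -> 'I_(sumn mu).+1} | part_of (fun i => a i) == mu)
    lmono (nexp (fun i => a i)).
Proof. by apply: eq_bigr => a _; rewrite prod_lvarV. Qed.

Lemma coef_monomial n mu (b : 'I_n -> nat) :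
  (monomial_eval (@lvarV n) mu)@_(nexp b) = (part_of b == mu)%:R.
Proof.
rewrite monomial_eval_lvarV raddf_sum /=.
have nexp_inj (a c : 'I_n -> nat) : (nexp a == nexp c) = [forall i, a i == c i].
  apply/eqP/forallP => [/ffunP E i|E]; last by apply/ffunP=> i; rewrite !ffunE (eqP (E i)).
  by have := E i; rewrite !ffunE => /oppr_inj[->].
have [bmu|bmu] := eqVneq (part_of b) mu; last first.
  rewrite big1 // => a /eqP amu; rewrite coef_lmono nexp_inj.
  case: forallP => // ab; case/eqP: bmu; rewrite -amu.
  by congr mkpart; apply: eq_map => i; rewrite (eqP (ab i)).
have b_le i : (b i < (sumn mu).+1)%N.
  rewrite ltnS -bmu (perm_sumn (perm_mkpart _)).
  have -> : sumn [seq j <- [seq b j | j <- enum 'I_n] | (0 < j)%N] = sumn [seq b j | j <- enum 'I_n].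
    by elim: [seq b j | j <- _] => //= -[|x] s /= ->.
  rewrite sumnE big_map big_enum /= (bigD1 i) //=; exact: leq_addr.
pose a : {ffun 'I_n -> 'I_(sumn mu).+1} := [ffun i => Ordinal (b_le i)].
have aE : (fun i => a i : nat) =1 b by move=> i; rewrite ffunE.
rewrite (bigD1 a) /=; last first.
  by apply/eqP; transitivity (part_of b) => //; congr mkpart; apply: eq_map.
rewrite coef_lmono nexp_inj (introT forallP) ?big1 ?addr0 // => [c /andP[_ ca]|i].
  rewrite coef_lmono nexp_inj; case: forallP => // cb; case/eqP: ca.
  by apply/ffunP => i; apply: val_inj; rewrite /= (eqP (cb i)) aE.
by rewrite aE.
Qed.

Lemma supported_monomial n mu :
  supported (fun q => exists2 b : 'I_n -> nat, q = nexp b & part_of b = mu)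
    (monomial_eval (@lvarV n) mu : laurent n).
Proof.
rewrite monomial_eval_lvarV; apply: supported_sum => a /eqP amu.
by apply: supportedU; exists (fun i => nat_of_ord (a i)).
Qed.

Section Unitriangular.
Variables (la : intpart) (f : symfun).
Hypothesis tri_f : unitriangular la f.

Lemma unitriangular_coef1 n (b : 'I_n -> nat) : part_of b = la ->
  (sfeval (finite_alphabet (@lvarV n)) f)@_(nexp b) = 1.
Proof.
case: tri_f => s [u [s_lt ->]] bla; rewrite mcoeffD coef_monomial bla eqxx raddf_sum.
rewrite big_seq big1 ?addr0 // => mu /s_lt[_ mula] /=.
rewrite mcoeffZ coef_monomial bla; case: eqP => [E|]; last by rewrite mulr0.
by case: mula; rewrite E.
Qed.

Lemma unitriangular_supported n :
  supported (fun q => exists2 b : 'I_n -> nat, q = nexp b & dominated (part_of b) la)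
    (sfeval (finite_alphabet (@lvarV n)) f : laurent n).
Proof.
case: tri_f => s [u [s_lt ->]]; apply: supportedD.
  by refine (supportedS (@supported_monomial n la) _) => q [b -> bla]; exists b; rewrite ?bla.
rewrite big_seq; apply: supported_sum => mu /s_lt[dom _]; apply: supportedZ.
by refine (supportedS (@supported_monomial n mu) _) => q [b -> bmu]; exists b; rewrite ?bmu.
Qed.
End Unitriangular.

Lemma part_of_nth (la : intpart) : part_of (fun i : 'I_(size la) => nth 0%N la i) = la.
Proof.
rewrite /part_of -[RHS]mkpartK; congr mkpart.
by rewrite (map_comp (nth 0%N la) val) val_enum_ord map_nth_iota0 // take_size.
Qed.

(** * Orthogonality and triangularity of Jack functions *)

Section Gamma.
Variable alpha : rat.
Hypothesis alpha_neq0 : alpha != 0.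
Notation h := (signed_powersum alpha^-1).

(** Evaluation at this alphabet sends Psi_la to the product g_la of the
    functions g_p. *)
Definition hsym_alphabet : alphabet symfun := fun i => sfeval h (esym i).

Lemma hsym_psi (la : intpart) :
  sfeval hsym_alphabet (psi la) =
  integral h (lmono [ffun i : 'I_(size la) => (nth 0%N la i)%:Z]).
Proof.
rewrite sfeval_psi integral_lmono (big_nth 0%N) big_mkord.
by apply: eq_bigr => i _; rewrite ffunE.
Qed.

(** Duality of the g_la and the monomial functions: the scalar product with g_la
    extracts the coefficient of the monomial with exponents la. *)
Lemma jdot_hsym_psi f (la : intpart) :
  jdot alpha f (sfeval hsym_alphabet (psi la)) =
  (sfeval (finite_alphabet (@lvarV (size la))) f)@_(nexp (fun i => nth 0%N la i)).
Proof.
rewrite hsym_psi jdot_integral // [LHS]coef_lmonoM sub0r.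
by congr (_ @_ _); apply/ffunP => i; rewrite !ffunE.
Qed.

Lemma jdot_hsym f F :
  jdot alpha f (sfeval hsym_alphabet F) =
  \sum_(la <- msupp F) F@_la * jdot alpha f (sfeval hsym_alphabet (psi la)).
Proof.
rewrite -/(lext (V := rat^o) (fun la => jdot alpha f (sfeval hsym_alphabet (psi la))) F).
apply: (linear_basis_eq (V := rat^o)
  (u := fun F => jdot alpha f (sfeval hsym_alphabet F))
  (v := lext (V := rat^o) (fun la => jdot alpha f (sfeval hsym_alphabet (psi la)))))
  => [c G H|c G H|la].
- by rewrite [sfeval _ _]linearP jdotPr.
- by rewrite linearP.
- by rewrite lextU.
Qed.

(** Since alpha is invertible, Newton's identities express p_r through
    g_1, ..., g_r. *)
Lemma hsym_surjective f : exists F, sfeval hsym_alphabet F = f.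
Proof.
suff pE r : exists F, sfeval hsym_alphabet F = powersum r.
  elim/malg_ind: f => [|c la f [F <-]]; first by exists 0; rewrite linear0.
  suff [G GE] : exists G, sfeval hsym_alphabet G = psi la.
    by exists (c *: G + F); rewrite [LHS]linearP /= GE.
  rewrite psiE; elim: (parts la) => [|r s [G GE]].
    by rewrite big_nil; exists 1; rewrite rmorph1.
  have [H HE] := pE r; exists (H * G).
  by rewrite big_cons [LHS]rmorphM /= HE GE.
elim/ltn_ind: r {f} => -[|m] IH.
  by exists 1; rewrite [LHS]rmorph1; congr psi; apply: val_inj.
have m0 : m.+1%:R != 0 :> rat by rewrite Num.Theory.pnatr_eq0.
pose im f := exists F, sfeval hsym_alphabet F = f.
have imD f g : im f -> im g -> im (f + g).
  by move=> [F <-] [G <-]; exists (F + G); exact: rmorphD.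
have imM f g : im f -> im g -> im (f * g).
  by move=> [F <-] [G <-]; exists (F * G); exact: rmorphM.
have imZ c f : im f -> im (c *: f).
  by move=> [F <-]; exists (c *: F); exact: linearZ_LR.
have im_h j : im (sfeval h (esym j)).
  case: j => [|j]; first by exists 1; rewrite esym0 [LHS]rmorph1 [RHS]rmorph1.
  by exists (powersum j.+1); exact: sfeval_powersum.
have -> : powersum m.+1 = (alpha * m.+1%:R) *: sfeval h (esym m.+1) +
    (- 1) *: \sum_(i < m) powersum i.+1 * sfeval h (esym (m - i)).
  rewrite -[X in X + _]scalerA signed_newton [X in X + _]scalerA (mulfV alpha_neq0) [X in X + _]scale1r.
  by rewrite big_ord_recr /= subnn esym0 rmorph1 mulr1 scaleN1r [X in X - _]addrC addrK.
apply: (imD); first exact/imZ/im_h.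
apply: imZ; elim/big_rec: _ => [|i f _ IHf]; first by exists 0; exact: rmorph0.
apply: imD IHf; apply: imM; [apply: IH; exact: (ltn_ord i) | exact: im_h].
Qed.
End Gamma.

Section Jack.
Variables (alpha : rat) (P Q : intpart -> symfun).
Hypothesis alpha_neq0 : alpha != 0.
Hypotheses (jackP : is_jackP alpha P) (jackQ : is_jackQ alpha P Q).
Notation gsym := (sfeval (hsym_alphabet alpha)).

Lemma jdot_P_hsym1 la : jdot alpha (P la) (gsym (psi la)) = 1.
Proof.
rewrite jdot_hsym_psi //; apply: unitriangular_coef1 (part_of_nth la).
by case: jackP.
Qed.

Lemma jdot_P_hsym la mu :
  jdot alpha (P la) (gsym (psi mu)) != 0 -> dominated mu la.
Proof.
rewrite jdot_hsym_psi // => /(unitriangular_supported (jackP.2 la))[b bE].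
suff -> : part_of b = mu by [].
rewrite -[RHS]part_of_nth; congr mkpart; apply: eq_map => i.
by have /ffunP/(_ i) := bE; rewrite !ffunE => /oppr_inj[].
Qed.

Lemma min_dom_rank (F : symfun) (C : pred intpart) :
  has C (msupp F) -> exists2 la, (la \in msupp F) && C la &
    forall mu, mu \in msupp F -> C mu -> ~ strictly_dominated mu la.
Proof.
move=> hasC.
suff [la /andP[laF Cla] le] : exists2 la, (la \in msupp F) && C la &
    forall mu, mu \in msupp F -> C mu -> (dom_rank la <= dom_rank mu)%N.
  exists la; rewrite ?laF // => mu muF Cmu /dom_rank_lt.
  by rewrite ltnNge le.
pose ex := [pred r : nat | has (fun la => C la && (dom_rank la == r)) (msupp F)].
have exr : exists r, ex r.
  by have /hasP[la laF Cla] := hasC; exists (dom_rank la); apply/hasP; exists la; rewrite ?Cla /=.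
case: (ex_minnP exr) => r /hasP[la laF /andP[Cla /eqP rE]] rmin.
exists la; rewrite ?laF // => mu muF Cmu; rewrite rE; apply: rmin.
by apply/hasP; exists mu; rewrite ?Cmu /=.
Qed.

(** In a nonzero combination of the g_la, take a term la that is minimal for
    dominance: P_la is orthogonal to all the other terms, because <P_la, g_mu>
    vanishes unless mu <= la. *)
Lemma jackP_separating f : (forall la, jdot alpha f (P la) = 0) -> f = 0.
Proof.
have [F <-] := hsym_surjective alpha_neq0 f => F0.
suff -> : F = 0 by rewrite linear0.
apply/eqP; rewrite -msupp_eq0; apply/negPn/negP => Fn0.
have hasF : has predT (msupp F).
  by case/fset0Pn: Fn0 => la laF; apply/hasP; exists la.
have [la /andP[laF _] la_min] := min_dom_rank hasF.
have := F0 la; rewrite jdotC jdot_hsym (big_fsetD1 la laF) /= [in X in X + _]jdot_P_hsym1 mulr1.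
rewrite big_seq big1 ?addr0.
  by move/eqP; rewrite mcoeff_eq0 laF.
move=> mu; rewrite !inE => /andP[mula muF].
have [->|/jdot_P_hsym dom] := eqVneq (jdot alpha (P la) (gsym (psi mu))) 0.
  by rewrite mulr0.
by case: (la_min mu muF isT); split=> //; apply/eqP.
Qed.

Lemma jackP_eq f g : (forall la, jdot alpha f (P la) = jdot alpha g (P la)) -> f = g.
Proof.
move=> fg; apply/eqP; rewrite -subr_eq0; apply/eqP/jackP_separating => la.
by rewrite jdotBl fg subrr.
Qed.

(** The matrix <P_la, g_mu> is unitriangular, hence so is the expansion of the
    dual basis Q on the g_mu, in the opposite direction. *)
Lemma jackQ_hsym la : exists F, [/\ gsym F = Q la, F@_la = 1 &
  forall mu, F@_mu != 0 -> dominated la mu].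
Proof.
have [F FE] := hsym_surjective alpha_neq0 (Q la); exists F.
have E nu : \sum_(mu <- msupp F) F@_mu * jdot alpha (P nu) (gsym (psi mu)) = (la == nu)%:R.
  by rewrite -jdot_hsym FE jdotC jackQ.
have dom mu : F@_mu != 0 -> dominated la mu.
  move=> muF; apply/dominatedP/negPn/negP => ndom.
  have hasF : has (fun nu => ~~ dominatedb la nu) (msupp F).
    by apply/hasP; exists mu; rewrite -?mcoeff_neq0.
  have [nu /andP[nuF nDnu] nu_min] := min_dom_rank hasF.
  have := E nu; have -> : (la == nu) = false.
    by apply: contraNF nDnu => /eqP <-; apply/dominatedP.
  rewrite (big_fsetD1 nu nuF) /= [in X in X + _]jdot_P_hsym1 mulr1 big_seq big1 ?addr0.
    by move/eqP; rewrite mcoeff_eq0 nuF.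
  move=> ka; rewrite !inE => /andP[kanu kaF].
  have [->|/jdot_P_hsym dom] := eqVneq (jdot alpha (P nu) (gsym (psi ka))) 0.
    by rewrite mulr0.
  case: (nu_min ka kaF); last by split=> //; apply/eqP.
  by apply: contra nDnu => /dominatedP laka; apply/dominatedP/(dominated_trans laka).
split=> //; have := E la; rewrite eqxx.
have [laF|laF] := boolP (la \in msupp F); last first.
  rewrite big_seq big1 => [/eqP|mu muF]; first by rewrite eq_sym oner_eq0.
  have [->|/jdot_P_hsym mula] := eqVneq (jdot alpha (P la) (gsym (psi mu))) 0.
    by rewrite mulr0.
  have lamu : dominated la mu by apply: dom; rewrite mcoeff_neq0.
  by case/negP: laF; rewrite (dominated_anti lamu mula).
rewrite (big_fsetD1 la laF) /= [in X in X + _]jdot_P_hsym1 mulr1 big_seq big1 ?addr0 // => mu.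
rewrite !inE => /andP[/eqP mula muF].
have [->|/jdot_P_hsym dom'] := eqVneq (jdot alpha (P la) (gsym (psi mu))) 0.
  by rewrite mulr0.
by case: mula; apply: dominated_anti => //; apply: dom; rewrite mcoeff_neq0.
Qed.

Lemma jackP_norm_neq0 la : jdot alpha (P la) (P la) != 0.
Proof.
apply/eqP => nz; have P0 : P la = 0.
  apply: jackP_separating => mu; have [<-//|/eqP ne] := eqVneq la mu.
  by case: jackP => orth _; apply: orth.
by have := jdot_P_hsym1 la; rewrite P0 jdot0l => /eqP; rewrite eq_sym oner_eq0.
Qed.

Lemma jackPE la : P la = jdot alpha (P la) (P la) *: Q la.
Proof.
apply: jackP_eq => mu; rewrite jdotZl jackQ.
case: eqVneq => [<-|/eqP ne]; first by rewrite mulr1.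
by rewrite mulr0; case: jackP => orth _; apply: orth.
Qed.

Lemma jackQE la : Q la = jack_b alpha P la *: P la.
Proof. by rewrite [in RHS]jackPE scalerA mulVf ?scale1r // jackP_norm_neq0. Qed.
End Jack.

(** * Conjugate partitions *)

Lemma sorted_geq0 s : sorted geq (0%N :: s) -> all (pred1 0%N) s.
Proof.
move=> /= /(order_path_min (rev_trans leq_trans)) /allP s0.
by apply/allP => x /s0 /=; rewrite leqn0.
Qed.

Lemma sumn_take_pos s i : sorted geq s ->
  sumn (take i [seq x <- s | (0 < x)%N]) = sumn (take i s).
Proof.
elim: s i => [|[|x] s IH] i // s_sorted /=.
  have s0 := sorted_geq0 s_sorted.
  have -> : [seq x <- s | (0 < x)%N] = [::].
    by elim: s s0 {IH s_sorted} => //= x s IH /andP[/eqP-> /IH].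
  case: i => //= i; elim: s s0 i {IH s_sorted} => //= x s IH /andP[/eqP-> /IH E] [|i] //=.
  by rewrite -E.
by case: i => //= i; rewrite IH // (path_sorted s_sorted).
Qed.

Lemma mkpart_sorted s : sorted geq s -> mkpart s = [seq x <- s | (0 < x)%N] :> seq nat.
Proof.
move=> s_sorted /=; rewrite sorted_sort //; first exact: rev_trans leq_trans.
by apply: sorted_filter => //; apply: rev_trans leq_trans.
Qed.

Lemma sumn_count_leq s N :
  sumn [seq count (leq j) s | j <- iota 1 N] = (\sum_(x <- s) minn x N)%N.
Proof.
elim: N => [|N IH]; first by rewrite big1 // => x _; rewrite minn0.
have -> : iota 1 N.+1 = iota 1 N ++ [:: N.+1] by rewrite -(addn1 N) iotaD add1n addn1.
rewrite map_cat sumn_cat IH /= addn0.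
elim: s {IH} => [|x s IH]; first by rewrite !big_nil.
rewrite !big_cons /= -IH; lia.
Qed.

Lemma mem_le_sumn (s : seq nat) x : x \in s -> (x <= sumn s)%N.
Proof. by elim: s => //= y s IH; rewrite inE => /predU1P[->|/IH]; lia. Qed.

(** Both sides count the cells in the first i columns of the diagram. *)
Lemma sumn_take_conj (la : intpart) i :
  sumn (take i (conj_part la)) = (\sum_(x <- parts la) minn x i)%N.
Proof.
rewrite mkpart_sorted; last first.
  have: sorted leq (iota 1 (sumn la)) by apply: iota_sorted.
  rewrite sorted_map; apply: sub_sorted => a b ab /=.
  by apply: sub_count => x /(leq_trans ab).
rewrite sumn_take_pos; last first.
  have: sorted leq (iota 1 (sumn la)) by apply: iota_sorted.
  rewrite sorted_map; apply: sub_sorted => a b ab /=.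
  by apply: sub_count => x /(leq_trans ab).
rewrite -map_take take_iota sumn_count_leq big_seq [RHS]big_seq.
by apply: eq_bigr => x /mem_le_sumn; lia.
Qed.

Lemma nth_conj (la : intpart) i : nth 0%N (conj_part la) i = count (ltn i) la.
Proof.
have := sumn_takeS (conj_part la) i; rewrite !sumn_take_conj => E.
suff E2 : (\sum_(x <- parts la) minn x i.+1 =
            \sum_(x <- parts la) minn x i + count (ltn i) la)%N by lia.
elim: (parts la) {E} => [|x s IH]; first by rewrite !big_nil.
rewrite !big_cons /= IH; lia.
Qed.

Lemma sumn_conj la : sumn (conj_part la) = sumn la.
Proof.
have := sumn_take_conj la (maxn (sumn la) (size (conj_part la))).
rewrite take_oversize ?leq_maxr // => ->.
rewrite [RHS]sumnE big_seq [RHS]big_seq; apply: eq_bigr => x /mem_le_sumn; lia.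
Qed.

Lemma sumn_take_excess s t i : (sumn (take s t) <= s * i + \sum_(x <- t) (x - i))%N.
Proof.
elim: t s => [|x t IH] [|s] //=; rewrite big_cons; have := IH s; lia.
Qed.

Lemma sumn_take_excess_sorted t i : sorted geq t ->
  (\sum_(x <- t) (x - i) + count (ltn i) t * i = sumn (take (count (ltn i) t) t))%N.
Proof.
elim: t => [|x t IH] t_sorted; first by rewrite big_nil.
have {}IH := IH (path_sorted t_sorted); rewrite big_cons /=.
have [ix|xi] := ltnP i x; first by rewrite add1n /= -IH; lia.
have tx : all (geq x) t by apply: order_path_min t_sorted; apply: rev_trans leq_trans.
have -> : count (ltn i) t = 0%N.
  apply/eqP; rewrite -leqn0 leqNgt -has_count; apply/hasPn => y /(allP tx) /=; lia.
rewrite /= big_seq big1 => [|y /(allP tx) /=]; lia.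
Qed.

Lemma intpart_sorted (la : intpart) : sorted geq la.
Proof. by case: la => s /= /andP[]. Qed.

(** The first i columns contain all cells of the diagram but \sum_x (x - i), where
    x runs over the parts larger than i.  This sum is the maximum over s of
    la_1 + ... + la_s - s i, hence it increases with la. *)
Lemma dominated_conj mu la : dominated mu la -> dominated (conj_part la) (conj_part mu).
Proof.
move=> [E le]; split=> [|i]; first by rewrite !sumn_conj.
rewrite !sumn_take_conj.
have minE (s : seq nat) : (\sum_(x <- s) minn x i + \sum_(x <- s) (x - i) = sumn s)%N.
  rewrite sumnE -big_split /=; apply: eq_bigr => x _; lia.
have := minE la; have := minE mu; rewrite E.
have := sumn_take_excess (count (ltn i) mu) la i; have := le (count (ltn i) mu).
have := sumn_take_excess_sorted i (intpart_sorted mu).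
lia.
Qed.

Lemma conj_inj : injective conj_part.
Proof.
move=> la mu E; apply: intpart_eq.
have cE i : count (ltn i) la = count (ltn i) mu by rewrite -!nth_conj E.
have cm (s : seq nat) x : (count_mem x.+1 s + count (ltn x.+1) s = count (ltn x) s)%N.
  by elim: s => //= y s; case: eqP; lia.
apply/allP => -[|x] _ /=; last first.
  by apply/eqP/(@addIn (count (ltn x.+1) la)); rewrite [LHS]cm [in RHS]cE [RHS]cm cE.
have c0 (nu : intpart) : count_mem 0%N nu = 0%N.
  by apply/count_memPn; apply/negP => /intpart_gt0.
by rewrite !c0.
Qed.

Lemma intpart_take_eq (la mu : intpart) :
  (forall i, sumn (take i la) = sumn (take i mu)) -> la = mu.
Proof.
by move=> E; apply: intpart_nth_eq => i; have := E i.+1; rewrite !sumn_takeS E => /addnI.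
Qed.

Lemma sorted_nseq m n : sorted geq (nseq m n).
Proof. by case: m => //= m; elim: m => //= m ->; rewrite leqnn. Qed.

Lemma sumn_take_rect n m i : sumn (take i (rect_part n m)) = (n * minn i m)%N.
Proof.
rewrite mkpart_sorted ?sorted_nseq // sumn_take_pos ?sorted_nseq //.
have [im|mi] := leqP i m; first by rewrite take_nseq // sumn_nseq.
by rewrite take_oversize ?size_nseq 1?ltnW // sumn_nseq.
Qed.

Lemma conj_rect n m : conj_part (rect_part n m) = rect_part m n.
Proof.
apply: intpart_take_eq => i; rewrite sumn_take_conj sumn_take_rect.
rewrite mkpart_sorted ?sorted_nseq // big_filter big_mkcond /=.
rewrite (eq_bigr (fun x => minn x i)) => [|x _]; last by case: x => //=; rewrite min0n.
by rewrite big_nseq iter_addn addn0 mulnC minnC.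
Qed.

(** * Duality between the parameters k and 1/k *)

Section ElementaryCoefficients.
Variable n : nat.
Notation "'x^'" := (finite_alphabet (@lvarV n)).

Definition indic (S : {set 'I_n}) (i : 'I_n) : nat := i \in S.

Lemma sfeval_lvarV_esym m :
  sfeval x^ (esym m) = \sum_(S : {set 'I_n} | #|S| == m) lmono (nexp (indic S)) :> laurent n.
Proof.
rewrite sfeval_esym.
under eq_bigr do rewrite addrC.
have termE (S : {set 'I_n}) :
    \prod_i (if i \in S then (lvarV i)%:P * 'X else 1) = (lmono (nexp (indic S)))%:P * 'X^#|S|.
  rewrite -big_mkcond big_split /= prodr_const; congr (_ * _).
  rewrite -rmorph_prod -prod_lvarV big_mkcond; congr _%:P; apply: eq_bigr => i _.
  by rewrite /indic; case: (i \in S); rewrite ?expr1 ?expr0.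
rewrite bigA_distr coef_sum [RHS]big_mkcond; apply: eq_bigr => S _.
by rewrite termE coefCM coefXn eq_sym; case: eqP; rewrite ?mulr1 ?mulr0.
Qed.

(** The sum of the minn x i is the sum of the first i parts of the conjugate of
    s, so this says that the exponents b are dominated by that conjugate. *)
Definition below_conj (s : seq nat) (q : {ffun 'I_n -> int}) : Prop :=
  exists2 b : 'I_n -> nat, q = nexp b &
    (forall i, (\sum_(j < n | (j < i)%N) b j <= \sum_(x <- s) minn x i)%N) /\
    (\sum_(j < n) b j = sumn s)%N.

Lemma sum_ltn_ord i : (\sum_(j < n | (j < i)%N) 1 = minn n i)%N.
Proof.
rewrite big_mkcond /=; elim: n => [|N IH]; first by rewrite big_ord0; lia.
by rewrite big_ord_recr /= IH; case: ltnP; lia.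
Qed.

Lemma sum_indic S : (\sum_j indic S j = #|S|)%N.
Proof.
rewrite -sum1_card [RHS]big_mkcond; apply: eq_bigr => j _.
by rewrite /indic; case: (j \in S).
Qed.

Lemma sum_indic_lt S i : (\sum_(j < n | (j < i)%N) indic S j <= minn #|S| i)%N.
Proof.
rewrite leq_min; apply/andP; split.
  by rewrite -sum_indic big_mkcond; apply: leq_sum => j _; case: ifP.
have /leq_trans -> // : (\sum_(j < n | (j < i)%N) indic S j <= minn n i)%N.
  by rewrite -sum_ltn_ord; apply: leq_sum => j _; rewrite /indic; case: (j \in S).
exact: geq_minr.
Qed.

Lemma nexpD (a b : 'I_n -> nat) : nexp a + nexp b = nexp (fun i => a i + b i)%N.
Proof. by apply/ffunP => i; rewrite !ffunE PoszD opprD. Qed.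

Lemma nexpI (a b : 'I_n -> nat) : nexp a = nexp b -> a =1 b.
Proof. by move=> /ffunP E i; have := E i; rewrite !ffunE => /oppr_inj[]. Qed.

Lemma supported_eprod s :
  supported (below_conj s) (sfeval x^ (\prod_(x <- s) esym x) : laurent n).
Proof.
elim: s => [|m s IH].
  rewrite big_nil rmorph1; apply: supported1; exists (fun=> 0%N).
    by apply/ffunP => i; rewrite !ffunE.
  by split=> [i|]; rewrite big1 ?big_nil.
rewrite big_cons rmorphM; refine (supportedM (P := below_conj [:: m]) _ _ IH).
  move=> _ _ [a -> [al aE]] [b -> [bl bE]]; exists (fun i => a i + b i)%N.
    exact: nexpD.
  split=> [i|]; last by rewrite big_split /= aE bE /= addn0.
  by rewrite big_split big_cons leq_add //; have := al i; rewrite big_seq1.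
rewrite /= sfeval_lvarV_esym; apply: supported_sum => S /eqP Sm.
apply: supportedU; exists (indic S) => //; split=> [i|]; last by rewrite sum_indic /= addn0.
by rewrite big_seq1 -Sm sum_indic_lt.
Qed.

(** The exponents attain the bound of [supported_eprod], so that each factor e_m
    can only contribute z_1 ... z_m. *)
Lemma lead_eprod s : all (fun x => x <= n)%N s ->
  (sfeval x^ (\prod_(x <- s) esym x))@_(nexp (fun j : 'I_n => count (ltn j) s)) = 1.
Proof.
elim: s => [_|m s IH /= /andP[mn sn]].
  have -> : nexp (fun j : 'I_n => count (ltn j) [::]) = 0.
    by apply/ffunP => i; rewrite !ffunE.
  by rewrite big_nil rmorph1 [LHS](coef_lmono 0 0) eqxx.
pose S0 : {set 'I_n} := [set i : 'I_n | (i < m)%N].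
have cardS0 : #|S0| = m.
  rewrite -sum1_card (eq_bigl (fun i : 'I_n => (i < m)%N)) => [|i]; last by rewrite inE.
  by rewrite sum_ltn_ord (minn_idPr mn).
rewrite big_cons rmorphM /= sfeval_lvarV_esym mulr_suml raddf_sum.
rewrite (bigD1 S0) /=; last by rewrite cardS0.
rewrite [X in _ + X]big1 => [|S /andP[/eqP Sm SS0]].
  rewrite addr0 mulrC [LHS]coef_lmonoM -[RHS](IH sn); congr (_ @_ _).
  apply/ffunP => i; rewrite !ffunE /indic inE; lia.
rewrite mulrC [LHS]coef_lmonoM; apply: (supported_coef0 (supported_eprod (s := s))).
case=> b bE [b_le _]; case/negP: SS0.
have {}bE i : (b i + indic S i = (i < m) + count (ltn i) s)%N.
  by have /ffunP/(_ i) := bE; rewrite !ffunE; lia.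
have sumc : (\sum_(j < n | (j < m)%N) count (ltn j) s = \sum_(x <- s) minn x m)%N.
  elim: s sn {IH b_le bE} => [_|x s IHs /= /andP[xn sn]]; first by rewrite big_nil big1.
  rewrite big_cons big_split /= IHs //; congr (_ + _)%N.
  have -> : minn x m = minn n (minn x m) by lia.
  rewrite -sum_ltn_ord big_mkcond [RHS]big_mkcond; apply: eq_bigr => j _ /=.
  by rewrite leq_min; case: (j < m)%N; case: (j < x)%N.
have sum_b := b_le m.
have sumE : (\sum_(j < n | (j < m)%N) b j + \sum_(j < n | (j < m)%N) indic S j =
    \sum_(j < n | (j < m)%N) 1 + \sum_(j < n | (j < m)%N) count (ltn j) s)%N.
  by rewrite -!big_split; apply: eq_bigr => j jm; rewrite /= bE jm.
have leS : (m <= \sum_(j < n | (j < m)%N) indic S j)%N.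
  by move: sumE sum_b; rewrite sumc sum_ltn_ord; lia.
have S0S : S0 \subset S.
  have cardI : #|S0 :&: S| = (\sum_(j < n | (j < m)%N) indic S j)%N.
    rewrite -sum1_card big_mkcond [RHS]big_mkcond; apply: eq_bigr => j _.
    by rewrite /indic !inE; case: (j < m)%N; case: (j \in S).
  have <- : S0 :&: S = S0 by apply/eqP; rewrite eqEcard subsetIl cardI cardS0.
  exact: subsetIr.
by rewrite eq_sym eqEcard S0S cardS0 Sm leqnn.
Qed.
End ElementaryCoefficients.

Lemma sum_nth_lt (s : seq nat) i :
  (\sum_(j < size s | (j < i)%N) nth 0%N s j = sumn (take i s))%N.
Proof.
elim: s i => [|x s IH] i; first by rewrite big_ord0.
case: i => [|i]; first by rewrite big_pred0.
rewrite big_mkcond big_ord_recl /= -IH; congr (_ + _)%N.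
by rewrite [RHS]big_mkcond.
Qed.

Section CompleteVersusElementary.
Variable al : rat.
Hypothesis al_neq0 : al != 0.
Notation gsym := (sfeval (hsym_alphabet al)).

Definition eprod (la : intpart) : symfun := \prod_(x <- parts la) esym x.

Lemma jdot_hsym_eprod rho ka :
  jdot al (gsym (psi rho)) (eprod ka) != 0 -> dominated rho (conj_part ka).
Proof.
rewrite jdotC (jdot_hsym_psi al_neq0) => /supported_eprod[b /nexpI bE [b_le b_sum]].
have sumE i : (\sum_(j < size rho | (j < i)%N) b j = sumn (take i rho))%N.
  by rewrite -sum_nth_lt; apply: eq_bigr => j _; rewrite bE.
have sumT : sumn rho = sumn ka.
  rewrite -b_sum -{1}(take_size rho) -sum_nth_lt; apply: eq_big => j; first by rewrite ltn_ord.
  by rewrite bE.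
split=> [|i]; first by rewrite sumn_conj.
by rewrite sumn_take_conj -sumE.
Qed.

Lemma jdot_hsym_eprod1 ka : jdot al (gsym (psi (conj_part ka))) (eprod ka) = 1.
Proof.
rewrite jdotC (jdot_hsym_psi al_neq0).
have -> : nexp (fun i : 'I_(size (conj_part ka)) => nth 0%N (conj_part ka) i) =
          nexp (fun i : 'I_(size (conj_part ka)) => count (ltn i) ka).
  by apply/ffunP => i; rewrite !ffunE nth_conj.
apply: lead_eprod; apply/allP => x xka; rewrite leqNgt; apply/negP => lt.
have := nth_conj ka (size (conj_part ka)); rewrite nth_default // => /eqP.
by rewrite eq_sym -leqn0 leqNgt -has_count => /negP[]; apply/hasP; exists x.
Qed.
End CompleteVersusElementary.

Lemma omega_eprod (k : rat) (ka : intpart) :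
  omega k (eprod ka) = sfeval (hsym_alphabet k^-1) (psi ka).
Proof.
rewrite sfeval_psi omegaE /eprod rmorph_prod; apply: eq_bigr => i _.
by rewrite /hsym_alphabet invrK.
Qed.

Lemma msupp_sum1 (F : symfun) (c : intpart -> rat) ka :
  (forall nu, F@_nu != 0 -> nu <> ka -> c nu = 0) ->
  \sum_(nu <- msupp F) F@_nu * c nu = F@_ka * c ka.
Proof.
move=> c0; have [kaF|kaF] := boolP (ka \in msupp F); last first.
  rewrite (mcoeff_outdom kaF) mul0r big_seq big1 // => nu nuF.
  rewrite c0 ?mulr0 ?mcoeff_neq0 // => E; by rewrite -E nuF in kaF.
rewrite (big_fsetD1 ka kaF) /= big_seq big1 ?addr0 // => nu.
by rewrite !inE => /andP[/eqP ne nuF]; rewrite c0 ?mulr0 ?mcoeff_neq0.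
Qed.

Opaque eprod.

Section Duality.
Variables (k : rat) (P1 Q1 P2 Q2 : intpart -> symfun).
Hypothesis k0 : k != 0.
Hypotheses (jackP1 : is_jackP k^-1 P1) (jackQ1 : is_jackQ k^-1 P1 Q1).
Hypotheses (jackP2 : is_jackP k P2) (jackQ2 : is_jackQ k P2 Q2).
Let kV0 : k^-1 != 0. Proof. by rewrite invr_eq0. Qed.

Lemma omega_isometry f g : jdot k^-1 (omega k f) (omega k g) = jdot k f g.
Proof. by rewrite jdot_omega expr2 -mulrA mulfV // mulr1. Qed.

(** P_nu is a multiple of Q_nu, hence a combination of the g_rho with rho >= nu,
    and the scalar product of g_rho with a product of elementary functions is a
    coefficient of the latter. *)
Lemma jackP2_eprodE nu ka : exists F : symfun, [/\ F@_nu = 1,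
  forall rho, F@_rho != 0 -> dominated nu rho &
  jdot k (P2 nu) (eprod ka) = jdot k (P2 nu) (P2 nu) *
    \sum_(rho <- msupp F) F@_rho * jdot k (eprod ka) (sfeval (hsym_alphabet k) (psi rho))].
Proof.
have [F [FE F1 Fdom]] := jackQ_hsym k0 jackP2 jackQ2 nu; exists F; split=> //.
have -> : jdot k (P2 nu) (eprod ka) =
    jdot k (P2 nu) (P2 nu) * jdot k (eprod ka) (Q2 nu).
  by rewrite -jdotZr -(jackPE k0 jackP2 jackQ2 nu) jdotC.
by apply: (congr1 ( *%R _)); rewrite -FE; exact: jdot_hsym.
Qed.

Lemma jackP2_eprod nu ka : jdot k (P2 nu) (eprod ka) != 0 -> dominated nu (conj_part ka).
Proof.
have [F [_ Fdom ->]] := jackP2_eprodE nu ka; rewrite mulf_eq0 => /norP[_ nz].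
apply/dominatedP; apply: contraNT nz => /dominatedP ndom.
rewrite big_seq big1 // => rho; rewrite -mcoeff_neq0 => /Fdom nurho.
have [->|] := eqVneq (jdot k (eprod ka) (sfeval (hsym_alphabet k) (psi rho))) 0.
  by rewrite mulr0.
by rewrite jdotC => /(jdot_hsym_eprod k0)/(dominated_trans nurho).
Qed.

Lemma jackP2_eprod1 ka :
  jdot k (P2 (conj_part ka)) (eprod ka) = jdot k (P2 (conj_part ka)) (P2 (conj_part ka)).
Proof.
have [F [F1 Fdom ->]] := jackP2_eprodE (conj_part ka) ka.
rewrite (msupp_sum1 (ka := conj_part ka)) => [|rho /Fdom dom ne].
  by rewrite F1 jdotC jdot_hsym_eprod1 // !mulr1.
have [//|] := eqVneq (jdot k (eprod ka) (sfeval (hsym_alphabet k) (psi rho))) 0.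
by rewrite jdotC => /(jdot_hsym_eprod k0) dom'; case: ne; apply: dominated_anti.
Qed.

(** For the parameter 1/k the functions g_ka are the images by omega_k of the
    products of elementary functions; Q_mu is a combination of those with
    ka >= mu. *)
Lemma omega_jackP2_Q1E nu mu : exists F : symfun, [/\ F@_mu = 1,
  forall ka, F@_ka != 0 -> dominated mu ka &
  jdot k^-1 (omega k (P2 nu)) (Q1 mu) =
    \sum_(ka <- msupp F) F@_ka * jdot k (P2 nu) (eprod ka)].
Proof.
have [F [FE F1 Fdom]] := jackQ_hsym kV0 jackP1 jackQ1 mu; exists F; split=> //.
rewrite -FE jdot_hsym; apply: eq_bigr => ka _; congr (_ * _).
by rewrite -omega_eprod omega_isometry.
Qed.

Lemma omega_jackP2_Q1 nu mu :
  jdot k^-1 (omega k (P2 nu)) (Q1 mu) != 0 -> dominated nu (conj_part mu).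
Proof.
have [F [_ Fdom ->]] := omega_jackP2_Q1E nu mu => nz.
apply/dominatedP; apply: contraNT nz => /dominatedP ndom.
rewrite big_seq big1 // => ka; rewrite -mcoeff_neq0 => /Fdom/dominated_conj muka.
have [->|/jackP2_eprod dom] := eqVneq (jdot k (P2 nu) (eprod ka)) 0; first by rewrite mulr0.
by case: ndom; apply: dominated_trans muka.
Qed.

Lemma omega_jackP2_Q1_conj mu :
  jdot k^-1 (omega k (P2 (conj_part mu))) (Q1 mu) =
  jdot k (P2 (conj_part mu)) (P2 (conj_part mu)).
Proof.
have [F [F1 Fdom ->]] := omega_jackP2_Q1E (conj_part mu) mu.
rewrite (msupp_sum1 (ka := mu)) => [|ka /Fdom/dominated_conj dom ne].
  by rewrite F1 mul1r jackP2_eprod1.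
have [//|/jackP2_eprod dom'] := eqVneq (jdot k (P2 (conj_part mu)) (eprod ka)) 0.
by case: ne; apply: conj_inj; apply: dominated_anti.
Qed.

Lemma dom_rank_le la : (dom_rank la <= (sumn la).+1 * sumn la)%N.
Proof.
rewrite /dom_rank -[X in (X * _)%N]card_ord -sum_nat_const.
by apply: leq_sum => i _; apply: sumn_take_le.
Qed.

(** Downward induction on the conjugate of la for the dominance order.  If
    omega_k P_(la') had a nonzero scalar product with Q_mu for some mu <> la, then
    la' < mu' by triangularity, so Q_mu = omega_k P_(mu') by induction, and the
    isometry omega_k contradicts the orthogonality of P_(la') and P_(mu').  Hence
    omega_k P_(la') = c Q_la, where c is the product of the two squared norms;
    comparing the squared norms of both sides gives c = 1. *)
Theorem jack_duality la :
  omega k (P2 (conj_part la)) = Q1 la /\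
  jdot k^-1 (P1 la) (P1 la) * jdot k (P2 (conj_part la)) (P2 (conj_part la)) = 1.
Proof.
(* The rank is bounded in each degree, so its distance to the bound decreases
   upwards along the dominance order. *)
have [N] := ubnP ((sumn la).+1 * sumn la - dom_rank (conj_part la)).
elim: N la => // N IH la leN.
set R := omega k _; set n1 := jdot _ (P1 la) _; set n2 := jdot k _ _.
have RQ0 mu : mu <> la -> jdot k^-1 R (Q1 mu) = 0.
  move=> ne; apply/eqP/negPn/negP => nz; have dom := omega_jackP2_Q1 nz.
  have sdom : strictly_dominated (conj_part la) (conj_part mu).
    by split=> // /conj_inj E; apply: ne.
  have lt : ((sumn mu).+1 * sumn mu - dom_rank (conj_part mu) < N)%N.
    have := dom_rank_lt sdom; have := dom_rank_le (conj_part mu).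
    by have [E _] := dom; rewrite !sumn_conj in E *; rewrite -E; move: leN; lia.
  have [RmuE _] := IH mu lt.
  case/negP: nz; rewrite -RmuE omega_isometry; apply/eqP.
  by case: jackP2 => orth _; apply: orth => /conj_inj E; apply: ne.
have RE : R = (n1 * n2) *: Q1 la.
  apply: (jackP_eq kV0 jackP1) => mu; rewrite jdotZl jackQ1.
  rewrite (jackPE kV0 jackP1 jackQ1 mu) jdotZr.
  have [<-|/eqP ne] := eqVneq la mu; first by rewrite omega_jackP2_Q1_conj mulr1.
  by rewrite RQ0 ?mulr0 // => E; apply: ne.
have n1nz : n1 != 0 := jackP_norm_neq0 kV0 jackP1 la.
have n2nz : n2 != 0 := jackP_norm_neq0 k0 jackP2 _.
have QQ : jdot k^-1 (Q1 la) (Q1 la) = n1^-1.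
  by rewrite {2}(jackQE kV0 jackP1 jackQ1 la) jdotZr jackQ1 eqxx mulr1.
have n2E : n2 = (n1 * n2) * ((n1 * n2) * n1^-1).
  by rewrite -QQ -(jdotZr k^-1) -(jdotZl k^-1) -RE omega_isometry.
have n12 : n1 * n2 = 1.
  by apply: (mulfI n2nz); rewrite mulr1 [RHS]n2E; field.
by rewrite RE n12 scale1r.
Qed.
End Duality.

(** * Dyson products *)

(** Dividing out the factors X - z_i one by one only requires that the differences
    of the roots be no zero divisors. *)
Lemma poly_eq0_of_regular_roots (I : eqType) (R : comNzRingType) (z : I -> R) :
  (forall i j y, i != j -> (z i - z j) * y = 0 -> y = 0) ->
  forall (s : seq I) (p : {poly R}), uniq s -> (size p <= size s)%N ->
  (forall i, i \in s -> p.[z i] = 0) -> p = 0.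
Proof.
move=> reg; elim=> [|i s IH] p; first by rewrite leqn0 size_poly_eq0 => _ /eqP.
move=> /= /andP[iNs s_uniq] sz_p p0.
have /factor_theorem[q pE] : root p (z i) by rewrite /root p0 // mem_head.
suff q0 : q = 0 by rewrite pE q0 mul0r.
apply: IH => // [|j js]; last first.
  have ji : j != i by apply: contraNneq iNs => <-.
  apply: (reg j i _ ji); have := p0 j; rewrite inE js orbT => /(_ isT).
  by rewrite pE hornerM hornerXsubC mulrC.
have [->|qn0] := eqVneq q 0; first by rewrite size_poly0.
by move: sz_p; rewrite pE size_Mmonic ?monicXsubC // size_XsubC addn2.
Qed.

(** In generating series this change of alphabet multiplies \sum_p e_p t^p by
    1 - z t. *)
Lemma sfeval_esym_sub (A : comAlgType rat) (X X' : alphabet A) (z : A) :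
  (forall i, X' i.+1 = X i.+1 - (-1) ^+ i * z ^+ i.+1) ->
  forall p, sfeval X' (esym p.+1) = sfeval X (esym p.+1) - z * sfeval X (esym p).
Proof.
move=> X'E p; pose E m := sfeval X (esym m).
pose E1 m := if m is m'.+1 then E m' else 0.
(* The coefficient of t^m in (1 - z t) \sum_p e_p t^p. *)
pose s m := E m - z * E1 m.
have T m : \sum_(i < m.+1) z ^+ i.+1 * s (m - i)%N = z * E m.
  elim: m => [|m IH]; first by rewrite big_ord1 /s /= mulr0 subr0.
  rewrite big_ord_recl expr1 subn0.
  rewrite (eq_bigr (fun i : 'I_m.+1 => z * (z ^+ i.+1 * s (m - i)%N))) => [|i _]; last first.
    by rewrite mulrA -exprS subSS.
  by rewrite -mulr_sumr IH /s /= mulrBr subrK.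
suff sP m : s m = sfeval X' (esym m) by rewrite -sP.
apply: newton_unique => [|{}m]; first by rewrite /s /E esym0 rmorph1 mulr0 subr0.
pose N j := \sum_(i < j) (-1) ^+ i * X i.+1 * E (j.-1 - i)%N.
have NE j : j%:R *: E j = N j.
  by case: j => [|j]; rewrite /N ?big_ord0 ?scale0r // /E sfeval_newton.
have N1 : \sum_(i < m.+1) (-1) ^+ i * X i.+1 * E1 (m - i)%N = N m.
  rewrite big_ord_recr /= subnn mulr0 addr0; apply: eq_bigr => i _.
  by have -> : (m - i = (m.-1 - i).+1)%N by have := ltn_ord i; lia.
rewrite (eq_bigr (fun i : 'I_m.+1 => ((-1) ^+ i * X i.+1 * E (m - i)%N -
    z * ((-1) ^+ i * X i.+1 * E1 (m - i)%N)) - z ^+ i.+1 * s (m - i)%N)); last first.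
  move=> i _; rewrite X'E [_ * (X _ - _)]mulrBr mulrBl mulrA -exprMn mulrN1 opprK expr1n mul1r.
  by congr (_ - _); rewrite {1}/s mulrBr [in RHS]mulrCA.
rewrite sumrB T sumrB -mulr_sumr N1 -[\sum_(i < m.+1) _]/(N m.+1) /s scalerBr NE /=.
by rewrite scalerAr -natr1 scalerDl scale1r NE mulrDr opprD addrA.
Qed.

Section Laurent.
Variable n : nat.
Implicit Types (S : {set 'I_n}) (a : 'I_n -> nat).
Notation x := (@lvar n).
Notation z := (@lvarV n).

Lemma lvarVKz i : z i * x i = 1.
Proof. by rewrite mulrC lvarK. Qed.

(** If (z_i - z_j) y = 0 then the coefficients of y are invariant under a nonzero
    translation of the exponents; having finite support, y vanishes. *)
Lemma lvarV_sub_regular i j (y : laurent n) : i != j -> (z i - z j) * y = 0 -> y = 0.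
Proof.
move=> ij y0.
pose e : {ffun 'I_n -> int} := [ffun l => (i == l)%:Z - (j == l)%:Z].
have step q : y@_q = y@_(q + e).
  have : ((z i - z j) * y)@_(q - [ffun l => (j == l)%:Z]) = 0.
    by rewrite y0 mcoeff0.
  rewrite mulrBl mcoeffB ![_ * y]mulrC /lvarV /lmono !coef_lmonoM => /eqP.
  rewrite subr_eq0 => /eqP E.
  transitivity (y@_(q - [ffun l => (j == l)%:Z] - [ffun l => - (j == l)%:Z])).
    congr (_ @_ _); apply/ffunP => l; rewrite !ffunE; by rewrite opprK subrK.
  rewrite -E; congr (_ @_ _); apply/ffunP => l; rewrite /e !ffunE; ring.
have steps N q : y@_q = y@_(q + e *+ N).
  elim: N => [|N IH]; first by rewrite mulr0n addr0.
  by rewrite IH step mulrSr addrA.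
apply/malgP => q; rewrite mcoeff0; set B := (\sum_(p <- msupp y) `|p i|)%N.
have leB p : p \in msupp y -> (`|p i| <= B)%N.
  by move=> py; rewrite /B (big_fsetD1 p py) /= leq_addr.
(* The exponent of index i of the translate exceeds all those in the support. *)
rewrite (steps (B + `|q i|).+1); apply: mcoeff_outdom; apply/negP => /leB.
rewrite /e !ffunE ffunMnE !ffunE eqxx [j == i]eq_sym (negPf ij) subr0 natz.
move: {leB} (q i) => u; move: B => B; lia.
Qed.

End Laurent.

Section DysonProducts.
Variables (R : comAlgType rat) (n : nat) (z x : 'I_n -> R).
Implicit Types (S : {set 'I_n}) (a : 'I_n -> nat).

Definition dyson_factor S (j : 'I_n) : R := \prod_(i in S | i != j) (1 - z j * x i).

Definition dyson_product S a : R := \prod_(j in S) dyson_factor S j ^+ a j.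

Definition lower_exponent (i : 'I_n) a : 'I_n -> nat := fun l => (a l - (l == i))%N.

Hypothesis zx1 : forall i, z i * x i = 1.
Hypothesis z_regular : forall i j y, i != j -> (z i - z j) * y = 0 -> y = 0.

(** As polynomials in t of degree less than #|S|, the two sides of
    \sum_i (c + d z_i) \prod_(l != i) D_l \prod_(j != i) (1 - t x_j) =
    (c + d t) \prod_l D_l, with D_l the factor of index l, agree at the points
    t = z_l for l in S.  The lemma is the case t = 0. *)
Lemma lagrange_interpolation S (c d : R) : (1 < #|S|)%N ->
  \sum_(i in S) (c + d * z i) * \prod_(l in S | l != i) dyson_factor S l =
  c * \prod_(l in S) dyson_factor S l.
Proof.
move=> S2.
pose L (t : {poly R}) i := \prod_(j in S | j != i) (1 - t * (x j)%:P).
(* The difference of the two sides as a polynomial in t. *)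
pose g : {poly R} :=
  \sum_(i in S) ((c + d * z i) * \prod_(l in S | l != i) dyson_factor S l)%:P * L 'X i
  - (c%:P + d%:P * 'X) * (\prod_(l in S) dyson_factor S l)%:P.
have g_horner t : g.[t] =
    \sum_(i in S) ((c + d * z i) * \prod_(l in S | l != i) dyson_factor S l) *
      (\prod_(j in S | j != i) (1 - t * x j))
    - (c + d * t) * \prod_(l in S) dyson_factor S l.
  rewrite /g !hornerE horner_sum; congr (_ - _); apply: eq_bigr => i _.
  rewrite hornerM hornerC /L horner_prod; congr (_ * _); apply: eq_bigr => j _.
  by rewrite !hornerE.
have size_L i : i \in S -> (size (L 'X i) <= #|S|)%N.
  move=> iS; have -> : L 'X i = \prod_(j in S :\ i) (1 - 'X * (x j)%:P).
    by apply: eq_bigl => j; rewrite !inE andbC.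
  apply: leq_trans (size_poly_prod_leq _ _) _.
  rewrite -[X in (_ - X)%N]/(#|S :\ i|).
  have: (\sum_(j in S :\ i) size (1 - 'X * (x j)%:P)%R <= \sum_(j in S :\ i) 2)%N.
    apply: leq_sum => j _; apply: leq_trans (size_polyD _ _) _.
    rewrite geq_max size_poly1 size_polyN /=.
    apply: leq_trans (size_polyMleq _ _) _; rewrite size_polyX add2n /=.
    by rewrite ltnS size_polyC_leq1.
  rewrite sum_nat_const; have := cardsD1 i S; rewrite iS add1n => -> le.
  by rewrite leq_subLR (leq_trans (_ : _ <= (#|S :\ i| * 2).+1)%N) //; lia.
suff g0 : g = 0.
  have := g_horner 0; rewrite g0 horner0 mulr0 addr0 => /eqP.
  rewrite eq_sym subr_eq0 => /eqP <-; apply: eq_bigr => i _.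
  by rewrite [X in _ = _ * X]big1 ?mulr1 // => j _; rewrite mul0r subr0.
apply: (poly_eq0_of_regular_roots z_regular (s := enum S)).
- exact: enum_uniq.
- rewrite -cardE /g (leq_trans (size_polyD _ _)) // geq_max size_polyN; apply/andP; split.
    apply: leq_trans (size_sum _ _ _) _; apply/bigmax_leqP => i iS.
    by rewrite mul_polyC (leq_trans (size_scale_leq _ _)) ?size_L.
  rewrite [(c%:P + _) * _]mulrC [_ * (c%:P + _)]mul_polyC.
  apply: leq_trans (size_scale_leq _ _) _; apply: leq_trans S2.
  apply: leq_trans (size_polyD _ _) _; rewrite geq_max (leq_trans (size_polyC_leq1 _)) //=.
  by rewrite mul_polyC (leq_trans (size_scale_leq _ _)) // size_polyX.
move=> l; rewrite mem_enum => lS; rewrite g_horner (bigD1 l lS) /=.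
rewrite [X in _ + X - _]big1 ?addr0.
  have aux (u v w : R) : u * v * w - u * (w * v) = 0 by ring.
  by rewrite [X in _ - _ * X](bigD1 l lS) /=; exact: aux.
move=> i /andP[iS il]; rewrite [X in _ * X](bigD1 l) /=; last by rewrite lS eq_sym.
by rewrite zx1 subrr mul0r mulr0.
Qed.
End DysonProducts.

Section DysonRecursion.
Variables (R : comAlgType rat) (n : nat) (z x : 'I_n -> R).
Implicit Types (S : {set 'I_n}) (a : 'I_n -> nat).
Hypothesis zx1 : forall i, z i * x i = 1.
Hypothesis z_regular : forall i j y, i != j -> (z i - z j) * y = 0 -> y = 0.
Notation dyson_factor := (dyson_factor z x).
Notation dyson_product := (dyson_product z x).

Definition dyson_alphabet S a : alphabet R :=
  fun r => (-1) ^+ r.-1 * \sum_(i in S) z i ^+ r *+ a i.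

(** When all exponents are k this is g_p(X^v) for the parameter 1/k, see
    [sfeval_hsym]; unequal exponents are what the recursion needs. *)
Definition dyson_esym S a p : R := sfeval (dyson_alphabet S a) (esym p).

Lemma dyson_esym0 S a : dyson_esym S a 0 = 1.
Proof. by rewrite /dyson_esym esym0 rmorph1. Qed.

Lemma dyson_esym_lower S a i p : i \in S -> (0 < a i)%N ->
  dyson_esym S (lower_exponent i a) p.+1 = dyson_esym S a p.+1 - z i * dyson_esym S a p.
Proof.
move=> iS ai0; apply: sfeval_esym_sub => r; rewrite /dyson_alphabet /= -mulrBr; congr (_ * _).
rewrite (bigD1 i iS) [in RHS](bigD1 i iS) /= /lower_exponent eqxx subn1.
have aux (V : zmodType) (u v w : V) m : (0 < m)%N -> v = w -> u *+ m.-1 + v = u *+ m + w - u.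
  by case: m => // m _ ->; rewrite mulrSr addrAC addrK.
apply: aux => //; apply: eq_bigr => l /andP[_ /negPf li].
by rewrite li subn0.
Qed.

(** Good's recursion, with the factor of degree p inserted in the Dyson product.
    Lowering the exponent a_i multiplies the generating series of the inserted
    factor by 1 - z_i t, which makes it an affine function of z_i, so Lagrange
    interpolation applies as it does for p = 0. *)
Lemma dyson_recursion S a p : (1 < #|S|)%N -> (forall i, i \in S -> 0 < a i)%N ->
  dyson_product S a * dyson_esym S a p =
  \sum_(i in S) dyson_product S (lower_exponent i a) * dyson_esym S (lower_exponent i a) p.
Proof.
move=> S2 a0; pose d := if p is p'.+1 then - dyson_esym S a p' else 0.
pose B := \prod_(l in S) dyson_factor S l ^+ (a l).-1.
have gE : dyson_product S a = B * \prod_(l in S) dyson_factor S l.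
  rewrite -big_split; apply: eq_bigr => l lS /=.
  by rewrite -exprSr prednK // a0.
have glE i : i \in S -> dyson_product S (lower_exponent i a) = B * \prod_(l in S | l != i) dyson_factor S l.
  move=> iS; rewrite /dyson_product /B (bigD1 i iS) [in RHS](bigD1 i iS) /= -mulrA.
  rewrite {1}/lower_exponent eqxx subn1; congr (_ * _).
  rewrite -big_split; apply: eq_bigr => l /andP[lS /negPf li] /=.
  by rewrite /lower_exponent li subn0 -exprSr prednK // a0.
have aux (u v w : R) : u * v * w = u * (w * v) by ring.
have aux' (u v w w' g : R) : g = u * v -> w' = w -> u * (w * v) = g * w'.
  by move=> -> ->; ring.
rewrite gE aux -(lagrange_interpolation zx1 z_regular _ d S2) mulr_sumr.
apply: eq_bigr => i iS; apply: aux'; first exact: glE.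
rewrite /d; case: (p) => [|p']; first by rewrite !dyson_esym0 mul0r addr0.
by rewrite dyson_esym_lower ?a0 // mulNr mulrC.
Qed.

(** The factors of the Dyson product that involve i when a_i = 0. *)
Definition removed_factor S a i : R := \prod_(j in S :\ i) (1 - z j * x i) ^+ a j.

Lemma dyson_product_remove S a i : i \in S -> a i = 0%N ->
  dyson_product S a = dyson_product (S :\ i) a * removed_factor S a i.
Proof.
move=> iS ai0.
have E l : l \in S :\ i ->
    dyson_factor S l ^+ a l = dyson_factor (S :\ i) l ^+ a l * (1 - z l * x i) ^+ a l.
  rewrite !inE => /andP[li lS].
  rewrite -exprMn; congr (_ ^+ _); rewrite [RHS]mulrC.
  rewrite /dyson_factor (bigD1 i); last by rewrite iS eq_sym.
  congr (_ * _); apply: eq_bigl => j.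
  by rewrite !inE; case: (j \in S); case: (j == i); case: (j == l).
rewrite /dyson_product (big_setD1 i iS).
rewrite ai0 expr0.
rewrite [LHS]mul1r.
rewrite [LHS](eq_bigr _ E).
exact: big_split.
Qed.

Lemma dyson_esym_remove S a i p : i \in S -> a i = 0%N -> dyson_esym S a p = dyson_esym (S :\ i) a p.
Proof.
move=> iS ai0; apply: sfeval_eq => r _; rewrite /dyson_alphabet (bigD1 i iS) /= ai0 mulr0n add0r.
by congr (_ * _); apply: eq_bigl => l; rewrite !inE andbC.
Qed.

Definition total_exponent S a := (\sum_(i in S) a i)%N.

Lemma total_exponent_lower S a i : i \in S -> (0 < a i)%N ->
  (total_exponent S a = (total_exponent S (lower_exponent i a)).+1)%N.
Proof.
move=> iS ai0; rewrite /total_exponent (bigD1 i iS) [in RHS](bigD1 i iS) /= /lower_exponent eqxx subn1.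
rewrite -addSn prednK //; congr (_ + _)%N.
by apply: eq_bigr => l /andP[_ /negPf ->]; rewrite subn0.
Qed.

Lemma total_exponent_remove S a i : i \in S -> a i = 0%N -> total_exponent S a = total_exponent (S :\ i) a.
Proof.
move=> iS ai0; rewrite /total_exponent (bigD1 i iS) /= ai0.
by apply: eq_bigl => l; rewrite !inE andbC.
Qed.

(** The two reductions of Good's proof: lower the exponents while they are all
    positive, and drop an index whose exponent is zero. *)
Lemma dyson_induction (C : {set 'I_n} -> ('I_n -> nat) -> Prop) :
  (forall S a, (#|S| <= 1)%N -> C S a) ->
  (forall S a i, i \in S -> a i = 0%N -> C (S :\ i) a -> C S a) ->
  (forall S a, (1 < #|S|)%N -> (forall i, i \in S -> 0 < a i)%N ->
     (forall i, i \in S -> C S (lower_exponent i a)) -> C S a) ->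
  forall S a, C S a.
Proof.
move=> R1 R2 R3 S a; have [N] := ubnP (#|S| + total_exponent S a).
elim: N S a => // N IH S a leN.
have [|S2] := leqP #|S| 1; first exact: R1.
case: (pickP (fun i => (i \in S) && (a i == 0%N))) => [i /andP[iS /eqP ai0]|a0].
  apply: (R2 _ _ i iS ai0); apply: IH; move: leN.
  by rewrite (cardsD1 i S) iS (total_exponent_remove iS ai0).
have {}a0 i : i \in S -> (0 < a i)%N by move=> iS; have := a0 i; rewrite iS lt0n /= => ->.
apply: R3 => // i iS; apply: IH; move: leN; by rewrite (total_exponent_lower iS (a0 i iS)) addnS.
Qed.

End DysonRecursion.

Section LaurentDyson.
Variable n : nat.
Implicit Types (S : {set 'I_n}) (a : 'I_n -> nat).
Notation x := (@lvar n).
Notation z := (@lvarV n).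
Notation dyson_product := (dyson_product z x).
Notation dyson_esym := (dyson_esym z).
Implicit Types P : {ffun 'I_n -> int} -> Prop.

Lemma supported_sub1_zx P j i :
  P 0 -> P [ffun l => (i == l)%:Z - (j == l)%:Z] -> supported P (1 - z j * x i).
Proof.
move=> P0 Pq; apply: supportedB; first exact: supported1.
rewrite /lvar /lvarV lmonoM; apply: supportedU.
suff -> : [ffun l => - (j == l)%:Z] + [ffun l => (i == l)%:Z] =
  [ffun l => (i == l)%:Z - (j == l)%:Z] by [].
by apply/ffunP => l; rewrite !ffunE addrC.
Qed.

Lemma supported_dyson_product P S a :
  P 0 -> (forall p q, P p -> P q -> P (p + q)) ->
  (forall i j, i \in S -> j \in S -> i != j -> P [ffun l => (i == l)%:Z - (j == l)%:Z]) ->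
  supported P (dyson_product S a).
Proof.
move=> P0 PD Pe; apply: supported_prod => // j jS; apply: supportedX => //.
apply: supported_prod => // i /andP[iS ij]; apply: supported_sub1_zx => //.
exact: Pe.
Qed.

Lemma supported_removed_factor P S a i :
  P 0 -> (forall p q, P p -> P q -> P (p + q)) ->
  (forall j, j \in S -> j != i -> P [ffun l => (i == l)%:Z - (j == l)%:Z]) ->
  supported P (removed_factor z x S a i).
Proof.
move=> P0 PD Pe; apply: supported_prod => // j; rewrite !inE => /andP[ji jS].
by apply: supportedX => //; apply: supported_sub1_zx => //; apply: Pe.
Qed.

Lemma removed_factor_sub1 S a i :
  supported (fun q : {ffun 'I_n -> int} => 0 < q i) (removed_factor z x S a i - 1).
Proof.
pose P (q : {ffun 'I_n -> int}) := 0 < q i.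
have PM (F H : laurent n) : supported P (F - 1) -> supported P (H - 1) -> supported P (F * H - 1).
  move=> FP HP; have -> : F * H - 1 = (F - 1) * (H - 1) + (F - 1) + (H - 1).
    have aux (R : comNzRingType) (u v : R) : u * v - 1 = (u - 1) * (v - 1) + (u - 1) + (v - 1) by ring.
    exact: aux.
  apply: supportedD; last exact: HP.
  apply: supportedD; last exact: FP.
  apply: supportedM FP HP => p q.
  by rewrite /P ffunE; apply: Num.Theory.addr_gt0.
have P1 : supported P (1 - 1) by rewrite subrr; apply: supported0.
rewrite /removed_factor; elim/big_rec: _ => [//|j F]; rewrite !inE => /andP[ji _] FP; refine (PM _ _ _ FP).
elim: (a j) => [//|N IH]; rewrite exprS; refine (PM _ _ _ IH).
rewrite addrAC subrr add0r; apply: supportedN.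
rewrite /lvar /lvarV lmonoM; apply: supportedU.
by rewrite /P !ffunE eqxx (negPf ji) oppr0 add0r.
Qed.

(** For p = 0, Good's recursion is the recursion of the multinomial coefficients.
    When a_i = 0, the variable x_i only occurs with positive powers, in factors
    whose constant term is 1, so that it can be dropped. *)
Theorem dyson_constant_term S a :
  (dyson_product S a)@_0 * \prod_(i in S) ((a i)`!)%:R = ((total_exponent S a)`!)%:R :> rat.
Proof.
move: S a; apply: dyson_induction => [S a S1|S a i iS ai0 IH|S a S2 a0 IH].
- have [->|[i iS]] := set_0Vmem S.
    by rewrite /dyson_product /total_exponent !big_set0 mulr1 [LHS](coef_lmono 0 0) eqxx.
  have -> : S = [set i].
    by apply/eqP; rewrite eq_sym eqEcard sub1set iS cards1.
  rewrite /dyson_product /total_exponent !big_set1 /dyson_factor big1 ?expr1n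
    ?[X in X * _](coef_lmono 0 0) ?eqxx ?mul1r //.
  by move=> j /andP[]; rewrite inE => ->.
- have -> : \prod_(l in S) ((a l)`!)%:R = \prod_(l in S :\ i) ((a l)`!)%:R :> rat.
    by rewrite (big_setD1 i iS) /= ai0 fact0 mul1r.
  rewrite (total_exponent_remove iS ai0) -IH (dyson_product_remove z x iS ai0).
  apply: (congr1 ( *%R^~ _)).
  have -> : dyson_product (S :\ i) a * removed_factor z x S a i =
      dyson_product (S :\ i) a * (removed_factor z x S a i - 1) + dyson_product (S :\ i) a.
    by rewrite -[X in _ = _ + X]mulr1 -mulrDr subrK.
  rewrite mcoeffD [X in X + _](_ : _ = 0) ?add0r //.
  have FP : supported (fun q : {ffun 'I_n -> int} => q i = 0) (dyson_product (S :\ i) a).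
    apply: supported_dyson_product => [|p q pi qi|j l]; rewrite !ffunE //; first by rewrite pi qi.
    rewrite !inE => /andP[/negPf ji _] /andP[/negPf li _] _.
    by rewrite ji li subrr.
  apply: (supported_coef0 (P := fun q : {ffun 'I_n -> int} => 0 < q i)); last by rewrite ffunE.
  by refine (supportedM _ FP (@removed_factor_sub1 S a i)) => p q pi qi; rewrite ffunE pi add0r.
have [i0 i0S] : exists i, i \in S by apply/card_gt0P; apply: ltnW.
have := dyson_recursion (@lvarVKz n) (@lvarV_sub_regular n) 0 S2 a0.
rewrite dyson_esym0 mulr1 => ->.
rewrite raddf_sum mulr_suml.
transitivity (\sum_(i in S) (a i)%:R * ((total_exponent S a).-1`!)%:R : rat); last first.
  rewrite -mulr_suml -natr_sum -natrM -/(total_exponent S a).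
  by rewrite (total_exponent_lower i0S (a0 i0 i0S)) /= factS.
apply: eq_bigr => i iS.
rewrite dyson_esym0 mulr1 (total_exponent_lower iS (a0 i iS)) /= -(IH i iS).
have -> : \prod_(l in S) ((a l)`!)%:R =
    (a i)%:R * \prod_(l in S) ((lower_exponent i a l)`!)%:R :> rat.
  rewrite (big_setD1 i iS) [in RHS](big_setD1 i iS) /= mulrA; congr (_ * _); last first.
    by apply: eq_bigr => l; rewrite !inE => /andP[/negPf li _]; rewrite /lower_exponent li subn0.
  rewrite /lower_exponent eqxx subn1 -natrM; congr _%:R.
  by have := a0 i iS; case: (a i).
by rewrite mulrCA.
Qed.
End LaurentDyson.

Lemma sfevalP (A : comAlgType rat) (X : alphabet A) c f g :
  sfeval X (c *: f + g) = c *: sfeval X f + sfeval X g.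
Proof. exact: linearP. Qed.

Section CompleteSupport.
Variable n : nat.
Implicit Types (S : {set 'I_n}) (a : 'I_n -> nat).
Notation x := (@lvar n).
Notation z := (@lvarV n).
Notation dyson_product := (dyson_product z x).
Notation dyson_esym := (dyson_esym z).

Lemma dyson_esym_set0 a p : dyson_esym set0 a p.+1 = 0.
Proof.
have m0 : p.+1%:R != 0 :> rat by rewrite Num.Theory.pnatr_eq0.
apply: (scalerI m0); rewrite scaler0 /dyson_esym sfeval_newton big1 // => i _.
by rewrite /dyson_alphabet big_set0 mulr0 mulr0 mul0r.
Qed.

Lemma supported_lvarVX (P : {ffun 'I_n -> int} -> Prop) i r :
  P [ffun j => - (r%:Z * (i == j)%:Z)] -> supported P (z i ^+ r).
Proof. by move=> Pi; rewrite lvarVX; apply: supportedU. Qed.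

Lemma supported_sign (P : {ffun 'I_n -> int} -> Prop) r (F : laurent n) :
  supported P F -> supported P ((-1) ^+ r * F).
Proof. by rewrite -signr_odd mulr_sign; case: ifP => // _; apply: supportedN. Qed.

Lemma supportedMn (P : {ffun 'I_n -> int} -> Prop) r (F : laurent n) :
  supported P F -> supported P (F *+ r).
Proof. by rewrite -scaler_nat; apply: supportedZ. Qed.

Lemma dyson_esym_set1 i a p :
  supported (fun q : {ffun 'I_n -> int} => q i = - p%:Z) (dyson_esym [set i] a p).
Proof.
elim/ltn_ind: p => -[|p] IH.
  by rewrite dyson_esym0; apply: supported1; rewrite ffunE.
have m0 : p.+1%:R != 0 :> rat by rewrite Num.Theory.pnatr_eq0.
rewrite -[dyson_esym _ _ _]scale1r -(mulVf m0) -scalerA; apply: supportedZ.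
rewrite /dyson_esym sfeval_newton; apply: supported_sum => j _.
have jp := ltn_ord j.
refine (supportedM (P := fun q : {ffun 'I_n -> int} => q i = - j.+1%:Z)
                   (Q := fun q : {ffun 'I_n -> int} => q i = - (p - j)%N%:Z) _ _ _).
- by move=> q r; rewrite ffunE => -> ->; lia.
- apply: supported_sign; rewrite /dyson_alphabet big_set1; apply: supported_sign.
  by apply: supportedMn; apply: supported_lvarVX; rewrite ffunE eqxx mulr1.
by apply: IH; lia.
Qed.

(** The recursion adds up terms of the same kind, and dropping an index i of
    exponent zero only multiplies by monomials with nonpositive exponents at the
    other indices.  With one index left, the inserted factor is a multiple of
    z_i^p; with none, it is 0. *)
Lemma supported_dyson_product_esym p S a : (0 < p)%N ->
  supported (fun q : {ffun 'I_n -> int} => exists2 i, i \in S & q i <= - p%:Z)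
    (dyson_product S a * dyson_esym S a p).
Proof.
move=> p0; move: S a; apply: dyson_induction => [S a S1|S a i iS ai0 IH|S a S2 a0 IH].
- have [->|[i iS]] := set_0Vmem S.
    by case: p p0 => // p _; rewrite dyson_esym_set0 mulr0; apply: supported0.
  have -> : S = [set i].
    by apply/eqP; rewrite eq_sym eqEcard sub1set iS cards1.
  have -> : dyson_product [set i] a = 1.
    rewrite /dyson_product big_set1 /dyson_factor big1 ?expr1n // => j /andP[].
    by rewrite inE => ->.
  rewrite mul1r; refine (supportedS (@dyson_esym_set1 i a p) _) => q qi.
  by exists i; rewrite ?inE // qi.
- rewrite (dyson_product_remove z x iS ai0) (dyson_esym_remove _ _ iS ai0) mulrAC.
  refine (supportedM _ IH (@supported_removed_factor _
    (fun q : {ffun 'I_n -> int} => forall j, j \in S :\ i -> q j <= 0) _ _ _ _ _ _)).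
  + move=> q r [j jS qj] rS; exists j; first by move: jS; rewrite inE => /andP[].
    by rewrite ffunE -[- _]addr0; apply: Num.Theory.lerD (rS j jS).
  + by move=> j _; rewrite ffunE.
  + by move=> q r qS rS j jS; rewrite ffunE -[0]addr0; apply: Num.Theory.lerD (qS j jS) (rS j jS).
  + move=> j _ _ l; rewrite !inE ffunE => /andP[/negPf li _].
    by rewrite eq_sym li sub0r; case: (j == l).
rewrite (dyson_recursion (@lvarVKz n) (@lvarV_sub_regular n)) //.
by apply: supported_sum => i iS; apply: IH.
Qed.

Lemma supported_sfeval_lvarV f :
  supported (fun q : {ffun 'I_n -> int} => forall i, q i <= 0)
    (sfeval (finite_alphabet z) f : laurent n).
Proof.
elim/malg_ind: f => [|c la f IH]; first by rewrite linear0; apply: supported0.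
rewrite sfevalP; apply: supportedD IH; apply: supportedZ.
rewrite -/(psi la) sfeval_psi; apply: supported_prod => [i|q r qi ri i|r _].
- by rewrite ffunE.
- by rewrite ffunE -[0]addr0; apply: Num.Theory.lerD.
apply: supported_sum => j _; apply: supported_lvarVX => i; rewrite ffunE; lia.
Qed.
End CompleteSupport.

(** * Constant terms of Jack functions against the Dyson product *)

Section TorusProduct.
Variables (n k m : nat) (P Q : intpart -> symfun).
Hypothesis k_gt0 : (0 < k)%N.
Notation al := (k%:R^-1 : rat).
Hypotheses (jackP : is_jackP al P) (jackQ : is_jackQ al P Q).
Notation x := (@lvar n).
Notation z := (@lvarV n).
Notation gsym := (sfeval (hsym_alphabet al)).
Let al0 : al != 0. Proof. by rewrite invr_eq0 Num.Theory.pnatr_eq0 -lt0n. Qed.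

Definition dyson_weight : laurent n := dyson_product z x [set: 'I_n] (fun=> k).
Notation W := dyson_weight.
Definition xpow (j : nat) : laurent n := lmono [ffun=> j%:Z].

Lemma coef0_dyson_weight : W@_0 = (n * k)`!%:R / k`!%:R ^+ n.
Proof.
have := dyson_constant_term [set: 'I_n] (fun=> k).
rewrite /total_exponent !big_const cardsT card_ord iter_addn_0 iter_mulr_1.
rewrite mulnC => <-; rewrite mulfK // expf_neq0 // Num.Theory.pnatr_eq0 -lt0n fact_gt0 //.
Qed.

Lemma supported_dyson_weight :
  supported (fun q : {ffun 'I_n -> int} => \sum_i q i = 0) W.
Proof.
apply: supported_dyson_product => [|p q p0 q0|i j _ _ ij].
- by rewrite big1 // => i _; rewrite ffunE.
- by under eq_bigr do rewrite ffunE; rewrite big_split /= p0 q0.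
under eq_bigr do rewrite ffunE; rewrite sumrB.
rewrite (bigD1 i) //= eqxx big1 => [|l /negPf]; last by rewrite eq_sym => ->.
rewrite (bigD1 j) //= eqxx big1 ?subrr // => l /negPf.
by rewrite eq_sym => ->.
Qed.

Lemma sfeval_hsym p :
  sfeval (finite_alphabet z) (gsym (powersum p.+1)) = dyson_esym z [set: 'I_n] (fun=> k) p.+1.
Proof.
rewrite (sfeval_powersum _ (ltn0Sn p)) /hsym_alphabet invrK sfeval_comp.
apply: sfeval_eq => i i0; rewrite /signed_powersum /dyson_alphabet linearZ_LR /=.
rewrite (sfeval_powersum _ i0) /finite_alphabet.
rewrite (eq_bigl predT) => [|j]; last by rewrite inE.
rewrite sumrMnl -scaler_nat -scalerA.
rewrite -(signr_odd rat) -(signr_odd (laurent n)).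
by case: (odd _); rewrite ?expr1 ?expr0 ?mulN1r ?mul1r ?scaleNr ?scale1r.
Qed.

(** Every monomial of g_p(X^v) W has an exponent at most -p < -m, and f(X^v) only
    lowers exponents, so x^m cannot bring that exponent back to 0. *)
Lemma coef0_hsym_eq0 p h : (m < p)%N ->
  (sfeval (finite_alphabet z) (gsym (powersum p) * h) * (xpow m * W))@_0 = 0.
Proof.
case: p => // p mp; rewrite rmorphM /= sfeval_hsym.
set F := sfeval _ h.
have -> : dyson_esym z [set: 'I_n] (fun=> k) p.+1 * F * (xpow m * W) =
    (W * dyson_esym z [set: 'I_n] (fun=> k) p.+1) * (F * xpow m).
  have aux (R : comNzRingType) (a b c d : R) : a * b * (c * d) = d * a * (b * c) by ring.
  exact: aux.
apply: (supported_coef0 (P := fun q : {ffun 'I_n -> int} => exists i, q i < 0)); last first.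
  by case=> i; rewrite ffunE.
refine (supportedM (Q := fun q : {ffun 'I_n -> int} => forall i, q i <= m%:Z) _
  (@supported_dyson_product_esym n p.+1 [set: 'I_n] (fun=> k) _) _) => //.
  by move=> q r [i _ qi] /(_ i) ri; exists i; rewrite ffunE; move: qi ri mp; move: (q i) (r i) => u v; lia.
refine (supportedM (Q := fun q : {ffun 'I_n -> int} => forall i, q i = m%:Z) _
  (@supported_sfeval_lvarV n h) _).
  by move=> q r qi ri i; rewrite ffunE ri; have := qi i; move: (q i) => u; lia.
by apply: supportedU => i; rewrite ffunE.
Qed.

Lemma coef0_hsym_psi_eq0 (ka : intpart) : (m < nth 0%N ka 0)%N ->
  (sfeval (finite_alphabet z) (gsym (psi ka)) * (xpow m * W))@_0 = 0.
Proof.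
rewrite psiE; case: (parts ka) => //= p s mp; rewrite big_cons rmorphM /=.
exact: coef0_hsym_eq0.
Qed.

(** Q_nu is a combination of the g_ka with ka >= nu, for which ka_1 > m. *)
Lemma coef0_jackQ_eq0 (nu : intpart) : (m < nth 0%N nu 0)%N ->
  (sfeval (finite_alphabet z) (Q nu) * (xpow m * W))@_0 = 0.
Proof.
move=> nu_m; have [F [<- _ Fdom]] := jackQ_hsym al0 jackP jackQ nu.
have coef0_lin (G : symfun) : (sfeval (finite_alphabet z) (gsym G) * (xpow m * W))@_0 =
    jdot al (gsym G) (integral (signed_powersum al^-1) (xpow m * W)).
  by rewrite jdot_integral.
rewrite coef0_lin jdotC jdot_hsym big_seq big1 // => ka; rewrite -mcoeff_neq0 => /Fdom[_ dom].
rewrite jdotC -coef0_lin coef0_hsym_psi_eq0 ?mulr0 //; apply: leq_trans nu_m _.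
by have := dom 1%N; rewrite !sumn_takeS !take0.
Qed.

Lemma part_of_const : part_of (fun i : 'I_n => m) = rect_part m n.
Proof.
rewrite /part_of /rect_part; congr mkpart.
transitivity (nseq (size (enum 'I_n)) m); last by rewrite size_enum_ord.
by elim: (enum _) => //= i s ->.
Qed.

Lemma mem_le_first (nu : intpart) i : i \in parts nu -> (i <= nth 0%N nu 0)%N.
Proof.
case: nu => -[|c s] //= /andP[c_sorted _]; rewrite inE => /predU1P[->//|].
by move/allP: (order_path_min (rev_trans leq_trans) c_sorted); apply.
Qed.

Lemma dominated_first (mu nu : intpart) : dominated mu nu -> (nth 0%N mu 0 <= nth 0%N nu 0)%N.
Proof. by case=> _ /(_ 1%N); rewrite !sumn_takeS !take0. Qed.

Lemma le_part_of (b : 'I_n -> nat) i : (b i <= nth 0%N (part_of b) 0)%N.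
Proof.
case: (posnP (b i)) => [-> //|b0]; apply: mem_le_first.
by rewrite (perm_mem (perm_mkpart _)) mem_filter b0 map_f ?mem_enum.
Qed.

Lemma sumn_rect : sumn (rect_part m n) = (m * n)%N.
Proof.
have := sumn_take_rect m n (maxn n (size (rect_part m n))).
by rewrite take_oversize ?leq_maxr // => ->; rewrite (minn_idPr _) ?leq_maxl.
Qed.

Lemma dominated_rect (nu : intpart) : (nth 0%N nu 0 <= m)%N ->
  sumn nu = (m * n)%N -> dominated nu (rect_part m n).
Proof.
move=> nu_m nuE.
split=> [|i]; first by rewrite sumn_rect.
rewrite sumn_take_rect; have [_|_] := leqP i n; last by rewrite -nuE sumn_take_le.
have: all (geq m) nu by apply/allP => j /mem_le_first /leq_trans; apply.
elim: (parts nu) i => [|c s IH] [|i] //= /andP[cm /IH le].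
by rewrite mulnS leq_add.
Qed.

(** Among the partitions of m n with parts at most m, the rectangle m^n is the
    largest for dominance, so it occurs in P_nu only if nu = m^n. *)
Lemma coef_jackP_const (nu : intpart) : (nth 0%N nu 0 <= m)%N ->
  (sfeval (finite_alphabet z) (P nu))@_(nexp (fun=> m)) = (nu == rect_part m n)%:R.
Proof.
move=> nu_m; have tri := jackP.2 nu; case: eqP => [E|ne].
  by apply: (unitriangular_coef1 tri); rewrite part_of_const E.
apply: (supported_coef0 (@unitriangular_supported _ _ tri n)) => -[b /nexpI bm].
have -> : part_of b = rect_part m n.
  by rewrite -part_of_const; congr mkpart; apply: eq_map => i; rewrite -bm.
move=> dom; apply: ne; apply: (dominated_anti _ dom); apply: dominated_rect => //.
by have [<- _] := dom; rewrite sumn_rect.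
Qed.

(** If nu_1 > m, then P_nu is a multiple of Q_nu and [coef0_jackQ_eq0] applies.
    If nu_1 <= m, the monomials z^b of P_nu have b_i <= m; as W is homogeneous of
    degree 0, only the monomial with all b_i = m meets the constant term. *)
Lemma coef0_jackP (nu : intpart) :
  (sfeval (finite_alphabet z) (P nu) * (xpow m * W))@_0 = (nu == rect_part m n)%:R * W@_0.
Proof.
have [nu_m|nu_m] := ltnP m (nth 0%N nu 0).
  have -> : (nu == rect_part m n) = false.
    apply/eqP => E; move: nu_m; rewrite E ltnNge => /negP; apply.
    have := sumn_takeS (rect_part m n) 0; rewrite sumn_take_rect take0 /= add0n => <-.
    by rewrite -[X in (_ <= X)%N]muln1 leq_mul2l geq_minl orbT.
  rewrite mul0r (jackPE al0 jackP jackQ nu) linearZ_LR -scalerAl mcoeffZ.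
  by rewrite (coef0_jackQ_eq0 nu_m) mulr0.
rewrite -(coef_jackP_const nu_m).
have := @unitriangular_supported _ _ (jackP.2 nu) n.
move: (sfeval _ (P nu)) => F suppF; pose e := nexp (fun _ : 'I_n => m).
(* The exponents of the monomials of P_nu other than z^m have a sum above - m n. *)
have suppF' : supported (fun q : {ffun 'I_n -> int} => - (m * n)%N%:Z < \sum_i q i)
    (F - F@_e *: lmono e).
  move=> q; rewrite mcoeffB mcoeffZ coef_lmono.
  have [<-|eq] := eqVneq e q; first by rewrite mulr1 subrr eqxx.
  rewrite mulr0 subr0 => /suppF[b qE /dominated_first bnu].
  have b_le i : (b i <= m)%N := leq_trans (le_part_of b i) (leq_trans bnu nu_m).
  have [i bi] : exists i, (b i < m)%N.
    apply/existsP; apply: contraNT eq => /existsPn bm; apply/eqP.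
    rewrite qE; apply/ffunP => i; rewrite !ffunE; congr (- Posz _).
    by apply/eqP; rewrite eqn_leq b_le leqNgt bm.
  rewrite qE; under eq_bigr do rewrite ffunE.
  rewrite sumrN Num.Theory.ltrN2 -(big_morph Posz PoszD (erefl _)) ltz_nat.
  have -> : (m * n = \sum_(i < n) m)%N by rewrite sum_nat_const card_ord mulnC.
  rewrite (bigD1 i) //= [X in (_ < X)%N](bigD1 i) //= -addSn leq_add //.
  by apply: leq_sum => j _.
have -> : F = (F - F@_e *: lmono e) + F@_e *: lmono e by rewrite subrK.
rewrite mulrDl mcoeffD; set F' := F - _.
rewrite [X in X + _](_ : _ = 0) ?add0r.
  rewrite -scalerAl mcoeffZ mulrA /xpow lmonoM.
  have -> : e + [ffun=> m%:Z] = 0 by apply/ffunP => i; rewrite !ffunE addNr.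
  rewrite mcoeffD mcoeffZ coef_lmono eqxx mulr1 mcoeffB mcoeffZ coef_lmono eqxx mulr1.
  by rewrite subrr add0r [lmono 0 * _]mul1r.
apply: (supported_coef0 (P := fun q : {ffun 'I_n -> int} => 0 < \sum_i q i)); last first.
  by rewrite big1 // => i _; rewrite ffunE.
refine (supportedM (Q := fun q : {ffun 'I_n -> int} => \sum_i q i = (m * n)%N%:Z) _ suppF' _).
  move=> q r qs rs; under eq_bigr do rewrite ffunE.
  by rewrite big_split /= rs; move: qs; move: (\sum_i q i) => u; lia.
refine (supportedM (P := fun q : {ffun 'I_n -> int} => \sum_i q i = (m * n)%N%:Z) _ _
  supported_dyson_weight).
  by move=> q r qs rs; under eq_bigr do rewrite ffunE; rewrite big_split /= qs rs addr0.
apply: supportedU; under eq_bigr do rewrite ffunE.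
by rewrite sumr_const card_ord -mulr_natr PoszM natz.
Qed.

(** By [jdot_integral] the scalar products of the two sides with P_nu are constant
    terms, which [coef0_jackP] computes. *)
Theorem integral_xpow_dyson_weight :
  integral (signed_powersum k%:R) (xpow m * W) = W@_0 *: Q (rect_part m n).
Proof.
apply: (jackP_eq al0 jackP) => nu.
have -> : signed_powersum k%:R = signed_powersum al^-1 by rewrite invrK.
rewrite jdotC (jdot_integral al0) coef0_jackP jdotZl jackQ.
by rewrite mulrC eq_sym.
Qed.
End TorusProduct.

Transparent lext.

(** * Euler operators and exchanges of variables *)

Section LaurentOperators.
Variable n : nat.
Notation x := (@lvar n).
Notation z := (@lvarV n).

Lemma laurent_bilinear_eq (V : lmodType rat) (u v : laurent n -> laurent n -> V) :
  (forall G, linear (u^~ G)) -> (forall F, linear (u F)) ->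
  (forall G, linear (v^~ G)) -> (forall F, linear (v F)) ->
  (forall p q, u (lmono p) (lmono q) = v (lmono p) (lmono q)) ->
  forall F G, u F G = v F G.
Proof.
move=> ul ur vl vr uv F G.
apply: (laurent_linear_eq (u := u^~ G) (v := v^~ G)) => // p.
exact: (laurent_linear_eq (u := u (lmono p)) (v := v (lmono p))).
Qed.

(** The Euler operator x_i d/dx_i. *)
Definition theta (i : 'I_n) : laurent n -> laurent n :=
  lext (fun p : {ffun 'I_n -> int} => (p i)%:~R *: lmono p).

Lemma thetaP i c F G : theta i (c *: F + G) = c *: theta i F + theta i G.
Proof. exact: lext_is_linear. Qed.

Lemma theta_lmono i p : theta i (lmono p) = (p i)%:~R *: lmono p.
Proof. exact: lextU. Qed.

Lemma thetaM i F G : theta i (F * G) = theta i F * G + F * theta i G.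
Proof.
apply: (laurent_bilinear_eq (u := fun F G => theta i (F * G))
  (v := fun F G => theta i F * G + F * theta i G)) => [H c A B|H c A B|H c A B|H c A B|p q].
- by rewrite mulrDl -scalerAl thetaP.
- by rewrite mulrDr -scalerAr thetaP.
- by rewrite thetaP !mulrDl -!scalerAl addrACA -scalerDr.
- by rewrite thetaP !mulrDr -!scalerAr addrACA -scalerDr.
rewrite lmonoM !theta_lmono -scalerAl -scalerAr lmonoM ffunE.
by rewrite intrD scalerDl.
Qed.

Definition swap (i l : 'I_n) : laurent n -> laurent n :=
  lext (fun p : {ffun 'I_n -> int} => lmono [ffun j => p (tperm i l j)]).

Lemma swapP i l c F G : swap i l (c *: F + G) = c *: swap i l F + swap i l G.
Proof. exact: lext_is_linear. Qed.

Lemma swap_lmono i l p : swap i l (lmono p) = lmono [ffun j => p (tperm i l j)].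
Proof. exact: lextU. Qed.

Lemma swapM i l F G : swap i l (F * G) = swap i l F * swap i l G.
Proof.
apply: (laurent_bilinear_eq (u := fun F G => swap i l (F * G))
  (v := fun F G => swap i l F * swap i l G)) => [H c A B|H c A B|H c A B|H c A B|p q].
- by rewrite mulrDl -scalerAl swapP.
- by rewrite mulrDr -scalerAr swapP.
- by rewrite swapP mulrDl -scalerAl.
- by rewrite swapP mulrDr -scalerAr.
rewrite lmonoM !swap_lmono lmonoM; congr lmono.
by apply/ffunP => j; rewrite !ffunE.
Qed.

Lemma swap1 i l : swap i l 1 = 1.
Proof.
rewrite [LHS]swap_lmono; congr lmono.
by apply/ffunP => j; rewrite !ffunE.
Qed.

HB.instance Definition _ i l :=
  GRing.isLinear.Build rat (laurent n) (laurent n) *:%R (swap i l) (swapP i l).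
HB.instance Definition _ i l :=
  GRing.isMonoidMorphism.Build (laurent n) (laurent n) (swap i l) (swap1 i l, swapM i l).

Lemma swap_lvar i l j : swap i l (x j) = x (tperm i l j).
Proof.
rewrite [LHS]swap_lmono; congr lmono; apply/ffunP => a; rewrite !ffunE.
by rewrite -[in RHS](inj_eq (@perm_inj _ (tperm i l))) tpermK.
Qed.

Lemma swap_lvarV i l j : swap i l (z j) = z (tperm i l j).
Proof.
rewrite [LHS]swap_lmono; congr lmono; apply/ffunP => a; rewrite !ffunE.
by rewrite -[in RHS](inj_eq (@perm_inj _ (tperm i l))) tpermK.
Qed.

Lemma integral_swap (A : comAlgType rat) (Y : alphabet A) i l F :
  integral Y (swap i l F) = integral Y F.
Proof.
apply: (laurent_linear_eq (u := fun F => integral Y (swap i l F)) (v := integral Y)) => [c G H|c G H|p].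
- by rewrite swapP integralP.
- exact: integralP.
rewrite swap_lmono !integral_lmono [RHS](reindex_inj (@perm_inj _ (tperm i l))).
by apply: eq_bigr => j _; rewrite ffunE.
Qed.

Lemma swap_dyson_weight k i l : swap i l (dyson_weight n k) = dyson_weight n k.
Proof.
rewrite /dyson_weight /dyson_product rmorph_prod [RHS](reindex_inj (@perm_inj _ (tperm i l))) /=.
apply: eq_big => [j|j _]; first by rewrite !inE.
rewrite rmorphXn; congr (_ ^+ _); rewrite /dyson_factor rmorph_prod.
rewrite [RHS](reindex_inj (@perm_inj _ (tperm i l))) /=.
apply: eq_big => [a|a _]; first by rewrite !inE (inj_eq perm_inj).
by rewrite rmorphB rmorph1 rmorphM /= swap_lvar swap_lvarV.
Qed.
End LaurentOperators.

Opaque theta swap.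

Section Derivation.
Variables (R : comNzRingType) (D : R -> R).
Hypothesis DM : forall f g, D (f * g) = D f * g + f * D g.

Lemma derivation1 : D 1 = 0.
Proof.
have := DM 1 1; rewrite !mulr1 mul1r => /eqP.
by rewrite -subr_eq0 opprD addrA subrr sub0r oppr_eq0 => /eqP.
Qed.

Lemma derivation_prod0 I (r : seq I) (C : pred I) (F : I -> R) :
  (forall i, C i -> D (F i) = 0) -> D (\prod_(i <- r | C i) F i) = 0.
Proof.
move=> DF; elim/big_rec: _ => [|i f Ci Df]; first exact: derivation1.
by rewrite DM DF // Df mul0r mulr0 addr0.
Qed.

Lemma derivationX f m : D (f ^+ m.+1) = (f ^+ m * D f) *+ m.+1.
Proof.
elim: m => [|m IH]; first by rewrite expr1 expr0 mul1r.
by rewrite exprS DM IH -mulrnAr mulrA -exprS mulrC -mulrnAr -mulrDr -mulrS.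
Qed.

Lemma derivation_prod (I : finType) (C : pred I) (F : I -> R) :
  D (\prod_(i | C i) F i) = \sum_(i | C i) D (F i) * \prod_(j | C j && (j != i)) F j.
Proof.
rewrite -big_filter -[RHS]big_filter.
under [RHS]eq_bigr do rewrite -big_filter_cond.
have: uniq [seq i <- index_enum I | C i] by rewrite filter_uniq // index_enum_uniq.
elim: [seq i <- _ | C i] => [|i s IH /= /andP[is_ s_uniq]].
  by rewrite !big_nil derivation1.
rewrite !big_cons DM IH // eqxx /=; congr (_ * _ + _).
  rewrite big_seq [RHS]big_seq_cond; apply: eq_bigl => j.
  case: (boolP (j \in s)) => //= js.
  by have -> : j != i by apply: contraNneq is_ => <-.
rewrite mulr_sumr big_seq [RHS]big_seq; apply: eq_bigr => j js.
rewrite big_cons; have -> : i != j by apply: contraNneq is_ => ->.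
by rewrite mulrCA.
Qed.
End Derivation.

Section Aomoto.
Variables (n k : nat).
Hypothesis k_gt0 : (0 < k)%N.
Notation x := (@lvar n).
Notation z := (@lvarV n).
Notation W := (dyson_weight n k).

Definition pair_factor (i l : 'I_n) : laurent n := (1 - z i * x l) * (1 - z l * x i).

Definition weight_without (i : 'I_n) : laurent n :=
  \prod_(j | j != i) (\prod_(a | (a != j) && (a != i)) (1 - z j * x a)) ^+ k.

Lemma dyson_weight_split i :
  W = weight_without i * \prod_(l | l != i) pair_factor i l ^+ k.
Proof.
have aux (R : comNzRingType) (u : 'I_n -> 'I_n -> R) :
    \prod_j (\prod_(a | a != j) u j a) ^+ k =
    \prod_(j | j != i) (\prod_(a | (a != j) && (a != i)) u j a) ^+ k *
    \prod_(l | l != i) (u i l * u l i) ^+ k.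
  rewrite (bigD1 i) //= [X in _ * X = _](eq_bigr (fun j => u j i ^+ k *
      (\prod_(a | (a != j) && (a != i)) u j a) ^+ k)) => [|j ji]; last first.
    by rewrite (bigD1 i) /=; [rewrite exprMn | rewrite eq_sym].
  rewrite big_split /= -prodrXl mulrA -big_split /= mulrC; congr (_ * _).
  by apply: eq_bigr => l _; rewrite exprMn.
transitivity (\prod_j (\prod_(a | a != j) (1 - z j * x a)) ^+ k).
  apply: eq_big => [j|j _]; first by rewrite inE.
  apply: (congr1 (fun F : laurent n => F ^+ k)).
  by apply: eq_bigl => a; rewrite inE.
exact: (aux (laurent n) (fun j a => 1 - z j * x a)).
Qed.

Lemma theta_zx i j a :
  theta i (1 - z j * x a) = ((i == j)%:R - (i == a)%:R) *: (z j * x a).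
Proof.
have thetaB F G : theta i (F - G) = theta i F - theta i G.
  by rewrite -scaleN1r addrC thetaP scaleN1r addrC.
rewrite thetaB (derivation1 (@thetaM n i)) sub0r /lvar /lvarV lmonoM theta_lmono !ffunE.
rewrite -scaleNr; congr (_ *: _); rewrite intrD rmorphN /= opprD opprK.
by rewrite ![_ == i]eq_sym.
Qed.

(** The logarithmic derivative of W, with V l = W / ((1 - z_i x_l) (1 - z_l x_i)),
    a Laurent polynomial because k > 0. *)
Lemma theta_dyson_weight i : exists V : 'I_n -> laurent n,
  (forall l, l != i -> V l * pair_factor i l = W) /\
  theta i W = \sum_(l | l != i) (V l * (z i * x l - z l * x i)) *+ k.
Proof.
pose V l := weight_without i * \prod_(j | (j != i) && (j != l)) pair_factor i j ^+ k *
  pair_factor i l ^+ k.-1.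
exists V; split=> [l li|].
  rewrite (dyson_weight_split i) (bigD1 l li) /= /V.
  have aux (R : comNzRingType) (u v w : R) : u * v * w ^+ k.-1 * w = u * (w ^+ k * v).
    by rewrite -[in RHS](prednK k_gt0) exprS; ring.
  exact: aux.
have theta_rest : theta i (weight_without i) = 0.
  apply: (derivation_prod0 (@thetaM n i)) => j ji; rewrite -prodrXl.
  apply: (derivation_prod0 (@thetaM n i)) => a /andP[aj ai].
  rewrite -(prednK k_gt0) (derivationX (@thetaM n i)) theta_zx.
  by rewrite ![i == _]eq_sym (negPf ji) (negPf ai) subrr scale0r mulr0 mul0rn.
rewrite {1}(dyson_weight_split i) thetaM theta_rest mul0r add0r (derivation_prod (@thetaM n i)).
rewrite mulr_sumr; apply: eq_bigr => l li.
rewrite -{1}(prednK k_gt0) (derivationX (@thetaM n i)) prednK //.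
have -> : theta i (pair_factor i l) = z i * x l - z l * x i.
  have il : (i == l) = false by rewrite eq_sym (negPf li).
  have E1 : theta i (1 - z i * x l) = z i * x l.
    by rewrite theta_zx eqxx il subr0 scale1r.
  have E2 : theta i (1 - z l * x i) = - (z l * x i).
    by rewrite theta_zx eqxx il sub0r scaleN1r.
  have aux (R : comNzRingType) (u v : R) : u * (1 - v) + (1 - u) * (- v) = u - v by ring.
  have E := congr2 +%R (congr1 ( *%R^~ (1 - z l * x i)) E1) (congr1 ( *%R (1 - z i * x l)) E2).
  exact: etrans (thetaM i _ _) (etrans E (aux _ _ _)).
have aux (R : comNzRingType) (u v w d : R) : u * ((w * d) *+ k * v) = (u * v * w * d) *+ k.
  by rewrite mulrnAl mulrnAr; congr (_ *+ _); ring.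
exact: aux.
Qed.

Lemma pair_factor_regular i l y : l != i -> y * pair_factor i l = 0 -> y = 0.
Proof.
have reg a b u : a != b -> u * (1 - z a * x b) = 0 -> u = 0.
  move=> ab ub; have E : (z b - z a) * (x b * u) = 0.
    have aux (R : comNzRingType) (p q s t : R) : q * s = 1 -> t * (1 - p * s) = 0 -> (q - p) * (s * t) = 0.
      by move=> qs; rewrite -qs => <-; ring.
    exact: aux (lvarVKz b) ub.
  have xu : x b * u = 0 by apply: (lvarV_sub_regular _ E); rewrite eq_sym.
  by rewrite -[u]mul1r -(lvarVKz b) -mulrA xu mulr0.
by move=> li; rewrite /pair_factor mulrA => /(reg _ _ _ li)/reg; apply; rewrite eq_sym.
Qed.
End Aomoto.

(** * Integrals at a binomial alphabet *)

Section Pearson.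
Variables (n : nat) (N : rat).
Notation z := (@lvarV n).

(** Its elementary functions are the coefficients of (1 - t)^(-N). *)
Definition binomial_alphabet : alphabet rat^o := fun i => (-1) ^+ i.-1 * N.
Notation Y := binomial_alphabet.

Lemma binomial_esym p :
  p%:~R * esym_val Y p = (N + p%:~R - 1) * esym_val Y (p - 1) :> rat.
Proof.
have neg q : q < 0 -> esym_val Y q = 0 by apply: esym_val_neg.
have [p0|p0|->] := Num.Theory.ltrgt0P p.
- case: p p0 => // -[//|m] _; have -> : m.+1%:Z - 1 = m%:Z by lia.
  have newton j : j.+1%:R * sfeval Y (esym j.+1) = N * \sum_(i < j.+1) sfeval Y (esym i) :> rat.
    apply: etrans (sfeval_newton Y j) _.
    rewrite mulr_sumr (reindex_inj rev_ord_inj); apply: eq_bigr => i _ /=.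
    have aux q (c e : rat) : (-1) ^+ q * ((-1) ^+ q * c) * e = c * e.
      by rewrite [_ * (_ * c)]mulrA -exprMn mulrNN mulr1 expr1n mul1r.
    rewrite subSS; have -> : (j - (j - i))%N = i by have := ltn_ord i; lia.
    exact: aux.
  rewrite /= -pmulrn newton; case: m => [|m]; first by rewrite big_ord1 addrK.
  rewrite big_ord_recr /= mulrDr -newton -mulrDl; congr (_ * _).
  by rewrite [in RHS]mulrS; ring.
- by rewrite !neg ?mulr0 //; lia.
by rewrite [esym_val Y (0 - 1)]neg ?mulr0 ?mul0r.
Qed.

(** Integration by parts: since p e_p = (N + p - 1) e_(p - 1), the integral of
    theta_i ((1 - z_i) F) is N times that of z_i F. *)
Lemma pearson i (F : laurent n) :
  integral Y (theta i F) =
  N * integral Y (z i * F) + integral Y (theta i (z i * F)).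
Proof.
apply: (laurent_linear_eq (V := rat^o) (u := fun F => integral Y (theta i F))
  (v := fun F => N * integral Y (z i * F) + integral Y (theta i (z i * F)))) => [c G H|c G H|p].
- by rewrite thetaP integralP.
- rewrite mulrDr -scalerAr thetaP !integralP /GRing.scale /=.
  have aux (a b c1 d e f : rat) : a * (c1 * b + d) + (c1 * e + f) = c1 * (a * b + e) + (a * d + f) by ring.
  exact: aux.
have -> : z i * lmono p = lmono ([ffun j => - (i == j)%:Z] + p) by exact: lmonoM.
rewrite !theta_lmono !integralZ !integral_lmono.
pose R0 : rat := \prod_(j < n | j != i) esym_val Y (p j).
have E0 : \prod_j esym_val Y (p j) = (esym_val Y (p i) : rat) * R0 by exact: (bigD1 i).
have E1 : \prod_j esym_val Y (([ffun j => - (i == j)%:Z] + p) j) =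
    (esym_val Y (p i - 1) : rat) * R0.
  apply: etrans (bigD1 i isT) _; apply: (congr2 ( *%R : rat -> rat -> rat)).
    by congr (esym_val Y _); rewrite !ffunE eqxx addrC.
  apply: eq_bigr => j /negPf ji; congr (esym_val Y _).
  by rewrite !ffunE eq_sym ji oppr0 add0r.
have E2 : (([ffun j => - (i == j)%:Z] + p) i)%:~R = (p i)%:~R - 1 :> rat.
  by rewrite !ffunE eqxx addrC intrD rmorphN.
have aux (a e e' r : rat) : a * e = (N + a - 1) * e' ->
    a * (e * r) = N * (e' * r) + (a - 1) * (e' * r).
  by rewrite mulrA => ->; ring.
rewrite E0 E1 E2; exact: aux (binomial_esym (p i)).
Qed.
End Pearson.

(** Here s exchanges two variables and I is a form invariant under s.  As V is
    invariant and d = z_i x_l - z_l x_i changes sign, the integral of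
    (1 - z_i) u V d is half that of r (z_l - z_i) V d, and
    (z_l - z_i) d = (z_i + z_l) (1 - z_i x_l) (1 - z_l x_i) gives back W. *)
Lemma antisymmetrization (R : comNzRingType) (s : R -> R) (I : R -> rat)
    (zi zl xi xl V W u r : R) :
  (forall F G, s (F * G) = s F * s G) -> s 1 = 1 -> (forall F G, s (F - G) = s F - s G) ->
  (forall F G, I (F + G) = I F + I G) -> (forall F G, I (F - G) = I F - I G) ->
  (forall F, I (s F) = I F) ->
  s zi = zl -> s zl = zi -> s xi = xl -> s xl = xi -> zi * xi = 1 -> zl * xl = 1 ->
  (forall y, y * ((1 - zi * xl) * (1 - zl * xi)) = 0 -> y = 0) ->
  V * ((1 - zi * xl) * (1 - zl * xi)) = W -> s W = W -> s r = r ->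
  (1 - zi) * u - (1 - zl) * s u = r * (zl - zi) ->
  I ((1 - zi) * u * (V * (zi * xl - zl * xi))) = I (r * zi * W) /\
  I (r * zl * W) = I (r * zi * W).
Proof.
move=> sM s1 sB ID IB Is szi szl sxi sxl zxi zxl reg VW sW sr uE.
pose d := zi * xl - zl * xi.
have s_d : s d = - d by rewrite sB !sM szi szl sxi sxl opprB.
have s_V : s V = V.
  apply/eqP; rewrite -subr_eq0; apply/eqP/reg; rewrite mulrBl VW -[X in _ - X]sW -VW.
  by rewrite !sM !sB !sM s1 szi szl sxi sxl [(1 - zl * xi) * _]mulrC subrr.
have E1 : I (r * zl * W) = I (r * zi * W).
  by rewrite -(Is (r * zl * W)) !sM sW sr szl.
split=> //; rewrite -/d; set A := I _.
have A2 : A = - I ((1 - zl) * s u * (V * d)).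
  have I0 : I 0 = 0 by have := IB 0 0; rewrite subrr => ->; rewrite subrr.
  by rewrite -[RHS]add0r -I0 -IB sub0r -mulrN -mulrN /A -Is !sM sB s1 szi s_V s_d.
have AA : A + A = I (r * zi * W) + I (r * zl * W).
  rewrite {2}A2 /A -IB -ID; congr (I _).
  rewrite -mulrBl uE -VW.
  transitivity (r * V * ((zl - zi) * (zi * xl - zl * xi))); first by rewrite /d; ring.
  have -> : (zl - zi) * (zi * xl - zl * xi) =
            (zi + zl) * ((1 - zi * xl) * (1 - zl * xi)).
    transitivity (zi * (zl * xl) - zl * (zl * xi) - zi * (zi * xl) + zl * (zi * xi)); first by ring.
    transitivity ((zi + zl) - zl * (zl * xi) - zi * (zl * xi) - zi * (zi * xl) - zl * (zi * xl)
       + zi * (zi * xi) * (zl * xl) + zl * (zl * xl) * (zi * xi)); last by ring.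
    by rewrite zxi zxl !mulr1; ring: zxi zxl.
  by ring.
move: AA; rewrite E1; lra.
Qed.

Section Recursion.
Variables (n k : nat) (N : rat).
Hypothesis k_gt0 : (0 < k)%N.
Notation x := (@lvar n).
Notation z := (@lvarV n).
Notation W := (dyson_weight n k).
Notation int := (integral (binomial_alphabet N)).

Lemma integral_swap_term i l (V u r : laurent n) : l != i ->
  V * pair_factor i l = W -> swap i l r = r ->
  (1 - z i) * u - (1 - z l) * swap i l u = r * (z l - z i) ->
  int ((1 - z i) * u * (V * (z i * x l - z l * x i))) = int (r * z i * W) /\
  int (r * z l * W) = int (r * z i * W).
Proof.
move=> li VW rE uE.
apply: (antisymmetrization (s := swap i l) (I := int) _ _ _ _ _ _ _ _ _ _ _ _ _ VW _ rE uE).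
- exact: swapM.
- exact: swap1.
- by move=> F G; exact: raddfB.
- by move=> F G; refine (@integralD _ (binomial_alphabet N) n F G).
- by move=> F G; refine (@integralB _ (binomial_alphabet N) n F G).
- by move=> F; refine (@integral_swap n _ (binomial_alphabet N) i l F).
- by rewrite swap_lvarV tpermL.
- by rewrite swap_lvarV tpermR.
- by rewrite swap_lvar tpermL.
- by rewrite swap_lvar tpermR.
- exact: lvarVKz.
- exact: lvarVKz.
- by move=> y; apply: pair_factor_regular.
- exact: swap_dyson_weight.
Qed.
End Recursion.

Transparent integral.
Lemma integral_neg (A : comAlgType rat) (Y : alphabet A) n (F : laurent n) :
  supported (fun q : {ffun 'I_n -> int} => exists i, q i < 0) F -> integral Y F = 0.
Proof.
move=> Fneg; rewrite /integral big_seq big1 // => p; rewrite -mcoeff_neq0 => /Fneg[i pi].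
by rewrite (bigD1 i) //= esym_val_neg // mul0r scaler0.
Qed.
Opaque integral.

Lemma telescope_prod (a p q : nat -> rat) r :
  (forall i, (i < r)%N -> q i * a i.+1 = p i * a i) ->
  a 0%N * \prod_(i < r) p i = a r * \prod_(i < r) q i.
Proof.
elim: r => [|r IH] E; first by rewrite !big_ord0.
rewrite !big_ord_recr /= mulrA IH => [|i lt]; last exact/E/ltnW.
have Er := E r (ltnSn r); move: (\prod_(i < r) q i) => b.
transitivity (p r * a r * b); first by ring.
by rewrite -Er; ring.
Qed.

Section Recursion.
Variables (n k : nat).
Hypothesis k_gt0 : (0 < k)%N.
Notation x := (@lvar n).
Notation z := (@lvarV n).
Notation W := (dyson_weight n k).
Notation N := ((n * k)%:R : rat).
Notation intY := (integral (binomial_alphabet N)).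

(** The exponents of (x_1 ... x_n)^j z_1 ... z_r. *)
Definition staircase (j r : nat) : {ffun 'I_n -> int} :=
  [ffun l : 'I_n => j%:Z - (l < r)%N%:Z].

Definition stair_int j r : rat := intY (lmono (staircase j r) * W).

Lemma sum_if_ltn (i : 'I_n) (a b : rat) :
  \sum_(l < n | l != i) (if (l < i)%N then a else b) = i%:R * a + (n%:R - i%:R - 1) * b.
Proof.
have -> : \sum_(l < n | l != i) (if (l < i)%N then a else b) =
    \sum_(l < n) (if (l < i)%N then a else b) - b.
  rewrite [in RHS](bigD1 i) //= ltnn; ring.
rewrite (eq_bigr (fun l : 'I_n => b + (a - b) * (l < i)%N%:R)) => [|l _]; last first.
  by case: (l < i)%N; rewrite ?mulr1 ?mulr0; ring.
rewrite big_split /= -mulr_sumr -natr_sum sumr_const card_ord.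
have -> : (\sum_(l < n) (l < i) = i)%N.
  have := sum_ltn_ord n i; rewrite big_mkcond (minn_idPr (ltnW (ltn_ord i))) => E.
  by rewrite -[RHS]E; apply: eq_bigr => l _; case: (l < i)%N.
by rewrite -mulr_natl; ring.
Qed.

Lemma integral_theta_lmonoM (i : 'I_n) (p : {ffun 'I_n -> int}) (G : laurent n) (c : rat) : (p i)%:~R = c ->
  intY (theta i (lmono p * G)) = c * intY (lmono p * G) + intY (lmono p * theta i G).
Proof. by move=> <-; rewrite thetaM integralD theta_lmono -scalerAl integralZ. Qed.

(** Aomoto's recursion: integrate by parts with respect to x_i in
    (x_1 ... x_n)^j W times the product of the z_l for l < i.  Antisymmetrizing in
    x_i and x_l turns the term of index l of theta_i W into the integral before or
    after the step, according to whether l < i. *)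
Lemma stair_step j (i : 'I_n) :
  (k%:R * i.+1%:R + j%:R - 1) * stair_int j i.+1 = (j%:R + k%:R * i%:R) * stair_int j i.
Proof.
have [u uE0] : {u : laurent n | u = lmono (staircase j i)} by exists (lmono (staircase j i)).
have zu : z i * u = lmono (staircase j i.+1).
  rewrite uE0 /lvarV lmonoM; congr lmono; apply/ffunP => l; rewrite !ffunE.
  have -> : (l < i.+1)%N = (l < i)%N || (i == l).
    by rewrite ltnS leq_eqVlt orbC eq_sym.
  by case: (eqVneq i l) => [<-|_]; rewrite ?ltnn ?orbF /=; ring.
have [V [VW thetaW]] := theta_dyson_weight k_gt0 i.
(* Take r = u / z_l if l < i and r = u otherwise: r is invariant under the
   exchange of i and l. *)
have term l : l != i -> intY ((1 - z i) * u * (V l * (z i * x l - z l * x i))) =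
    if (l < i)%N then stair_int j i else stair_int j i.+1.
  move=> li; have [lt|ge] := ltnP l i.
    have [r rE] : {r : laurent n | r = lmono [ffun a : 'I_n => j%:Z - ((a < i)%N && (a != l))%:Z]}.
      by eexists.
    have rz a : r * z a = lmono ([ffun b : 'I_n => j%:Z - ((b < i)%N && (b != l))%:Z] +
        [ffun b => - (a == b)%:Z]) by rewrite rE; exact: lmonoM.
    have rzl : r * z l = u.
      rewrite rz uE0; congr lmono; apply/ffunP => b; rewrite !ffunE [b == l]eq_sym.
      by case: (eqVneq l b) => [<-|_]; rewrite ?lt; lia.
    have sr : swap i l r = r.
      rewrite rE [LHS]swap_lmono; congr lmono; apply/ffunP => b; rewrite !ffunE.
      case: tpermP => [->|->|//]; rewrite ltnn eqxx andbF //.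
    have su : swap i l u = r * z i.
      by rewrite -rzl swapM sr swap_lvarV tpermR.
    have uE : (1 - z i) * u - (1 - z l) * swap i l u = r * (z l - z i).
      have aux (R : comNzRingType) (a b c : R) :
        (1 - a) * (c * b) - (1 - b) * (c * a) = c * (b - a) by ring.
      by rewrite su -rzl; exact: aux.
    have [E1 E2] := integral_swap_term N li (VW l li) sr uE.
    have E3 : intY (r * z l * W) = stair_int j i :=
      congr1 (fun F : laurent n => intY (F * W)) (etrans rzl uE0).
    exact (etrans E1 (etrans (Logic.eq_sym E2) E3)).
  have su : swap i l u = u.
    rewrite uE0 [LHS]swap_lmono; congr lmono; apply/ffunP => b; rewrite !ffunE.
    by case: tpermP => [->|->|//]; rewrite ltnn ltnNge ge.
  have uE : (1 - z i) * u - (1 - z l) * swap i l u = u * (z l - z i).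
    have aux (R : comNzRingType) (a b c : R) :
      (1 - a) * c - (1 - b) * c = c * (b - a) by ring.
    by rewrite su; exact: aux.
  have [E1 _] := integral_swap_term N li (VW l li) su uE.
  have E2 : intY (u * z i * W) = stair_int j i.+1 :=
    congr1 (fun F : laurent n => intY (F * W)) (etrans (mulrC u (z i)) zu).
  exact (etrans E1 E2).
have cE : (j%:Z - 1)%:~R = j%:R - 1 :> rat by rewrite intrD.
have st : staircase j i i = j%:Z by rewrite ffunE ltnn subr0.
have stS : staircase j i.+1 i = j%:Z - 1 by rewrite ffunE ltnSn.
pose A : rat := intY (u * theta i W); pose B : rat := intY (lmono (staircase j i.+1) * theta i W).
have F2 : z i * (u * W) = lmono (staircase j i.+1) * W :=
  etrans (mulrA _ _ _) (congr1 ( *%R^~ W) zu).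
have H1 : intY (theta i (u * W)) = j%:R * stair_int j i + A.
  by rewrite /A uE0; apply: integral_theta_lmonoM; rewrite st.
have H2 : intY (theta i (z i * (u * W))) = (j%:R - 1) * stair_int j i.+1 + B.
  apply: etrans (congr1 (fun F => intY (theta i F)) F2) _.
  by apply: integral_theta_lmonoM; rewrite stS.
have H3 : intY (z i * (u * W)) = stair_int j i.+1 := congr1 intY F2.
have H4 : A - B = k%:R * (i%:R * stair_int j i + (n%:R - i%:R - 1) * stair_int j i.+1).
  have -> : A - B = intY ((1 - z i) * u * theta i W).
    have -> : (1 - z i) * u * theta i W = u * theta i W - lmono (staircase j i.+1) * theta i W.
      by rewrite mulrBl mul1r zu mulrBl.
    by rewrite integralB.
  rewrite thetaW mulr_sumr integral_sum -sum_if_ltn mulr_sumr; apply: eq_bigr => l li.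
  rewrite -(term l li) mulrnAr -scaler_nat integralZ //.
have P := etrans (Logic.eq_sym H1)
  (etrans (pearson N i (u * W)) (congr2 +%R (congr1 ( *%R N) H3) H2)).
move: P H4; rewrite natrM -natr1; move: (stair_int j i) (stair_int j i.+1) => e0 e1.
clearbody A B; move=> P H4.
have {}H4 : A = B + k%:R * (i%:R * e0 + (n%:R - i%:R - 1) * e1) by rewrite -H4; ring.
rewrite H4 in P; apply/eqP; rewrite -subr_eq0; move/eqP: P; rewrite -subr_eq0 => /eqP P.
by rewrite -[0]oppr0 -P; apply/eqP; ring.
Qed.

Lemma stair_int_wrap j : stair_int j.+1 n = stair_int j 0.
Proof.
congr (intY (lmono _ * _)); apply/ffunP => l; rewrite !ffunE ltn_ord ltn0; lia.
Qed.

Lemma stair_telescope j :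
  stair_int j.+1 0 * \prod_(i < n) (j.+1%:R + k%:R * i%:R) =
  stair_int j 0 * \prod_(i < n) (k%:R * i.+1%:R + j%:R).
Proof.
rewrite -(stair_int_wrap j).
apply: (telescope_prod (a := stair_int j.+1) (p := fun i => j.+1%:R + k%:R * i%:R)
  (q := fun i => k%:R * i.+1%:R + j%:R)) => i lt.
apply: etrans _ (stair_step j.+1 (Ordinal lt)).
by apply: (congr1 ( *%R^~ (stair_int j.+1 i.+1))); rewrite -[j.+1%:R]natr1; ring.
Qed.

Lemma stair_int_prod m :
  stair_int m 0 * \prod_(j < m) \prod_(i < n) (j.+1%:R + k%:R * i%:R) =
  stair_int 0 0 * \prod_(j < m) \prod_(i < n) (k%:R * i.+1%:R + j%:R).
Proof.
pose p (j : nat) : rat := \prod_(i < n) (k%:R * i.+1%:R + j%:R).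
pose q (j : nat) : rat := \prod_(i < n) (j.+1%:R + k%:R * i%:R).
suff E : stair_int 0 0 * \prod_(j < m) p j = stair_int m 0 * \prod_(j < m) q j by exact: Logic.eq_sym E.
apply: (telescope_prod (a := fun j => stair_int j 0)) => j _.
have E : stair_int j.+1 0 * q j = stair_int j 0 * p j := stair_telescope j.
by rewrite mulrC E mulrC.
Qed.

(** The exponents of a monomial of W add up to 0, so unless it is constant one of
    them is negative and its integral vanishes. *)
Lemma stair_int00 : stair_int 0 0 = W@_0.
Proof.
have -> : stair_int 0 0 = intY W.
  have E : staircase 0 0 = 0 by apply/ffunP => l; rewrite !ffunE ltn0.
  by rewrite /stair_int E [lmono 0 * W]mul1r.
pose F : laurent n := W - W@_0 *: lmono 0.
have F0 : intY F = 0.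
  apply: integral_neg => q; rewrite mcoeffB mcoeffZ coef_lmono.
  have [<-|q0] := eqVneq 0 q; first by rewrite mulr1 subrr eqxx.
  rewrite mulr0 subr0 => /supported_dyson_weight qs.
  apply/existsP; apply: contraNT q0 => /existsPn q_ge0; apply/eqP/ffunP => i.
  rewrite ffunE; apply/eqP; rewrite eq_sym; apply/eqP.
  have q_ge l : 0 <= q l by rewrite Num.Theory.real_leNgt ?Num.Theory.num_real // q_ge0.
  have /eqP := qs; rewrite Num.Theory.psumr_eq0 // => /allP/(_ i).
  by rewrite mem_index_enum => /(_ isT) /eqP.
have -> : W = F + W@_0 *: lmono 0 by rewrite subrK.
rewrite integralD F0 add0r integralZ integral_lmono mcoeffD mcoeffB mcoeffZ coef_lmono eqxx.
rewrite mulr1 subrr add0r big1 => [|i _]; first by rewrite /GRing.scale /= mulr1.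
by rewrite ffunE /= esym0 rmorph1.
Qed.
End Recursion.

(** * The Jack function of a rectangle *)

Lemma rect_first n m : (nth 0%N (rect_part m n) 0 <= m)%N.
Proof.
have := sumn_takeS (rect_part m n) 0; rewrite sumn_take_rect take0 /= add0n => <-.
by rewrite -[X in (_ <= X)%N]muln1 leq_mul2l geq_minl orbT.
Qed.

(** The entries of b are at most m and add up to m n. *)
Lemma dominated_const n m (b : 'I_n -> nat) :
  dominated (part_of b) (rect_part m n) -> b =1 fun=> m.
Proof.
move=> dom; have b_le i : (b i <= m)%N.
  exact: leq_trans (le_part_of b i) (leq_trans (dominated_first dom) (rect_first n m)).
have /eqP : (\sum_i b i = \sum_(i < n) m)%N.
  transitivity (sumn (part_of b)).
    rewrite sumnE (perm_big _ (perm_mkpart _)) big_filter big_map big_enum_cond /=.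
    by rewrite [RHS]big_mkcond; apply: eq_bigr => i _ /=; case: posnP.
  by have [-> _] := dom; rewrite sumn_rect sum_nat_const card_ord mulnC.
have leqif i : true -> (b i <= m ?= iff (b i == m))%N by move=> _; split.
by rewrite (leqif_sum leqif) => /forallP bm i; apply/eqP/(bm i).
Qed.

Lemma monomial_eval_ones n (mu : intpart) :
  monomial_eval (fun _ : 'I_n => 1 : rat^o) mu =
  (\sum_(a : {ffun 'I_n -> 'I_(sumn mu).+1} | part_of (fun i => a i) == mu) 1)%:R.
Proof.
rewrite /monomial_eval natr_sum; apply: eq_bigr => a _.
by rewrite big1 // => i _; rewrite expr1n.
Qed.

(** In n variables the only monomial with exponents dominated by m^n is
    (x_1 ... x_n)^m. *)
Lemma jackP_rect_ones n m (f : symfun) : (0 < n)%N -> unitriangular (rect_part m n) f ->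
  sfeval (finite_alphabet (fun _ : 'I_n => 1 : rat^o)) f = 1.
Proof.
move=> n0 [s [u [s_lt ->]]]; rewrite big_seq big1 => [|mu /s_lt[dom ne]]; last first.
  rewrite monomial_eval_ones big_pred0 ?scaler0 // => a; apply/eqP => aE.
  apply: ne; rewrite -aE; rewrite -aE in dom.
  rewrite -part_of_const; congr mkpart; apply: eq_map; exact: dominated_const dom.
rewrite addr0 monomial_eval_ones.
have m_lt : (m < (sumn (rect_part m n)).+1)%N by rewrite ltnS sumn_rect leq_pmulr.
rewrite (big_pred1 [ffun=> Ordinal m_lt]) // => a /=; apply/eqP/eqP => [aE|->].
  apply/ffunP => i; rewrite ffunE; apply: val_inj => /=.
  by apply: (@dominated_const n m (fun i => a i)); rewrite aE; apply: dominated_refl.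
by rewrite -[RHS]part_of_const; congr mkpart; apply: eq_map => i; rewrite ffunE.
Qed.

(** * Factorials in the staircase recursion *)

Lemma rising_fact a m : (\prod_(j < m) (a + j.+1) * a`! = (a + m)`!)%N.
Proof.
elim: m => [|m IH]; first by rewrite big_ord0 mul1n addn0.
rewrite big_ord_recr /= mulnAC IH mulnC addnS factS //.
Qed.

Lemma telescope_fact (f : nat -> nat) n :
  (\prod_(i < n) f i.+1 * f 0 = \prod_(i < n) f i * f n)%N.
Proof.
elim: n => [|n IH]; first by rewrite !big_ord0.
by rewrite [in LHS]big_ord_recr [in RHS]big_ord_recr /= -IH mulnAC.
Qed.

(** For each i the product over j is a quotient of factorials, (k (i + n))! / (k i)!
    for D and (k (i + 1 + n) - 1)! / (k (i + 1) - 1)! for H; so D and H differ by the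
    end terms of two telescoping products. *)
Lemma rectangle_hooks n k (D := (\prod_(j < k * n) \prod_(i < n.+1) (j.+1 + k * i))%N)
    (H := (\prod_(j < k * n) \prod_(i < n.+1) (k * i.+1 + j))%N) : (0 < k)%N ->
  (D * (k * n.+1`! * n`! * ((2 * n.+1 - 1) * k - 1)`!) =
   H * ((2 * n)`! * (n.+1 * k)`! * (n * k)`!))%N.
Proof.
move=> k0; pose A := (\prod_(i < n.+1) (k * i)`!)%N; pose B := (\prod_(i < n.+1) (k * (i + n))`!)%N.
have DA : (D * A = B)%N.
  rewrite /D exchange_big -big_split; apply: eq_bigr => i _ /=.
  rewrite (eq_bigr (fun j : 'I_(k * n) => (k * i + j.+1)%N)) => [|j _]; last by rewrite addnC.
  by rewrite rising_fact mulnDr.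
have HA : (H * \prod_(i < n.+1) (k * i.+1)`! * \prod_(i < n.+1) (n + i.+1) =
    n.+1`! * \prod_(i < n.+1) (k * (i.+1 + n))`!)%N.
  have -> : (n.+1`! = \prod_(i < n.+1) i.+1)%N.
    by have := rising_fact 0 n.+1; rewrite fact0 muln1 add0n => <-; apply: eq_bigr.
  rewrite /H exchange_big -!big_split; apply: eq_bigr => i _ /=.
  have aE : (k * i.+1 = (k * i.+1).-1.+1)%N by rewrite prednK // muln_gt0 k0.
  set a := (k * i.+1).-1 in aE.
  have E1 : (\prod_(j < k * n) (k * i.+1 + j) * a`! = (a + k * n)`!)%N.
    by rewrite -rising_fact; congr (_ * _)%N; apply: eq_bigr => j _; rewrite aE addSnnS.
  have E2 : ((k * (i.+1 + n))`! = (k * (i.+1 + n)) * (a + k * n)`!)%N.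
    by rewrite mulnDr [X in X`!](_ : _ = (a + k * n).+1) ?factS ?aE.
  rewrite E2 -E1 {2}aE factS -aE; move: (\prod_(j < k * n) _)%N (a`!) => u v; ring.
have TA := telescope_fact (fun i => (k * i)`!)%N n.+1.
have TB := telescope_fact (fun i => (k * (i + n))`!)%N n.+1.
have NF : (\prod_(i < n.+1) (n + i.+1) * n`! = (n + n.+1)`!)%N := rising_fact n n.+1.
have A0 : (0 < A)%N by rewrite prodn_gt0 // => i; rewrite fact_gt0.
have P1 : ((n + n.+1)`! = n.*2.+1 * (2 * n)`!)%N.
  by rewrite addnS factS addnn mul2n.
have Q1 : ((k * (n.+1 + n))`! = k * n.*2.+1 * ((2 * n.+1 - 1) * k - 1)`!)%N.
  have e1 : ((2 * n.+1 - 1) = n.*2.+1)%N by rewrite mulnS mul2n.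
  have e2 : (n.+1 + n = n.*2.+1)%N by rewrite addSn addnn.
  rewrite e1 e2 [(n.*2.+1 * k)%N]mulnC.
  have : (0 < k * n.*2.+1)%N by rewrite muln_gt0 k0.
  by case: (k * n.*2.+1)%N => // t _; rewrite subn1 factS.
apply/eqP; rewrite -(eqn_pmul2l (ltn0Sn n.*2)) -(eqn_pmul2l A0); apply/eqP.
rewrite muln0 fact0 muln1 -/A in TA; rewrite add0n -/B in TB; rewrite TA in HA.
rewrite mulnC in P1; rewrite [(n.+1 * k)%N]mulnC [(n * k)%N]mulnC.
move: DA HA TB NF P1 Q1.
move: (\prod_(i < n.+1) (n + i.+1))%N (\prod_(i < n.+1) (k * (i.+1 + n))`!)%N => G S'.
move: (((2 * n.+1 - 1) * k - 1)`!) ((2 * n)`!) ((k * n.+1)`!) ((k * n)`!) (n`!) (n.+1`!)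
  ((n + n.+1)`!) ((k * (n.+1 + n))`!) n.*2.+1 => r e c d u w p q t.
clearbody D H A B => DA HA TB NF P1 Q1.
transitivity ((D * A) * (w * u * (k * t * r)))%N; first by ring.
rewrite DA -Q1; transitivity (w * u * (B * q))%N; first by ring.
rewrite -TB; transitivity (u * d * (w * S'))%N; first by ring.
rewrite -HA; transitivity (H * A * c * d * (G * u))%N; first by ring.
by rewrite NF P1; ring.
Qed.

(** * Even powers of the Vandermonde product *)

Section VandermondePower.
Variable n : nat.
Notation x := (@lvar n).
Notation z := (@lvarV n).

Lemma prod_pairs (R : comNzRingType) (f : 'I_n -> 'I_n -> R) :
  \prod_(i < n) \prod_(j < n | (i < j)%N) (f i j * f j i) =
  \prod_(i < n) \prod_(j < n | j != i) f i j.
Proof.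
rewrite (eq_bigr (fun i : 'I_n => (\prod_(j < n | (i < j)%N) f i j) *
  \prod_(j < n | (i < j)%N) f j i)) => [|i _]; last exact: big_split.
rewrite big_split /= [X in _ * X](exchange_big_dep predT) //= -big_split /=.
apply: eq_bigr => i _; rewrite [RHS](bigID (fun j : 'I_n => (i < j)%N)) /=; congr (_ * _).
  by apply: eq_bigl => j; rewrite -(inj_eq val_inj) /= neq_ltn; case: ltngtP.
by apply: eq_bigl => j; rewrite -(inj_eq val_inj) /= neq_ltn; case: ltngtP.
Qed.

Lemma sum_pairs : (\sum_(i < n) \sum_(j < n | (i < j)%N) 1 = 'C(n, 2))%N.
Proof.
rewrite (exchange_big_dep predT) //= -bin2_sum big_mkord; apply: eq_bigr => j _.
by rewrite sum_ltn_ord (minn_idPr (ltnW (ltn_ord j))).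
Qed.

(** With v_i = u_i^(-1),
    (u_i - u_j)^2 = - u_i u_j (1 - v_i u_j) (1 - v_j u_i). *)
Lemma vandermonde_sqr (R : comNzRingType) (u v : 'I_n -> R) : (forall i, v i * u i = 1) ->
  (\prod_(i < n) \prod_(j < n | (i < j)%N) (u i - u j)) ^+ 2 =
  (-1) ^+ 'C(n, 2) * (\prod_i u i) ^+ n.-1 *
  \prod_i \prod_(j | j != i) (1 - v i * u j).
Proof.
move=> vu; pose f i j := u i * (1 - v i * u j).
have fE i j : f i j = u i - u j by rewrite /f mulrBr mulr1 mulrA [u i * v i]mulrC vu mul1r.
transitivity (\prod_(i < n) \prod_(j < n | (i < j)%N) (-1 * (f i j * f j i))).
  rewrite -prodrXl; apply: eq_bigr => i _; rewrite -prodrXl; apply: eq_bigr => j _.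
  by rewrite !fE; ring.
rewrite (eq_bigr (fun i : 'I_n => (-1) ^+ (\sum_(j < n | (i < j)%N) 1) *
    \prod_(j < n | (i < j)%N) (f i j * f j i))) => [|i _]; last first.
  rewrite big_split /=; congr (_ * _).
  by rewrite prodr_const sum1_card.
rewrite big_split /= prod_pairs -mulrA; congr (_ * _).
  by rewrite -sum_pairs expr_sum.
rewrite -prodrXl -big_split; apply: eq_bigr => i _ /=.
rewrite big_split /= prodr_const; congr (_ ^+ _ * _).
by rewrite cardC1 card_ord.
Qed.
End VandermondePower.

Lemma vandermonde_pow (R : comAlgType rat) n k (u v : 'I_n -> R) : (forall i, v i * u i = 1) ->
  (\prod_(i < n) \prod_(j < n | (i < j)%N) (u i - u j)) ^+ (2 * k) =
  (-1) ^+ (k * 'C(n, 2)) *: ((\prod_i u i) ^+ (k * n.-1) * dyson_product v u [set: 'I_n] (fun=> k)).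
Proof.
move=> vu; rewrite exprM (vandermonde_sqr vu) !exprMn -!exprM mulnC [(n.-1 * k)%N]mulnC.
have E : (-1 : R) ^+ (k * 'C(n, 2)) = (-1) ^+ (k * 'C(n, 2)) *: 1.
  exact: Logic.eq_sym (rmorph_sign (in_alg R) _).
rewrite E -mulrA -scalerAl mul1r; congr (_ *: (_ * _)).
rewrite -prodrXl /dyson_product; apply: eq_big => [i|i _]; first by rewrite inE.
by congr (_ ^+ _); apply: eq_bigl => j; rewrite inE.
Qed.

Lemma prod_lvar_pow n m : (\prod_(i < n) lvar i) ^+ m = xpow n m.
Proof.
have prodE : \prod_(i < n) lvar i = lmono (\sum_(i < n) [ffun j => (i == j)%:Z]).
  apply: (big_rec2 (fun F p => F = lmono p)) => [//|i p F _ ->].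
  by rewrite /lvar lmonoM.
rewrite prodE; set p := \sum_(i < n) _.
have pE : p = [ffun=> 1].
  apply/ffunP => j; rewrite /p sum_ffunE ffunE (bigD1 j) //= ffunE eqxx big1 ?addr0 // => i ij.
  by rewrite ffunE (negbTE ij).
apply: etrans (lmono_exp p m) _; congr lmono; apply/ffunP => i.
by rewrite pE ffunMnE !ffunE; lia.
Qed.

Lemma vandermonde_dyson n k : vandermonde n ^+ (2 * k) =
  (-1) ^+ ((k * n * (n - 1)) %/ 2) *: (xpow n (k * (n - 1)) * dyson_weight n k).
Proof.
have -> : ((k * n * (n - 1)) %/ 2 = k * 'C(n, 2))%N.
  rewrite bin2 subn1 -mulnA -divn2 muln_divA // dvdn2 oddM; case: n => //= n; by case: odd.
rewrite subn1 -prod_lvar_pow.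
exact: (@vandermonde_pow _ n k (@lvar n) (@lvarV n) (fun i => etrans (mulrC _ _) (lvarK i))).
Qed.

(** * The substitution integral of a Jack function *)

Lemma integral_eq (A : comAlgType rat) (Y Z : alphabet A) n (F : laurent n) :
  (forall i, (0 < i)%N -> Y i = Z i) -> integral Y F = integral Z F.
Proof.
move=> YZ; apply: (laurent_linear_eq (u := integral Y) (v := integral Z)) => [c G H|c G H|p].
- exact: integralP.
- exact: integralP.
rewrite !integral_lmono; apply: eq_bigr => i _; case: (p i) => // j.
exact: sfeval_eq.
Qed.

(** It is enough to integrate over the generic alphabet. *)
Lemma integral_powersum (A : comAlgType rat) (Y : alphabet A) n (F : laurent n) :
  integral Y F = sfeval Y (integral powersum F).
Proof.
by rewrite sfeval_integral; apply: integral_eq => i i0; rewrite sfeval_powersum.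
Qed.

Lemma sfevalZ (A : comAlgType rat) (X : alphabet A) c f : sfeval X (c *: f) = c *: sfeval X f.
Proof. exact: linearZ_LR. Qed.

Lemma sfevalZ_rat (X : alphabet rat^o) (c : rat) f :
  sfeval X (c *: f) = c * (sfeval X f : rat) :> rat.
Proof. exact: (sfevalZ X c f). Qed.

(** The power sum p_r is n at n variables equal to 1, and omega_k multiplies it by
    (-1)^(r-1) k. *)
Lemma sfeval_binomial (n k : nat) f :
  sfeval (binomial_alphabet (n * k)%:R) f =
  sfeval (finite_alphabet (fun _ : 'I_n => 1 : rat^o)) (omega k%:R f).
Proof.
rewrite omegaE sfeval_comp; apply: sfeval_eq => i i0; rewrite /signed_powersum.
apply: Logic.eq_sym; apply: etrans (sfevalZ _ _ _) _.
apply: etrans (congr1 _ (sfeval_powersum _ i0)) _.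
rewrite /finite_alphabet /binomial_alphabet.
under eq_bigr do rewrite expr1n.
rewrite sumr_const card_ord /GRing.scale /= natrM -mulrA; congr (_ * _).
exact: mulrC.
Qed.

Lemma omega_integral (b : rat) n (F : laurent n) :
  omega b (integral powersum F) = integral (signed_powersum b) F.
Proof.
rewrite omegaE sfeval_integral; apply: integral_eq => i i0.
by rewrite sfeval_powersum.
Qed.

Lemma omega_inj (k : rat) f g : k != 0 -> omega k f = omega k g -> f = g.
Proof.
move=> k0 E; apply: (jdot_eqr k0) => h.
by rewrite -(omega_isometry k0) E omega_isometry.
Qed.

Section Corollary.
Variables (n k : nat) (P1 Q1 P2 Q2 : intpart -> symfun).
Variables (Q2skew : intpart -> intpart -> symfun).
Hypotheses (n_gt0 : (0 < n)%N) (k_gt0 : (0 < k)%N).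
Hypotheses (jackP1 : is_jackP (k%:R)^-1 P1) (jackQ1 : is_jackQ (k%:R)^-1 P1 Q1).
Hypotheses (jackP2 : is_jackP k%:R P2) (jackQ2 : is_jackQ k%:R P2 Q2).
Hypothesis skewQ2 : is_skew_jackQ k%:R P2 Q2 Q2skew.
Let m := (k * (n - 1))%N.
Let W := dyson_weight n k.
Let F := xpow n m * W.
Let rect := rect_part n m.
Let k0 : (k%:R : rat) != 0. Proof. by rewrite Num.Theory.pnatr_eq0 -lt0n. Qed.
Let duality := jack_duality k0 jackP1 jackQ1 jackP2 jackQ2.

Lemma omega_rect : omega k%:R (P2 rect) = Q1 (rect_part m n).
Proof. by have [<- _] := duality (rect_part m n); rewrite conj_rect. Qed.

Lemma integral_dyson : integral powersum F = W@_0 *: P2 rect.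
Proof.
apply: (omega_inj k0); rewrite omega_integral.
apply: etrans (integral_xpow_dyson_weight n m k_gt0 jackP1 jackQ1) _.
by rewrite omegaZ omega_rect.
Qed.

Lemma norm_rect : jdot k%:R (P2 rect) (P2 rect) = jack_b (k%:R)^-1 P1 (rect_part m n).
Proof.
have [_ E] := duality (rect_part m n); rewrite conj_rect in E.
have k0' : (k%:R : rat)^-1 != 0 by rewrite invr_eq0.
have N := jackP_norm_neq0 k0' jackP1 (rect_part m n).
by apply: (mulfI N); rewrite E mulfV.
Qed.

(** Duality turns this value into that of Q_(m^n), for the parameter 1/k, at
    x_1 = ... = x_n = 1, where P_(m^n) takes the value 1. *)
Lemma sfeval_binomial_rect :
  sfeval (binomial_alphabet (n * k)%:R) (P2 rect) = jdot k%:R (P2 rect) (P2 rect).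
Proof.
have k0' : (k%:R : rat)^-1 != 0 by rewrite invr_eq0.
rewrite sfeval_binomial omega_rect (jackQE k0' jackP1 jackQ1) -norm_rect.
apply: etrans (sfevalZ _ _ _) _.
apply: etrans (congr1 _ (jackP_rect_ones n_gt0 (jackP1.2 _))) _.
by rewrite /GRing.scale /= mulr1.
Qed.

Lemma dyson_weight_neq0 : W@_0 != 0.
Proof.
rewrite coef0_dyson_weight mulf_neq0 ?invr_eq0 ?expf_neq0 //.
  by rewrite Num.Theory.pnatr_eq0 -lt0n fact_gt0.
by rewrite Num.Theory.pnatr_eq0 -lt0n fact_gt0.
Qed.

(** Evaluate the integral of x^m W at the binomial alphabet of n k: by
    [integral_dyson] this is the constant term of W times the squared norm, and
    Aomoto's recursion computes it. *)
Lemma norm_rect_prod :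
  jdot k%:R (P2 rect) (P2 rect) * (\prod_(j < m) \prod_(i < n) (j.+1 + k * i))%:R =
  (\prod_(j < m) \prod_(i < n) (k * i.+1 + j))%:R.
Proof.
have E : stair_int n k m 0 = W@_0 * jdot k%:R (P2 rect) (P2 rect).
  rewrite -sfeval_binomial_rect.
  have -> : stair_int n k m 0 = integral (binomial_alphabet (n * k)%:R) F.
    have e : staircase n m 0 = [ffun=> m%:Z] by apply/ffunP => i; rewrite !ffunE ltn0 subr0.
    by rewrite /stair_int e.
  rewrite integral_powersum integral_dyson; exact: sfevalZ_rat.
have := stair_int_prod n k_gt0 m; rewrite stair_int00 E -/W -mulrA.
move=> /(mulfI dyson_weight_neq0) H.
have cast (f : nat -> nat -> nat) : (\prod_(j < m) \prod_(i < n) f j i)%:R =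
    \prod_(j < m) \prod_(i < n) (f j i)%:R :> rat.
  by rewrite natr_prod; apply: eq_bigr => j _; rewrite natr_prod.
rewrite (cast (fun j i => (j.+1 + k * i)%N)) (cast (fun j i => (k * i.+1 + j)%N)).
transitivity (jdot k%:R (P2 rect) (P2 rect) * \prod_(j < m) \prod_(i < n) (j.+1%:R + k%:R * i%:R)).
  by congr (_ * _); apply: eq_bigr => j _; apply: eq_bigr => i _; rewrite natrD natrM.
rewrite H; apply: eq_bigr => j _; apply: eq_bigr => i _.
by rewrite natrD natrM.
Qed.

Lemma jack_b_rect : jack_b k%:R P2 rect =
    ((2 * (n - 1))`! * (n * k)`! * ((n - 1) * k)`!)%:R
      / (k * n`! * (n - 1)`! * ((2 * n - 1) * k - 1)`!)%:R.
Proof.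
have := norm_rect_prod.
have := rectangle_hooks (n - 1) k_gt0; rewrite -/m.
have -> : (n - 1).+1 = n by rewrite subn1 prednK.
set D := (\prod_(j < m) _)%N; set H := (\prod_(j < m) _)%N.
set a := (k * _ * _ * _)%N; set b := (_ * _ * _)%N.
have H0 : (0 < H)%N.
  by rewrite prodn_gt0 // => j; rewrite prodn_gt0 // => i; rewrite addn_gt0 muln_gt0 k_gt0.
have a0 : (0 < a)%N by rewrite !muln_gt0 k_gt0 !fact_gt0.
rewrite /jack_b => Dab; move: (jdot _ _ _) => N ND.
have H0' : (H%:R : rat) != 0 by rewrite Num.Theory.pnatr_eq0 -lt0n.
have a0' : (a%:R : rat) != 0 by rewrite Num.Theory.pnatr_eq0 -lt0n.
have N0 : N != 0 by apply: contraNneq H0' => N0; rewrite -ND N0 mul0r.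
apply: (mulfI N0); rewrite mulfV // mulrA; apply: (mulIf a0').
rewrite mul1r divfK //; apply: (mulfI H0').
by rewrite -{1}ND -mulrA -natrM Dab natrM mulrCA.
Qed.

(** The scalar product of the left side with P_nu becomes, after omega_k, the
    constant term of (omega_k P_nu)(X^v) Q_la(X^v) x^m W, that is, a multiple of
    <omega_k (P_nu P_(la')), omega_k P_rect>; removing the isometry omega_k gives
    the scalar product that defines the skew function. *)
Lemma integral_jackQ_dyson (la : intpart) :
  integral powersum (sfeval (finite_alphabet (@lvarV n)) (Q1 la) * F) =
  (W@_0 * (jack_b k%:R P2 rect)^-1) *: Q2skew rect (conj_part la).
Proof.
have [dla _] := duality la.
have k0' : (k%:R : rat)^-1 != 0 by rewrite invr_eq0.
have Kint f (G : laurent n) : jdot (k%:R)^-1 f (integral (signed_powersum k%:R) G) =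
    (sfeval (finite_alphabet (@lvarV n)) f * G)@_0.
  by apply: etrans _ (jdot_integral k0' f G); rewrite invrK.
apply: (jackP_eq k0 jackP2) => nu.
rewrite jdotZl skewQ2 jdotC -(omega_isometry k0) omega_integral Kint mulrA -rmorphM.
rewrite -Kint (integral_xpow_dyson_weight n m k_gt0 jackP1 jackQ1) -omega_rect -dla.
have -> : omega k%:R (P2 nu) * omega k%:R (P2 (conj_part la)) = omega k%:R (P2 (conj_part la) * P2 nu).
  by rewrite mulrC omegaM.
rewrite -omegaZ omega_isometry // jdotC jdotZl -mulrA; congr (_ * _).
by rewrite {1}(jackPE k0 jackP2 jackQ2 rect) jdotZl /jack_b invrK.
Qed.

End Corollary.

(* P1, Q1: Jack functions for alpha = 1/k; P2, Q2, Q2skew: for alpha = k. *)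
Theorem corollary4p2 (n k : nat) (hn : (1 <= n)%N) (hk : (1 <= k)%N)
    (A : comAlgType rat) (Y : alphabet A)
    (P1 Q1 P2 Q2 : intpart -> symfun) (Q2skew : intpart -> intpart -> symfun)
    (hP1 : is_jackP (k%:R)^-1 P1) (hQ1 : is_jackQ (k%:R)^-1 P1 Q1)
    (hP2 : is_jackP k%:R P2) (hQ2 : is_jackQ k%:R P2 Q2)
    (hS2 : is_skew_jackQ k%:R P2 Q2 Q2skew)
    (la : intpart) :
  let rect := rect_part n (k * (n - 1)) in
  integral Y (sfeval (finite_alphabet (@lvarV n)) (Q1 la)
                * vandermonde n ^+ (2 * k))
    = ((-1) ^+ ((k * n * (n - 1)) %/ 2)
         * ((n * k)`!%:R / k`!%:R ^+ n)
         * (jack_b k%:R P2 rect)^-1)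
      *: sfeval Y (Q2skew rect (conj_part la))
  /\
  jack_b k%:R P2 rect
    = ((2 * (n - 1))`! * (n * k)`! * ((n - 1) * k)`!)%:R
      / (k * n`! * (n - 1)`! * ((2 * n - 1) * k - 1)`!)%:R.
Proof.
move=> rect; split; last exact: (jack_b_rect hn hk hP1 hQ1 hP2 hQ2).
rewrite vandermonde_dyson -scalerAr integralZ integral_powersum.
have -> := integral_jackQ_dyson n hk hP1 hQ1 hP2 hQ2 hS2 la.
by rewrite sfevalZ scalerA -/rect mulrA coef0_dyson_weight.
Qed.
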